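(* Let $\lambda>0$ and let $h$ be a nonnegative Lipschitz function on $\mathbb{T}^1=\mathbb{R}/(2\pi\mathbb{Z})$. There exists $B_0\in\mathbb{R}$ (independent of $\varepsilon$) such that the solution $(A_\varepsilon^0,u_\varepsilon^0)$ of the Bernoulli problem $$\Delta u_\varepsilon^0=0 \text{ in } A_\varepsilon^0\setminus\overline{\Omega_0},\quad u_\varepsilon^0=1\text{ on }\partial\Omega_0,\quad u_\varepsilon^0=-\varepsilon B_0\text{ on }\partial A_\varepsilon^0,\quad |\nabla u_\varepsilon^0|=\lambda\text{ on }\partial A_\varepsilon^0$$ approaches the solution $(A_\varepsilon,u_\varepsilon)$ of the Bernoulli problem $$\Delta u_\varepsilon=0 \text{ in } A_\varepsilon\setminus\overline{\Omega_\varepsilon},\quad u_\varepsilon=1\text{ on }\partial\Omega_\varepsilon,\quad u_\varepsilon=0\text{ on }\partial A_\varepsilon,\quad |\nabla u_\varepsilon|=\lambda\text{ on }\partial A_\varepsilon$$ at order two, that is, $$\mathcal{D}_{\mathcal H}(A_\varepsilon^0,A_\varepsilon)=\mathcal{O}(\varepsilon^2)\quad\text{as }\varepsilon\to0.$$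
   Context: Functions on $\mathbb{T}^1$ are identified with $2\pi$-periodic functions on $\mathbb{R}$. The parameter $\varepsilon>0$ is such that $1/\varepsilon\in\mathbb{N}$ and $1/\varepsilon>\max_{\mathbb{T}^1}h$. In polar coordinates, $$\Omega_\varepsilon=\{(r,\theta)\in\mathbb{R}_+\times\mathbb{T}^1 : r<1-\varepsilon h(\theta/\varepsilon)\},\qquad \Omega_0=\mathcal{B}(0,1)\subset\mathbb{R}^2 .$$ Since $h\ge 0$, $\Omega_\varepsilon\subset\Omega_0$. In each Bernoulli problem the unknown is a pair consisting of a domain ($A_\varepsilon\supset\Omega_\varepsilon$, resp. $A_\varepsilon^0\supset\Omega_0$) and a function defined on that domain minus the closure of the given domain ($\Omega_\varepsilon$, resp. $\Omega_0$). The problem for $(A_\varepsilon,u_\varepsilon)$ is known to have a unique solution. Its domain $A_\varepsilon$ is bounded and starlike with respect to all points of an open ball centered at the origin, and $\partial A_\varepsilon$ is a graph $r=\rho_\varepsilon(\theta)$ of a Lipschitz function. The problem for $(A_\varepsilon^0,u_\varepsilon^0)$ has (for small $\varepsilon$) the explicit solution $A_\varepsilon^0=\mathcal{B}(0,\rho_\varepsilon^0)$ with $\lambda\rho_\varepsilon^0\ln\rho_\varepsilon^0=1+B_0\varepsilon$ and $u_\varepsilon^0(r,\theta)=(1+B_0\varepsilon)\frac{\ln\rho_\varepsilon^0-\ln r}{\ln\rho_\varepsilon^0}-B_0\varepsilon$. $\mathcal{D}_{\mathcal H}$ is the Hausdorff distance, $\mathcal{D}_{\mathcal H}(X,Y)=\max(\sup_{x\in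 X}d(x,Y),\sup_{y\in Y}d(y,X))$ with $d$ the Euclidean distance. *)

(* Defs.v *)
From HB Require Import structures.
From mathcomp Require Import all_boot all_order all_algebra.
From mathcomp Require Import all_classical all_reals all_analysis.
Import Order.TTheory GRing.Theory Num.Theory.
Import numFieldNormedType.Exports.

Set Implicit Arguments.
Unset Strict Implicit.
Unset Printing Implicit Defensive.

Local Open Scope classical_set_scope.
Local Open Scope ring_scope.

(* The plane is [R * R].  The library equips it with the sup norm, which has
   the same topology and the same directional derivatives as the Euclidean
   norm; wherever lengths matter, [enorm] is used instead of [`|_|]. *)

Section BernoulliProblem.
Variable R : realType.
Implicit Types (A U Om X Y : set (R * R)) (u f : R * R -> R) (p q : R * R).

Definition enorm p : R := Num.sqrt (p.1 ^+ 2 + p.2 ^+ 2).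

Definition e1 : R * R := (1, 0).
Definition e2 : R * R := (0, 1).

Definition grad u p : R * R := ('D_e1 u p, 'D_e2 u p).

Definition laplacian u p : R := 'D_e1 ('D_e1 u) p + 'D_e2 ('D_e2 u) p.

(* Only used for open [U]. *)
Definition C1_on U f : Prop :=
  forall p, U p ->
    [/\ derivable f p e1, derivable f p e2,
        {for p, continuous ('D_e1 f)} & {for p, continuous ('D_e2 f)}].

Definition C2_on U f : Prop :=
  [/\ C1_on U f, C1_on U ('D_e1 f) & C1_on U ('D_e2 f)].

Definition harmonic_on U u : Prop :=
  C2_on U u /\ (forall p, U p -> laplacian u p = 0).

Definition boundary A : set (R * R) := closure A `\` A°.

(* [(A, u)] is a classical solution of the exterior Bernoulli problem around
   [Om]: u is harmonic in A \ closure Om, u = 1 on the boundary of Om, and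
   u = c, |grad u| = lambda on the free boundary of A.
   - Only the values of [u] on [closure A `\` Om] are constrained.
   - [A] has to be bounded: the whole plane with u = 1 satisfies all the
     other clauses.
   - The gradient condition is a boundary limit from inside the domain of u. *)
Record bernoulli_solution (lambda c : R) Om A u : Prop := BernoulliSolution {
  bernoulli_open : open A;
  bernoulli_connected : connected A;
  bernoulli_bounded : bounded_set A;
  bernoulli_sub : Om `<=` A;
  bernoulli_harmonic : harmonic_on (A `\` closure Om) u;
  bernoulli_continuous : {within closure A `\` Om, continuous u};
  bernoulli_inner : forall p, boundary Om p -> u p = 1;
  bernoulli_outer : forall p, boundary A p -> u p = c;
  bernoulli_grad : forall p, boundary A p ->
    enorm (grad u q) @[q --> within (A `\` closure Om) (nbhs p)] --> lambda
}.

Definition Omega0 : set (R * R) := [set p | enorm p < 1].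

(* This is well defined on the circle when [e^-1] is a natural number and [h]
   is 2pi-periodic, since [theta |-> h (theta / e)] is then 2pi-periodic. *)
Definition Omega (h : R -> R) (e : R) : set (R * R) :=
  [set p | exists r theta, [/\ 0 <= r, r < 1 - e * h (theta / e)
                             & p = (r * cos theta, r * sin theta)]].

Definition dist_to p X : \bar R := ereal_inf [set (enorm (p - q))%:E | q in X].

Definition hausdorff_dist X Y : \bar R :=
  maxe (ereal_sup [set dist_to p Y | p in X])
       (ereal_sup [set dist_to q X | q in Y]).

End BernoulliProblem.

Arguments Omega0 : clear implicits.

(* Main.v *)
Require Import Defs.
From mathcomp Require Import all_boot all_order all_algebra.
From mathcomp Require Import ring lra.
From mathcomp Require Import all_classical all_reals all_analysis.
Import Order.TTheory GRing.Theory Num.Theory.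
Import numFieldNormedType.Exports.

Local Open Scope classical_set_scope.
Local Open Scope ring_scope.

(** The two free boundaries are compared through the distances from the origin
to the farthest and to the nearest boundary point.  At such a point the free
boundary is touched by a circle, from outside or from inside, and a one-sided
comparison of the potential with a function of the radius that has the same
value on the circle turns [|grad u| = lambda] into an inequality between
[lambda] and the radial slope ([outer_touch], [inner_touch]).  All
comparisons rest on the maximum principle.

For the disc, comparison with [ln r] bounds the outer radius from above and the
inner radius from below by the solution of [lambda * rho * ln rho = 1 + e * B0],
so that the domain is a disc up to its boundary ([disc_solution]).

For the oscillating obstacle, pass to logarithmic polar coordinates at the scale
of the oscillation, [x = exp (e (S + i Theta))].  The obstacle becomes the region
below a [2 pi]-periodic graph [S = - h(Theta) + O(e)], the free boundary lies at
height about [l / e], where [expR l] is the unperturbed radius, and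
[W = l / e * (1 - u)] is harmonic, vanishes on the graph and differs from [S] by a
bounded amount ([potential_bounds]).  If [W] were a boundary layer function with
asymptotics [alpha * (S + gamma)], the slope condition would read
[lambda * r * (ln r + e * gamma) = 1], which is the equation of the disc with
[B0 = - lambda * rho0 * gamma], up to [O(e ^ 2)].

Instead of solving the half-plane problem for the boundary layer, the proof
extracts [gamma] from the solutions themselves.  Averaging the potential of a
solution at a fine scale [e'] over the rotations that preserve the obstacle
yields a periodic function [V] above the graph, up to a height of order
[1 / e'] ([cell_average]).  A reflection argument shows that the oscillation of
[V] decays exponentially ([cell_oscillation]), so [V] is close to a line
[alpha * S + beta] ([cell_linear]).  For every coarser scale [e], comparison of
[W] with [V] near the obstacle and with chords above it bounds the outer radius
from above and the inner radius from below, with an error that amounts to [O(e)]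
in the shift [beta / alpha]
([outer_estimate], [inner_estimate], [fine_layer_shift]).  Hence the intervals
of length [O(e)] in which the solutions at the various scales locate the shift
intersect pairwise, and they have a common point [gamma], independent of [e]
([boundary_layer_shift]). *)

(** * Weak Laplacian and maximum principle *)

Section MaximumPrinciple.
Context {R : realType}.
Implicit Types (f g : R -> R) (F G : R * R -> R) (O K : set (R * R)).

Lemma is_derive_ext f g (x d : R) :
  (forall y, f y = g y) -> is_derive x 1 f d -> is_derive x 1 g d.
Proof. by move=> fg; have -> : f = g by apply/funext. Qed.

Lemma local_max_second_derivative f f1 (x a : R) :
  (\forall y \near x, is_derive (y : R) 1 f (f1 y)) -> is_derive x 1 f1 a ->
  (\forall y \near x, f y <= f x) -> a <= 0.
Proof.
move=> df df1 fmax; rewrite leNgt; apply/negP => a0.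
have /nbhs_ballP[r /= r0 rP] : \forall y \near x, is_derive (y : R) 1 f (f1 y) /\ f y <= f x.
  by near=> y; split; near: y.
have itvr y : y \in `]x - r, x + r[ -> ball x r y.
  by rewrite in_itv /= -ball_normE /= => /andP[h1 h2]; rewrite ltr_distl; lra.
have dfi y : y \in `]x - r, x + r[ -> derivable f y 1.
  by move=> /itvr/rP[[? _] _].
have xr : x \in `]x - r, x + r[ by rewrite in_itv /=; lra.
have f1x : f1 x = 0.
  have d0 : is_derive x 1 f 0.
    by apply: derive1_at_max dfi xr _; [lra|move=> t /itvr/rP[]].
  have /itvr/rP[[_ <-] _] := xr; exact: derive_val.
have /cvgrPdist_lt /(_ _ a0) : h^-1 *: ((f1 \o shift x) (h *: (1 : R)) - f1 x) @[h --> 0^'] --> a.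
  by case: df1 => df1 <-; exact: df1.
move=> /nbhs_ballP[s /= s0 sP].
have f1pos y : x < y < x + s -> 0 < f1 y.
  move=> /andP[xy ys].
  have := sP (y - x); rewrite -ball_normE /= sub0r normrN gtr0_norm; last lra.
  have h1 : y - x < s by lra.
  have h2 : y - x != 0 by rewrite subr_eq0 gt_eqF.
  move=> /(_ h1 h2); rewrite f1x subr0 [_%:A]mulr1 subrK => H.
  have: 0 < (y - x)^-1 *: f1 y.
    by move: H; rewrite ltr_distl; set v := (_ *: _); lra.
  by rewrite pmulr_rgt0 // invr_gt0; lra.
pose t := Num.min r s / 2.
have t0 : 0 < t by rewrite divr_gt0 // lt_min r0 s0.
have tr : t < r.
  by rewrite /t ltr_pdivrMr // gt_min; apply/orP; left; lra.
have ts : t < s.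
  by rewrite /t ltr_pdivrMr // gt_min; apply/orP; right; lra.
have xxt : x < x + t by lra.
have itvt y : y \in `[x, x + t] -> ball x r y.
  by rewrite in_itv /= => /andP[h1 h2]; apply: itvr; rewrite in_itv /=; lra.
have [|c|c] := @MVT _ f f1 x (x + t) xxt.
- move=> y yt; have /itvt/rP[] : y \in `[x, x + t]; last by [].
  by move: yt; rewrite !in_itv /=; lra.
- apply: derivable_within_continuous => y /itvt/rP[[? _] _]; exact.
- rewrite in_itv /= => ct E.
  have : 0 < f1 c by apply: f1pos; lra.
  have /itvt/rP[_] : x + t \in `[x, x + t] by rewrite in_itv /=; lra.
  rewrite -subr_le0 E addrAC subrr add0r => h1 h2.
  by have := mulr_gt0 h2 t0; lra.
Unshelve. all: by end_near. Qed.

(** Only one-variable derivatives along the two axes are recorded, without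
continuity, so that the notion is stable under the operations used below. *)
Definition has_lap O F G : Prop := exists F1 F2 F11 F22 : R * R -> R,
  forall z, O z ->
  [/\ is_derive z.1 1 (fun s => F (s, z.2)) (F1 z),
      is_derive z.2 1 (fun t => F (z.1, t)) (F2 z),
      is_derive z.1 1 (fun s => F1 (s, z.2)) (F11 z),
      is_derive z.2 1 (fun t => F2 (z.1, t)) (F22 z) &
      F11 z + F22 z = G z].


Lemma near_section1 (P : set (R * R)) (z : R * R) :
  nbhs z P -> \forall s \near z.1, P (s, z.2).
Proof.
move=> /nbhs_ballP[r /= r0 rP]; apply/nbhs_ballP; exists r => //= s sr.
by apply: rP; split => //=; exact: ballxx.
Qed.

Lemma near_section2 (P : set (R * R)) (z : R * R) :
  nbhs z P -> \forall t \near z.2, P (z.1, t).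
Proof.
move=> /nbhs_ballP[r /= r0 rP]; apply/nbhs_ballP; exists r => //= s sr.
by apply: rP; split => //=; exact: ballxx.
Qed.

Lemma lap_local_max_le0 O F G z : open O -> has_lap O F G -> O z ->
  (\forall y \near z, F y <= F z) -> G z <= 0.
Proof.
move=> oO [F1 [F2 [F11 [F22 H]]]] Oz zmax.
have nO : nbhs z O by exact: open_nbhs_nbhs.
have [_ _ d1 d2 <-] := H z Oz.
have a1 : F11 z <= 0.
  apply: (@local_max_second_derivative (fun s => F (s, z.2)) (fun s => F1 (s, z.2)) z.1) => //.
    by have := near_section1 _ _ nO; apply: filterS => s /H[].
  by have := near_section1 _ _ zmax; rewrite -surjective_pairing; apply: filterS.
have a2 : F22 z <= 0.
  apply: (@local_max_second_derivative (fun s => F (z.1, s)) (fun s => F2 (z.1, s)) z.2) => //.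
    by have := near_section2 _ _ nO; apply: filterS => s /H[].
  by have := near_section2 _ _ zmax; rewrite -surjective_pairing; apply: filterS.
lra.
Qed.

Lemma has_lapD O F G F' G' : has_lap O F G -> has_lap O F' G' ->
  has_lap O (fun z => F z + F' z) (fun z => G z + G' z).
Proof.
move=> [F1 [F2 [F11 [F22 H]]]] [F1' [F2' [F11' [F22' H']]]].
exists (fun z => F1 z + F1' z), (fun z => F2 z + F2' z),
  (fun z => F11 z + F11' z), (fun z => F22 z + F22' z) => z Oz.
have [a b c d <-] := H z Oz; have [a' b' c' d' <-] := H' z Oz.
split; [exact: is_deriveD|exact: is_deriveD|exact: is_deriveD|exact: is_deriveD|ring].
Qed.

Lemma has_lapZ O F G (k : R) : has_lap O F G ->
  has_lap O (fun z => k * F z) (fun z => k * G z).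
Proof.
move=> [F1 [F2 [F11 [F22 H]]]].
exists (fun z => k * F1 z), (fun z => k * F2 z),
  (fun z => k * F11 z), (fun z => k * F22 z) => z Oz.
have [a b c d <-] := H z Oz.
split; [exact: is_deriveZ|exact: is_deriveZ|exact: is_deriveZ|exact: is_deriveZ|ring].
Qed.

Lemma has_lap_subset O O' F G : O `<=` O' -> has_lap O' F G -> has_lap O F G.
Proof.
move=> OO' [F1 [F2 [F11 [F22 H]]]].
by exists F1, F2, F11, F22 => z /OO'/H.
Qed.

Lemma has_lap_fst O (f f1 f2 : R -> R) :
  (forall s : R, is_derive s 1 f (f1 s)) -> (forall s : R, is_derive s 1 f1 (f2 s)) ->
  has_lap O (fun z => f z.1) (fun z => f2 z.1).
Proof.
move=> df df1; exists (fun z => f1 z.1), (fun=> 0), (fun z => f2 z.1), (fun=> 0) => z _.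
split => //=; [exact: is_derive_cst|exact: is_derive_cst|by rewrite addr0].
Qed.

Lemma has_lap_affine O (a b : R) : has_lap O (fun z => a * z.1 + b) (fun=> 0).
Proof.
apply: (@has_lap_fst O (fun s => a * s + b) (fun=> a) (fun=> 0)) => s.
by apply: is_derive_eq; rewrite /GRing.scale /=; ring.
Qed.

(** Adding [eta * S^2] makes the function strictly subharmonic, so a positive
maximum can only sit outside [O].  The set [Kc] is a compact set that sees all
the values of [F] : one period of [K] in the applications. *)
Lemma max_principle K Kc O F G (M : R) :
  compact Kc -> Kc `<=` K ->
  (forall z, K z -> exists2 z', Kc z' & z'.1 = z.1 /\ F z' = F z) ->
  (forall z, K z -> `|z.1| <= M) ->
  open O -> O `<=` K -> has_lap O F G -> (forall z, O z -> 0 <= G z) ->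
  {within K, continuous F} ->
  (forall z, K z -> ~ O z -> F z <= 0) -> forall z, K z -> F z <= 0.
Proof.
move=> cKc KcK per KM oO OK lapF G0 cF bF z0 Kz0.
rewrite leNgt; apply/negP => Fz0.
have M0 : 0 <= M by apply: le_trans (KM _ Kz0); exact: normr_ge0.
pose eta := F z0 / (2 * (M ^+ 2 + 1)).
have M1 : 0 < M ^+ 2 + 1 by have := sqr_ge0 M; lra.
have eta0 : 0 < eta by rewrite /eta divr_gt0 // mulr_gt0.
pose H z := F z + eta * (z.1 ^+ 2 - M ^+ 2).
have HF z : K z -> H z <= F z.
  move=> /KM zM; rewrite /H gerDl pmulr_rle0 // subr_le0 -(real_normK (num_real z.1)).
  by rewrite lerXn2r // ?nnegrE.
have Hz0 : 0 < H z0.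
  have : eta * M ^+ 2 < F z0.
    rewrite /eta mulrAC -mulrA mulrC -mulrA -[ltRHS]mulr1; rewrite [X in X < _](_ : _ = F z0 * (M ^+ 2 / (2 * (M ^+ 2 + 1)))); last by ring.
    rewrite ltr_pM2l // ltr_pdivrMr; last lra.
    have := sqr_ge0 M; lra.
  have : 0 <= eta * z0.1 ^+ 2 by rewrite mulr_ge0 ?sqr_ge0 // ltW.
  rewrite /H; lra.
have cH : {within K, continuous H}.
  apply: within_continuousD => //.
  apply: continuous_subspaceT => z.
  apply: cvgM; first exact: cvg_cst.
  apply: cvgB; last exact: cvg_cst.
  rewrite expr2; under eq_cvg do rewrite expr2.
  by apply: cvgM; exact: cvg_fst.
have [z0' Kcz0' [z0'1 z0'F]] := per _ Kz0.
have Kc0 : Kc !=set0 by exists z0'.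
have cHc : {within Kc, continuous H} by apply: continuous_subspaceW cH.
have [z1 /set_mem Kcz1 z1max] := compact_EVT_max Kc0 cKc cHc.
have {}z1max z : K z -> H z <= H z1.
  move=> /per[z' Kcz' [e1 e2]]; have := z1max z'; rewrite inE => /(_ Kcz').
  by rewrite {1}/H e1 e2.
have Kz1 := KcK _ Kcz1.
have Oz1 : O z1.
  apply: contrapT => /(bF _ Kz1) H1.
  have := z1max _ Kz0; have := HF _ Kz1; lra.
have lapH : has_lap O H (fun z => G z + eta * 2).
  apply: has_lapD => //; apply: has_lapZ.
  apply: (@has_lap_fst O (fun s => s ^+ 2 - M ^+ 2) (fun s => 2 * s) (fun=> 2)) => s.
    by apply: is_derive_eq; rewrite /GRing.scale /=; ring.
  by apply: is_derive_eq; rewrite /GRing.scale /=; ring.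
have := @lap_local_max_le0 O H _ z1 oO lapH Oz1 _.
have /[swap]/[apply] : \forall y \near z1, H y <= H z1.
  have := open_nbhs_nbhs (conj oO Oz1).
  by apply: filterS => y /OK/z1max.
have := G0 _ Oz1; lra.
Qed.

End MaximumPrinciple.

(** * Chain rule and logarithmic polar coordinates *)

Section ChainRule.
Context {R : realType}.
Implicit Types (f u : R * R -> R) (U : set (R * R)) (p q z : R * R).

Lemma cvg_to_pair (T : Type) (F : set_system T) (FF : Filter F) (x y : T -> R) p :
  x @ F --> p.1 -> y @ F --> p.2 -> (fun t => (x t, y t)) @ F --> p.
Proof. by case: p => a b /= xa yb; exact: (cvg_pair xa yb). Qed.

Lemma is_derive_near_caratheodory (f g : R -> R) (x a : R) :
  (\forall y \near x, f y - f x = g y * (y - x)) ->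
  {for x, continuous g} -> g x = a -> is_derive x 1 f a.
Proof.
move=> fg cg gx; apply/is_derive1_caratheodory.
pose k y := if y == x then a else (f y - f x) / (y - x).
have kx : k x = a by rewrite /k eqxx.
exists k; split => //.
  move=> y; rewrite /k; case: eqP => [->|/eqP]; first by rewrite !subrr mulr0.
  by rewrite -subr_eq0 => /divfK ->.
suff H : k @ x --> a by move: H; rewrite -kx.
rewrite -gx; apply: cvg_trans cg; apply: near_eq_cvg.
near=> y; rewrite /k; case: eqP => [->//|/eqP yx].
have -> : f y - f x = g y * (y - x) by near: y.
by rewrite mulfK // subr_eq0.
Unshelve. all: by end_near. Qed.

Lemma is_derive_continuous (f : R -> R) (x d : R) :
  is_derive x 1 f d -> {for x, continuous f}.
Proof. by move=> [/derivable1_diffP/differentiable_continuous]. Qed.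

Lemma is_derive_cast (f : R -> R) (x d d' : R) :
  is_derive x 1 f d -> d = d' -> is_derive x 1 f d'.
Proof. by move=> fd <-. Qed.

Lemma mvt_between (f df : R -> R) (x y : R) :
  (forall t : R, `|t - x| <= `|y - x| -> is_derive t 1 f (df t)) ->
  exists2 c, `|c - x| <= `|y - x| & f y - f x = df c * (y - x).
Proof.
move=> d; have [xy|yx] := leP x y.
- have xy' t : t \in `[x, y] -> `|t - x| <= `|y - x|.
    by rewrite in_itv /= => /andP[h1 h2]; rewrite !ger0_norm; lra.
  have [||c cxy E] := @MVT_segment _ f df x y xy.
  + by move=> t /subset_itv_oo_cc/xy'/d.
  + by apply: derivable_within_continuous => t /xy'/d [].
  by exists c => //; apply: xy'.
- have xy' t : t \in `[y, x] -> `|t - x| <= `|y - x|.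
    by rewrite in_itv /= => /andP[h1 h2]; rewrite !ler0_norm; lra.
  have [||c cxy E] := @MVT_segment _ f df y x (ltW yx).
  + by move=> t /subset_itv_oo_cc/xy'/d.
  + by apply: derivable_within_continuous => t /xy'/d [].
  by exists c; [apply: xy'|rewrite -[LHS]opprB E; ring].
Qed.

Lemma is_derive_e1 f p : derivable f p (e1 R) ->
  is_derive p.1 1 (fun s => f (s, p.2)) ('D_(e1 R) f p).
Proof.
move=> d.
have E : (fun h : R => h^-1 *: ((f \o shift p) (h *: e1 R) - f p)) =
   (fun h : R => h^-1 *: (((fun s => f (s, p.2)) \o shift p.1) (h *: (1 : R)) - f (p.1, p.2))).
  apply/funext => h /=; congr (_ *: (f _ - f _)); last by case: (p).
  by rewrite /e1; case: (p) => a b; congr (_, _); rewrite /= ?scaler0 ?add0r.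
by split; rewrite /derivable /derive -E.
Qed.

Lemma is_derive_e2 f p : derivable f p (e2 R) ->
  is_derive p.2 1 (fun s => f (p.1, s)) ('D_(e2 R) f p).
Proof.
move=> d.
have E : (fun h : R => h^-1 *: ((f \o shift p) (h *: e2 R) - f p)) =
   (fun h : R => h^-1 *: (((fun s => f (p.1, s)) \o shift p.2) (h *: (1 : R)) - f (p.1, p.2))).
  apply/funext => h /=; congr (_ *: (f _ - f _)); last by case: (p).
  by rewrite /e2; case: (p) => a b; congr (_, _); rewrite /= ?scaler0 ?add0r.
by split; rewrite /derivable /derive -E.
Qed.

(** Two applications of the mean value theorem, along the two sides of an
axis-parallel path from [p] to [q]. *)
Lemma C1_caratheodory U f p : open U -> C1_on U f -> U p ->
  exists a b : R * R -> R,
  [/\ {for p, continuous a}, {for p, continuous b},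
      a p = 'D_(e1 R) f p, b p = 'D_(e2 R) f p &
      \forall q \near p, f q - f p = a q * (q.1 - p.1) + b q * (q.2 - p.2)].
Proof.
move=> oU fC1 Up.
have /nbhs_ballP[r /= r0 rU] : nbhs p U by exact: open_nbhs_nbhs.
have H1 q : exists x, ball p r q -> `|x - p.1| <= `|q.1 - p.1| /\
    f q - f (p.1, q.2) = 'D_(e1 R) f (x, q.2) * (q.1 - p.1).
  have [bq|] := pselect (ball p r q); last by exists 0.
  have [|c c1 c2] := @mvt_between (fun s => f (s, q.2)) (fun s => 'D_(e1 R) f (s, q.2)) p.1 q.1.
    move=> t tq; have /fC1[d _ _ _] : U (t, q.2); last exact: (is_derive_e1 _ (t, q.2)).
    apply: rU; case: bq => b1 b2; split => //=.
    by move: b1; rewrite -!ball_normE /= ![`|p.1 - _|]distrC; exact: le_lt_trans.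
  by exists c => _; split => //; rewrite -c2 -surjective_pairing.
have H2 q : exists y, ball p r q -> `|y - p.2| <= `|q.2 - p.2| /\
    f (p.1, q.2) - f p = 'D_(e2 R) f (p.1, y) * (q.2 - p.2).
  have [bq|] := pselect (ball p r q); last by exists 0.
  have [|c c1 c2] := @mvt_between (fun s => f (p.1, s)) (fun s => 'D_(e2 R) f (p.1, s)) p.2 q.2.
    move=> t tq; have /fC1[_ d _ _] : U (p.1, t); last exact: (is_derive_e2 _ (p.1, t)).
    apply: rU; case: bq => b1 b2; split => //=; first exact: ballxx.
    by move: b2; rewrite -!ball_normE /= ![`|p.2 - _|]distrC; exact: le_lt_trans.
  by exists c => _; split => //; rewrite -c2 -surjective_pairing.
have [xi xiP] := choice H1; have [eta etaP] := choice H2.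
have [_ _ c1 c2] := fC1 p Up.
have pp : ball p r p by exact: ballxx.
have xip : xi p = p.1.
  have [+ _] := xiP p pp; rewrite subrr normr0 normr_le0 subr_eq0.
  by move/eqP.
have etap : eta p = p.2.
  have [+ _] := etaP p pp; rewrite subrr normr0 normr_le0 subr_eq0.
  by move/eqP.
exists (fun q => 'D_(e1 R) f (xi q, q.2)), (fun q => 'D_(e2 R) f (p.1, eta q)).
split.
- suff H : (fun q => 'D_(e1 R) f (xi q, q.2)) @ p --> 'D_(e1 R) f (xi p, p.2) by exact: H.
  rewrite xip -surjective_pairing.
  apply: (@cvg_comp _ _ _ (fun q => (xi q, q.2)) ('D_(e1 R) f) (nbhs p) (nbhs p) (nbhs ('D_(e1 R) f p)) _ c1).
  apply: cvg_to_pair => /=; last exact: cvg_snd.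
  apply/cvgrPdist_lt => e e0.
  have : \forall q \near p, ball p (Num.min r e) q.
    by apply: nbhsx_ballx; rewrite lt_min r0.
  apply: filterS => q bq.
  have bqr : ball p r q by apply: le_ball bq; rewrite ge_min lexx.
  have [qx _] := xiP q bqr; rewrite distrC; apply: le_lt_trans qx _.
  have [+ _] := bq; rewrite -ball_normE /= distrC => /lt_le_trans; apply.
  by rewrite ge_min lexx orbT.
- suff H : (fun q => 'D_(e2 R) f (p.1, eta q)) @ p --> 'D_(e2 R) f (p.1, eta p) by exact: H.
  rewrite etap -surjective_pairing.
  apply: (@cvg_comp _ _ _ (fun q => (p.1, eta q)) ('D_(e2 R) f) (nbhs p) (nbhs p) (nbhs ('D_(e2 R) f p)) _ c2).
  apply: cvg_to_pair => /=; first exact: cvg_cst.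
  apply/cvgrPdist_lt => e e0.
  have : \forall q \near p, ball p (Num.min r e) q.
    by apply: nbhsx_ballx; rewrite lt_min r0.
  apply: filterS => q bq.
  have bqr : ball p r q by apply: le_ball bq; rewrite ge_min lexx.
  have [qx _] := etaP q bqr; rewrite distrC; apply: le_lt_trans qx _.
  have [_ +] := bq; rewrite -ball_normE /= distrC => /lt_le_trans; apply.
  by rewrite ge_min lexx orbT.
- by rewrite xip -surjective_pairing.
- by rewrite etap -surjective_pairing.
apply/nbhs_ballP; exists r => //= q bq.
have [_ <-] := xiP q bq; have [_ <-] := etaP q bq.
ring.
Qed.

Lemma chain_curve U f p (x y : R -> R) (t dx dy : R) :
  open U -> C1_on U f -> U p -> (x t, y t) = p ->
  is_derive t 1 x dx -> is_derive t 1 y dy ->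
  is_derive t 1 (fun s => f (x s, y s)) ('D_(e1 R) f p * dx + 'D_(e2 R) f p * dy).
Proof.
move=> oU fC1 Up xyp dX dY.
have cxt : x @ t --> x t by exact: is_derive_continuous dX.
have cyt : y @ t --> y t by exact: is_derive_continuous dY.
have /is_derive1_caratheodory[gx [Ex cx gxt]] := dX.
have /is_derive1_caratheodory[gy [Ey cy gyt]] := dY.
have [a [b [ca cb aE bE E]]] := C1_caratheodory _ _ _ oU fC1 Up.
have cxy : (x s, y s) @[s --> t] --> p by apply: cvg_to_pair; rewrite -xyp.
apply: (@is_derive_near_caratheodory _ (fun s => a (x s, y s) * gx s + b (x s, y s) * gy s)).
- have E' : \forall s \near t, f (x s, y s) - f p = a (x s, y s) * (x s - p.1) + b (x s, y s) * (y s - p.2).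
    exact: (cxy _ E).
  apply: filterS E' => s; rewrite -{1}xyp => ->; rewrite -xyp /= Ex Ey; ring.
- have ca' : a (x s, y s) @[s --> t] --> a (x t, y t).
    by rewrite xyp; apply: cvg_comp cxy ca.
  have cb' : b (x s, y s) @[s --> t] --> b (x t, y t).
    by rewrite xyp; apply: cvg_comp cxy cb.
  by apply: cvgD; apply: cvgM.
- by rewrite xyp aE bE gxt gyt.
Qed.

(** Logarithmic polar coordinates: the complex exponential at scale [e], a
conformal covering of the punctured plane. *)
Definition logpolar (e : R) z : R * R :=
  (expR (e * z.1) * cos (e * z.2), expR (e * z.1) * sin (e * z.2)).

Lemma logpolar_continuous e : continuous (logpolar e).
Proof.
move=> z.
have c1 : (fun z : R * R => e * z.1) @ z --> e * z.1 by apply: cvgM; [exact: cvg_cst|exact: cvg_fst].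
have c2 : (fun z : R * R => e * z.2) @ z --> e * z.2 by apply: cvgM; [exact: cvg_cst|exact: cvg_snd].
have c3 : (fun z : R * R => expR (e * z.1)) @ z --> expR (e * z.1) by apply: cvg_comp c1 _; exact: continuous_expR.
apply: cvg_to_pair => /=; apply: cvgM => //.
  by apply: cvg_comp c2 _; exact: continuous_cos.
by apply: cvg_comp c2 _; exact: continuous_sin.
Qed.

(** Conformal invariance.  Each of the two mixed second derivatives cancels
against itself, and the Laplacian gets multiplied by the square of the conformal
factor. *)
Lemma harmonic_logpolar U u e : open U -> harmonic_on U u ->
  has_lap (logpolar e @^-1` U) (u \o logpolar e) (fun=> 0).
Proof.
move=> oU [[C1u C1u1 C1u2] lap0].
pose x z := (logpolar e z).1; pose y z := (logpolar e z).2.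
have dx1 z : is_derive z.1 1 (fun s => x (s, z.2)) (e * x z).
  by rewrite /x /y /logpolar /=; apply: is_derive_eq; rewrite /GRing.scale /=; ring.
have dx2 z : is_derive z.2 1 (fun s => x (z.1, s)) (- (e * y z)).
  by rewrite /x /y /logpolar /=; apply: is_derive_eq; rewrite /GRing.scale /=; ring.
have dy1 z : is_derive z.1 1 (fun s => y (s, z.2)) (e * y z).
  by rewrite /x /y /logpolar /=; apply: is_derive_eq; rewrite /GRing.scale /=; ring.
have dy2 z : is_derive z.2 1 (fun s => y (z.1, s)) (e * x z).
  by rewrite /x /y /logpolar /=; apply: is_derive_eq; rewrite /GRing.scale /=; ring.
have xyE z : (x z, y z) = logpolar e z by rewrite /x /y -surjective_pairing.
clearbody x y.
have xyE' z : (x (z.1, z.2), y (z.1, z.2)) = logpolar e z.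
  by rewrite -surjective_pairing xyE.
have chain1 f z : C1_on U f -> U (logpolar e z) ->
    is_derive z.1 1 (fun s => f (logpolar e (s, z.2)))
      ('D_(e1 R) f (logpolar e z) * (e * x z) + 'D_(e2 R) f (logpolar e z) * (e * y z)).
  move=> C1f Uz; have := chain_curve _ f _ (fun s => x (s, z.2)) (fun s => y (s, z.2)) z.1 _ _ oU C1f Uz (xyE' z) (dx1 z) (dy1 z).
  apply: is_derive_ext => s.
  exact: (congr1 f (xyE _)).
have chain2 f z : C1_on U f -> U (logpolar e z) ->
    is_derive z.2 1 (fun s => f (logpolar e (z.1, s)))
      ('D_(e1 R) f (logpolar e z) * (- (e * y z)) + 'D_(e2 R) f (logpolar e z) * (e * x z)).
  move=> C1f Uz; have := chain_curve _ f _ (fun s => x (z.1, s)) (fun s => y (z.1, s)) z.2 _ _ oU C1f Uz (xyE' z) (dx2 z) (dy2 z).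
  apply: is_derive_ext => s.
  exact: (congr1 f (xyE _)).
pose u1 := 'D_(e1 R) u; pose u2 := 'D_(e2 R) u.
pose E := logpolar e.
exists (fun z => e * (u1 (E z) * x z + u2 (E z) * y z)),
  (fun z => e * (u2 (E z) * x z - u1 (E z) * y z)).
exists (fun z => e * (('D_(e1 R) u1 (E z) * (e * x z) + 'D_(e2 R) u1 (E z) * (e * y z)) * x z
   + u1 (E z) * (e * x z)
   + ('D_(e1 R) u2 (E z) * (e * x z) + 'D_(e2 R) u2 (E z) * (e * y z)) * y z
   + u2 (E z) * (e * y z))).
exists (fun z => e * (('D_(e1 R) u2 (E z) * (- (e * y z)) + 'D_(e2 R) u2 (E z) * (e * x z)) * x z
   + u2 (E z) * (- (e * y z))
   - ('D_(e1 R) u1 (E z) * (- (e * y z)) + 'D_(e2 R) u1 (E z) * (e * x z)) * y z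
   - u1 (E z) * (e * x z))).
move=> z Uz; split.
- apply: is_derive_cast (chain1 u z C1u Uz) _; rewrite /u1 /u2 /E;
  ring.
- apply: is_derive_cast (chain2 u z C1u Uz) _; rewrite /u1 /u2 /E;
  ring.
- have d1 := chain1 u1 z C1u1 Uz; have d2 := chain1 u2 z C1u2 Uz.
  have dx := dx1 z; have dy := dy1 z.
  apply: is_derive_cast (is_deriveZ e (is_deriveD (is_deriveM d1 dx) (is_deriveM d2 dy))) _.
  rewrite -!surjective_pairing /GRing.scale /= -/(E z).
  by generalize (x z) (y z) (u1 (E z)) (u2 (E z)) ('D_(e1 R) u1 (E z)) ('D_(e2 R) u1 (E z)) ('D_(e1 R) u2 (E z)) ('D_(e2 R) u2 (E z)) => *; ring.
- have d1 := chain2 u1 z C1u1 Uz; have d2 := chain2 u2 z C1u2 Uz.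
  have dx := dx2 z; have dy := dy2 z.
  apply: is_derive_cast (is_deriveZ e (is_deriveB (is_deriveM d2 dx) (is_deriveM d1 dy))) _.
  rewrite -!surjective_pairing /GRing.scale /= -/(E z).
  by generalize (x z) (y z) (u1 (E z)) (u2 (E z)) ('D_(e1 R) u1 (E z)) ('D_(e2 R) u1 (E z)) ('D_(e1 R) u2 (E z)) ('D_(e2 R) u2 (E z)) => *; ring.
- have := lap0 _ Uz; rewrite /laplacian -/u1 -/u2 -/E => L.
  transitivity (e ^+ 2 * (('D_(e1 R) u1 (E z) + 'D_(e2 R) u2 (E z)) * (x z ^+ 2 + y z ^+ 2))).
    by generalize (x z) (y z) (u1 (E z)) (u2 (E z)) ('D_(e1 R) u1 (E z)) ('D_(e2 R) u1 (E z)) ('D_(e1 R) u2 (E z)) ('D_(e2 R) u2 (E z)) => *; ring.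
  by rewrite L mul0r mulr0.
Qed.

End ChainRule.

(** * Euclidean norm and outer contact with the free boundary *)

Section FreeBoundary.
Context {R : realType}.
Implicit Types (u : R * R -> R) (A U Om : set (R * R)) (p q x : R * R).

Lemma within_comp {T U V : topologicalType} (K : set T) (D : set U)
    (f : T -> U) (g : U -> V) :
  continuous f -> K `<=` f @^-1` D -> {within D, continuous g} ->
  {within K, continuous (g \o f)}.
Proof.
move=> cf KD /subspace_continuousP cg; apply/subspace_continuousP => x Kx P nP.
have := cg _ (KD _ Kx) _ nP; rewrite /= !nbhs_simpl /within /= => nD.
have := cf x _ nD; rewrite /= nbhs_simpl /=.
by apply: filterS => z /= DP Kz; apply: DP; exact: KD.
Qed.

Lemma enorm_ge0 p : 0 <= enorm p. Proof. exact: sqrtr_ge0. Qed.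

Lemma enorm_sqr p : enorm p ^+ 2 = p.1 ^+ 2 + p.2 ^+ 2.
Proof. by rewrite sqr_sqrtr // addr_ge0 // sqr_ge0. Qed.

Lemma enormN p : enorm (- p) = enorm p.
Proof. by rewrite /enorm /= !sqrrN. Qed.

Lemma enormZ (k : R) p : enorm (k * p.1, k * p.2) = `|k| * enorm p.
Proof. by rewrite /enorm /= !exprMn -mulrDr sqrtrM ?sqr_ge0 // sqrtr_sqr. Qed.

Lemma le_of_sqr (a b : R) : 0 <= b -> a ^+ 2 <= b ^+ 2 -> a <= b.
Proof.
move=> b0 ab; have [a0|a0] := leP 0 a; last lra.
by rewrite -(ler_pXn2r (n := 2)) // nnegrE.
Qed.

Lemma cauchy_schwarz p q : p.1 * q.1 + p.2 * q.2 <= enorm p * enorm q.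
Proof.
apply: le_of_sqr; first by rewrite mulr_ge0 ?enorm_ge0.
rewrite exprMn !enorm_sqr; have := sqr_ge0 (p.1 * q.2 - p.2 * q.1); nra.
Qed.

Lemma enorm_triangle p q : enorm (p + q) <= enorm p + enorm q.
Proof.
apply: le_of_sqr; first by rewrite addr_ge0 ?enorm_ge0.
rewrite sqrrD !enorm_sqr /=; have := cauchy_schwarz p q.
lra.
Qed.

Lemma enormB_le p q : enorm p - enorm q <= enorm (p - q).
Proof. by have := enorm_triangle (p - q) q; rewrite subrK; lra. Qed.

Lemma enormBC p q : enorm (p - q) = enorm (q - p).
Proof. by rewrite -enormN opprB. Qed.

Lemma enorm0_eq p : enorm p = 0 -> p = 0.
Proof.
move=> p0; have := enorm_sqr p; rewrite p0 expr0n /= => /esym/eqP.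
rewrite paddr_eq0 ?sqr_ge0 // !sqrf_eq0 => /andP[/eqP e1 /eqP e2].
by rewrite [p]surjective_pairing e1 e2.
Qed.

Lemma normr1_le_enorm p : `|p.1| <= enorm p.
Proof.
apply: le_of_sqr (enorm_ge0 _) _; rewrite enorm_sqr real_normK ?num_real //.
by rewrite lerDl sqr_ge0.
Qed.

Lemma normr2_le_enorm p : `|p.2| <= enorm p.
Proof.
apply: le_of_sqr (enorm_ge0 _) _; rewrite enorm_sqr real_normK ?num_real //.
by rewrite lerDr sqr_ge0.
Qed.

Lemma enorm_ball p q (r : R) : enorm (q - p) < r -> ball p r q.
Proof.
move=> qp; split; rewrite -ball_normE /= distrC; apply: le_lt_trans qp.
  exact: (normr1_le_enorm (q - p)).
exact: (normr2_le_enorm (q - p)).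
Qed.

Lemma ball_enorm p q (r : R) : ball p r q -> enorm (q - p) < 2 * r.
Proof.
move=> [b1 b2]; have r0 : 0 < r by move: b1; rewrite -ball_normE /=; apply: le_lt_trans.
rewrite -(ltr_pXn2r (n := 2)) ?nnegrE ?enorm_ge0 //; last by rewrite mulr_ge0 // ltW.
rewrite enorm_sqr /=.
have s1 : (q.1 - p.1) ^+ 2 <= r ^+ 2.
  move: b1; rewrite -ball_normE /= distrC -(real_normK (num_real _)) => /ltW b1.
  by rewrite lerXn2r // nnegrE // ltW.
have s2 : (q.2 - p.2) ^+ 2 <= r ^+ 2.
  move: b2; rewrite -ball_normE /= distrC -(real_normK (num_real _)) => /ltW b2.
  by rewrite lerXn2r // nnegrE // ltW.
have := exprn_gt0 2 r0; lra.
Qed.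

Lemma near_enorm p (P : set (R * R)) : (\forall q \near p, P q) <->
  exists2 r : R, 0 < r & forall q, enorm (q - p) < r -> P q.
Proof.
split=> [/nbhs_ballP[r /= r0 rP]|[r r0 rP]].
  by exists r => // q /enorm_ball/rP.
apply/nbhs_ballP; exists (r / 2); first by rewrite /= divr_gt0.
by move=> q /ball_enorm; rewrite mulrC divfK // => /rP.
Qed.

Lemma enorm_continuous : continuous (@enorm R).
Proof.
move=> p; apply/cvgrPdist_lt => e e0; apply/near_enorm; exists e => // q qp.
have := enormB_le p q; have := enormB_le q p; rewrite (enormBC p) ltr_norml; lra.
Qed.

Lemma closed_enorm_le (r : R) : closed [set p : R * R | enorm p <= r].
Proof.
exact: (@preimage_closed _ _ (@enorm R) [set t : R | t <= r] (fun t _ => enorm_continuous t) (@closed_le R r)).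
Qed.

Lemma compact_enorm_le K (r : R) : closed K -> (forall p : R * R, K p -> enorm p <= r) -> compact K.
Proof.
move=> cK Kr; have cc : compact ([set` `[- r, r]] `*` [set` `[- r, r]]).
  by apply: compact_setX; exact: segment_compact.
apply: subclosed_compact cK cc _ => p /Kr pr; split; rewrite /= in_itv /= -ler_norml.
  exact: le_trans (normr1_le_enorm p) pr.
exact: le_trans (normr2_le_enorm p) pr.
Qed.

Lemma fermat_local_max (f : R -> R) (x d : R) :
  (\forall y \near x, derivable f y 1) -> (\forall y \near x, f y <= f x) ->
  is_derive x 1 f d -> d = 0.
Proof.
move=> df fmax [_ <-].
have /nbhs_ballP[r /= r0 rP] : \forall y \near x, derivable f y 1 /\ f y <= f x.
  by near=> y; split; near: y.
have itvr y : y \in `]x - r, x + r[ -> ball x r y.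
  by rewrite in_itv /= -ball_normE /= => /andP[h1 h2]; rewrite ltr_distl; lra.
have xr : x \in `]x - r, x + r[ by rewrite in_itv /=; lra.
have d0 : is_derive x 1 f 0.
  apply: (@derive1_at_max _ f (x - r) (x + r) x) xr _; first lra.
    by move=> t /itvr/rP[].
  by move=> t /itvr/rP[].
exact: derive_val.
Unshelve. all: by end_near. Qed.

Lemma is_derive_sqrt_sqrD (a x : R) {k : R} : 0 < k ->
  is_derive x 1 (fun s => Num.sqrt ((s - a) ^+ 2 + k))
    ((x - a) / Num.sqrt ((x - a) ^+ 2 + k)).
Proof.
move=> k0; have P : 0 < (x - a) ^+ 2 + k by rewrite ltr_wpDl ?sqr_ge0.
have d1 : is_derive x 1 (fun s : R => (s - a) ^+ 2 + k) (2 * (x - a)).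
  by apply: is_derive_eq; rewrite /GRing.scale /=; ring.
have d2 := @is_derive1_comp _ Num.sqrt (fun s => (s - a) ^+ 2 + k) x _ _ (is_derive1_sqrt P) d1.
apply: (is_derive_cast (fun s => Num.sqrt ((s - a) ^+ 2 + k)) x _ _ d2).
by rewrite /=; field; rewrite gt_eqF // sqrtr_gt0.
Qed.

(** On the free boundary the two boundary values would clash. *)
Lemma closure_obstacle_sub lambda c Om A u : c < 1 ->
  bernoulli_solution lambda c Om A u -> closure Om `<=` A.
Proof.
move=> c1 B p clp; apply: contrapT => nAp.
have nOp : ~ Om p by move=> /(bernoulli_sub B).
have bp : boundary Om p by split=> // /interior_subset.
have bAp : boundary A p.
  by split; [apply: closureS clp; exact: bernoulli_sub B|move=> /interior_subset].
have := bernoulli_inner B bp; rewrite (bernoulli_outer B bAp); lra.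
Qed.


Lemma boundary_notin A p : open A -> boundary A p -> ~ A p.
Proof. by move=> /interior_id oA [_]; rewrite oA. Qed.

Lemma notin_boundary A p : closure A p -> ~ A p -> boundary A p.
Proof. by move=> clp nAp; split => // /interior_subset. Qed.

Lemma open_domain A Om : open A -> open (A `\` closure Om).
Proof. by move=> oA; rewrite setDE; apply: openI => //; rewrite openC; exact: closed_closure. Qed.

(** Growth at an outer contact point.  As [|grad u|] stays close to [lambda],
[u] cannot be dominated near [p] by a cone of smaller slope: maximise [u] minus
a smoothed cone [k1 * sqrt (|x - q| ^ 2 + t ^ 2)] with vertex [q] in [A] close
to [p].  The maximum is neither on the boundary of [A], where [u] is minimal,
nor at an interior point, where the gradient would be shorter than [k1]; so it
is reached at distance [eta] from [q], where [u] exceeds the bound. *)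
Lemma outer_touch lambda c Om A u p (r K0 : R) : c < 1 -> 0 < r -> 0 <= K0 ->
  bernoulli_solution lambda c Om A u -> boundary A p -> enorm p = r ->
  (forall x, (A `\` closure Om) x -> c <= u x) ->
  (forall x, A x -> enorm x <= r) ->
  (\forall x \near p, (A `\` closure Om) x ->
     u x <= c + K0 * (ln r - ln (enorm x))) ->
  lambda <= K0 / r.
Proof.
move=> c1 r0 K00 B bp pr uc Ar ub; rewrite leNgt; apply/negP => Kl.
have oA := bernoulli_open B.
pose k1 := (K0 / r + lambda) / 2; pose k2 := (K0 / r + k1) / 2.
have Kr0 : 0 <= K0 / r by rewrite divr_ge0 // ltW.
have k12 : k2 < k1 by rewrite /k2 /k1; lra.
have Kk2 : K0 / r < k2 by rewrite /k2 /k1; lra.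
have k1l : k1 < lambda by rewrite /k1; lra.
have k20 : 0 < k2 by lra.
have k10 : 0 < k1 by lra.
have npO : ~ closure Om p by move=> /(closure_obstacle_sub _ _ _ _ _ c1 B); exact: boundary_notin.
have nclO : \forall x \near p, ~ closure Om x.
  have oC : open (~` closure Om) by rewrite openC; exact: closed_closure.
  exact: (open_nbhs_nbhs (conj oC npO)).
have grad_near : \forall x \near p, (A `\` closure Om) x -> k1 < enorm (grad u x).
  have l0 : 0 < lambda - k1 by lra.
  have /cvgrPdist_lt/(_ _ l0) := bernoulli_grad B bp.
  rewrite near_withinE; apply: filterS => x H Ax.
  by have := H Ax; rewrite ltr_distl; lra.
have /near_enorm[rho rho0 rhoP] : \forall x \near p, [/\ ~ closure Om x,
   (A `\` closure Om) x -> k1 < enorm (grad u x) &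
   (A `\` closure Om) x -> u x <= c + K0 * (ln r - ln (enorm x))].
  by near=> x; split; near: x.
(* [3 * eta] is small enough for [K0 / (r - 3 * eta) <= k2]. *)
pose eta := Num.min (rho / 3) ((r - K0 / k2) / 3).
have Kk2r : K0 / k2 < r by rewrite ltr_pdivrMr // mulrC -ltr_pdivrMr.
have eta0 : 0 < eta by rewrite lt_min; apply/andP; split; lra.
have eta_rho : 3 * eta <= rho.
  by have : eta <= rho / 3; [rewrite ge_min lexx|lra].
have eta_r : 3 * eta <= r - K0 / k2.
  by have : eta <= (r - K0 / k2) / 3; [rewrite ge_min lexx orbT|lra].
have K0k2 : 0 <= K0 / k2 by rewrite divr_ge0 // ltW.
have cone x : A x -> enorm (x - p) < 3 * eta -> u x - c <= k2 * enorm (x - p).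
  move=> Ax xp; have [nO _ /(_ (conj Ax nO)) uxb] := rhoP x (lt_le_trans xp eta_rho).
  have xr := Ar _ Ax.
  have rx : r - enorm x <= enorm (x - p) by rewrite -pr enormBC; exact: enormB_le.
  have xK : K0 / k2 < enorm x by lra.
  have x0 : 0 < enorm x by lra.
  have lnx : ln r - ln (enorm x) <= (r - enorm x) / enorm x.
    rewrite -ln_div ?posrE //.
    have -> : r / enorm x = 1 + (r - enorm x) / enorm x by rewrite mulrBl divff ?gt_eqF // addrC subrK.
    by apply: le_ln1Dx; apply: lt_le_trans (_ : 0 <= _); rewrite ?ltrN10 // divr_ge0 //; lra.
  have K0x : K0 / enorm x <= k2.
    by rewrite ler_pdivrMr // mulrC -ler_pdivrMr // ltW.
  have : K0 * (ln r - ln (enorm x)) <= K0 * ((r - enorm x) / enorm x) by rewrite ler_wpM2l.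
  have -> : K0 * ((r - enorm x) / enorm x) = (K0 / enorm x) * (r - enorm x) by ring.
  have : K0 / enorm x * (r - enorm x) <= k2 * (r - enorm x) by rewrite ler_wpM2r //; lra.
  have : k2 * (r - enorm x) <= k2 * enorm (x - p) by rewrite ler_wpM2l // ltW.
  lra.
pose t := (k1 - k2) * eta / (2 * (k1 + k2)).
have k12p : 0 < k1 + k2 by lra.
have t0 : 0 < t by rewrite divr_gt0 ?mulr_gt0 //; lra.
have tk : t * (2 * (k1 + k2)) = (k1 - k2) * eta by rewrite /t divfK // gt_eqF // mulr_gt0.
have tk0 : 0 < t * (k1 + k2) by rewrite mulr_gt0.
have teta : t < eta.
  rewrite -(ltr_pM2r (x := k1 + k2)) //; have : 0 < k2 * eta by rewrite mulr_gt0. 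
  by lra.
have [q [Aq qp]] : exists q, A q /\ enorm (q - p) < t.
  have [clp _] := bp.
  have /clp[q [Aq qp]] : nbhs p [set q | enorm (q - p) < t].
    by apply/near_enorm; exists t.
  by exists q.
have near2 x : enorm (x - q) <= eta -> enorm (x - p) < 3 * eta.
  move=> xq; have := enorm_triangle (x - q) (q - p); rewrite addrA subrK; lra.
have nO x : enorm (x - q) <= eta -> ~ closure Om x.
  by move=> /near2 xp; have [] := rhoP x (lt_le_trans xp eta_rho).
pose psi x := Num.sqrt (enorm (x - q) ^+ 2 + t ^+ 2).
have psi_arg x : 0 < enorm (x - q) ^+ 2 + t ^+ 2.
  by rewrite ltr_wpDl // ?sqr_ge0 // exprn_gt0.
have psi0 x : 0 < psi x by rewrite sqrtr_gt0.
have psi2 x : psi x ^+ 2 = enorm (x - q) ^+ 2 + t ^+ 2 by rewrite sqr_sqrtr // ltW.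
have psiq : psi q = t by rewrite /psi subrr /enorm /= expr0n /= addr0 sqrtr0 expr0n /= add0r sqrtr_sqr gtr0_norm.
pose phi x := u x - k1 * psi x.
pose D := closure A `&` [set x | enorm (x - q) <= eta].
have cDist : continuous (fun x : R * R => enorm (x - q)).
  move=> x; have cB : (fun x : R * R => x - q) @ x --> x - q by apply: cvgB; [exact: cvg_id|exact: cvg_cst].
  by apply: cvg_comp cB _; exact: enorm_continuous.
have cD : compact D.
  apply: (@compact_enorm_le _ (eta + enorm q)).
    apply: closedI; first exact: closed_closure.
    exact: (@preimage_closed _ _ (fun x => enorm (x - q)) [set s : R | s <= eta] (fun x _ => cDist x) (@closed_le R eta)).
  by move=> x [_ /= xq]; have := enorm_triangle (x - q) q; rewrite subrK; lra.
have Dq : D q.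
  by split; [exact: subset_closure|rewrite /= subrr /enorm /= expr0n /= addr0 sqrtr0 ltW].
have cpsi : continuous psi.
  move=> x; have c2 : (fun x : R * R => enorm (x - q) ^+ 2 + t ^+ 2) @ x --> enorm (x - q) ^+ 2 + t ^+ 2.
    by apply: cvgD; [apply: cvgM; exact: cDist|exact: cvg_cst].
  by apply: cvg_comp c2 _; exact: sqrt_continuous.
have cphi : {within D, continuous phi}.
  apply: within_continuousB.
    apply: continuous_subspaceW (bernoulli_continuous B) => x [clx /nO xO].
    by split => // Ox; apply: xO; exact: subset_closure.
  by apply: continuous_subspaceT => x; apply: cvgM; [exact: cvg_cst|exact: cpsi].
have [y /set_mem[cly yq] ymax] := compact_EVT_max (ex_intro _ q Dq) cD cphi.
have {}ymax x : D x -> phi x <= phi y by move=> Dx; apply: ymax; rewrite inE.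
have Aq' : (A `\` closure Om) q by split => //; apply: nO; rewrite subrr /enorm /= expr0n /= addr0 sqrtr0 ltW.
have uq := uc _ Aq'.
have Ay : A y.
  apply: contrapT => nAy.
  have uy := bernoulli_outer B (notin_boundary _ _ cly nAy).
  have := ymax _ Dq; rewrite /phi uy psiq => h.
  have : k1 * psi y <= k1 * t by lra.
  rewrite ler_pM2l // => psiyt.
  have : psi y ^+ 2 <= t ^+ 2 by rewrite lerXn2r // nnegrE ltW.
  rewrite psi2 gerDr => y0.
  have : enorm (y - q) = 0 by apply/eqP; rewrite -sqrf_eq0 eq_le y0 sqr_ge0.
  by move=> /enorm0_eq/eqP; rewrite subr_eq0 => /eqP yq0; apply: nAy; rewrite yq0.
have yO : (A `\` closure Om) y by split => //; exact: nO.
move: yq; rewrite /= le_eqVlt => /orP[/eqP yq|yq].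
- have uy : u y - c <= k2 * (eta + t).
    apply: le_trans (cone _ Ay _) _; first by apply: near2; rewrite yq.
    rewrite ler_wpM2l //; first exact: ltW.
    have := enorm_triangle (y - q) (q - p); rewrite addrA subrK; lra.
  have psiy : eta <= psi y.
    apply: le_of_sqr; first exact: ltW.
    by rewrite psi2 yq lerDl sqr_ge0.
  have := ymax _ Dq; rewrite /phi psiq => h.
  have : k1 * eta <= k1 * psi y by rewrite ler_pM2l.
  lra.
- have [_ grady _] : [/\ ~ closure Om y, (A `\` closure Om) y -> k1 < enorm (grad u y) &
   (A `\` closure Om) y -> u y <= c + K0 * (ln r - ln (enorm y))].
    by apply: rhoP; have := near2 y (ltW yq); lra.
  have {}grady := grady yO.
  pose W := A `\` closure Om.
  have oW : open W by exact: open_domain.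
  have [[C1u _ _] _] := bernoulli_harmonic B.
  have locmax : \forall x \near y, phi x <= phi y.
    have oB : open [set x | enorm (x - q) < eta].
      exact: (@open_comp _ _ (fun x => enorm (x - q)) [set s : R | s < eta] (fun x _ => cDist x) (@open_lt R eta)).
    have : \forall x \near y, A x /\ enorm (x - q) < eta.
      exact: filterI (open_nbhs_nbhs (conj oA Ay)) (open_nbhs_nbhs (conj oB yq)).
    apply: filterS => x [Ax xq]; apply: ymax; split; first exact: subset_closure.
    exact: ltW.
  have nW : nbhs y W by exact: open_nbhs_nbhs.
  have dpsi1 x : is_derive x.1 1 (fun s => psi (s, x.2)) ((x.1 - q.1) / psi x).
    have k0 : 0 < (x.2 - q.2) ^+ 2 + t ^+ 2 by rewrite ltr_wpDl ?sqr_ge0 ?exprn_gt0.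
    have E s : Num.sqrt ((s - q.1) ^+ 2 + ((x.2 - q.2) ^+ 2 + t ^+ 2)) = psi (s, x.2).
      by rewrite /psi enorm_sqr addrA.
    apply: (is_derive_ext _ _ _ _ E); apply: is_derive_cast (is_derive_sqrt_sqrD q.1 x.1 k0) _.
    by rewrite E -surjective_pairing.
  have dpsi2 x : is_derive x.2 1 (fun s => psi (x.1, s)) ((x.2 - q.2) / psi x).
    have k0 : 0 < (x.1 - q.1) ^+ 2 + t ^+ 2 by rewrite ltr_wpDl ?sqr_ge0 ?exprn_gt0.
    have E s : Num.sqrt ((s - q.2) ^+ 2 + ((x.1 - q.1) ^+ 2 + t ^+ 2)) = psi (x.1, s).
      by rewrite /psi enorm_sqr addrCA addrA.
    apply: (is_derive_ext _ _ _ _ E); apply: is_derive_cast (is_derive_sqrt_sqrD q.2 x.2 k0) _.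
    by rewrite E -surjective_pairing.
  have dphi1 x : W x -> is_derive x.1 1 (fun s => phi (s, x.2)) ('D_(e1 R) u x - k1 * ((x.1 - q.1) / psi x)).
    by move=> /C1u[d _ _ _]; exact: (is_deriveB (is_derive_e1 _ _ d) (is_deriveZ k1 (dpsi1 x))).
  have dphi2 x : W x -> is_derive x.2 1 (fun s => phi (x.1, s)) ('D_(e2 R) u x - k1 * ((x.2 - q.2) / psi x)).
    by move=> /C1u[_ d _ _]; exact: (is_deriveB (is_derive_e2 _ _ d) (is_deriveZ k1 (dpsi2 x))).
  have g1 : 'D_(e1 R) u y - k1 * ((y.1 - q.1) / psi y) = 0.
    apply: fermat_local_max (dphi1 _ yO).
      by have := near_section1 _ _ nW; apply: filterS => s Ws; have [] := dphi1 _ Ws.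
    by have := near_section1 _ _ locmax; rewrite -surjective_pairing; apply: filterS.
  have g2 : 'D_(e2 R) u y - k1 * ((y.2 - q.2) / psi y) = 0.
    apply: fermat_local_max (dphi2 _ yO).
      by have := near_section2 _ _ nW; apply: filterS => s Ws; have [] := dphi2 _ Ws.
    by have := near_section2 _ _ locmax; rewrite -surjective_pairing; apply: filterS.
  have E : enorm (grad u y) ^+ 2 * psi y ^+ 2 = k1 ^+ 2 * enorm (y - q) ^+ 2.
    rewrite !enorm_sqr /=.
    move/eqP: g1; rewrite subr_eq0 => /eqP ->; move/eqP: g2; rewrite subr_eq0 => /eqP ->.
    by field; rewrite gt_eqF.
  have : k1 ^+ 2 * psi y ^+ 2 < enorm (grad u y) ^+ 2 * psi y ^+ 2.
    by rewrite ltr_pM2r ?exprn_gt0 // ltr_pXn2r // nnegrE ?enorm_ge0 // ltW.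
  rewrite E ltr_pM2l ?exprn_gt0 // psi2; have := exprn_gt0 2 t0; lra.
Unshelve. all: by end_near. Qed.

End FreeBoundary.

(** * Inner contact with the free boundary *)

Section InnerTouch.
Context {R : realType}.
Implicit Types (u : R * R -> R) (A U Om : set (R * R)) (p q x : R * R).

(** At an inner contact point the segment to the origin lies in [A], and the
mean value theorem along it bounds the growth of [u] by [lambda]. *)
Lemma inner_touch lambda c Om A u p (r K0 : R) : c < 1 -> 0 < r -> 0 <= K0 ->
  bernoulli_solution lambda c Om A u -> boundary A p -> enorm p = r ->
  (forall x, enorm x < r -> A x) ->
  (\forall x \near p, enorm x < r -> c + K0 * (ln r - ln (enorm x)) <= u x) ->
  K0 / r <= lambda.
Proof.
move=> c1 r0 K00 B bp pr rA lb; rewrite leNgt; apply/negP => Kl.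
have oA := bernoulli_open B.
have npO : ~ closure Om p.
  by move=> /(closure_obstacle_sub _ _ _ _ _ c1 B); exact: boundary_notin.
pose k1 := (K0 / r + lambda) / 2.
have [k1K lk1] : k1 < K0 / r /\ lambda < k1 by rewrite /k1; split; lra.
have k1r : k1 * r < K0 by rewrite -ltr_pdivlMr.
have nclO : \forall x \near p, ~ closure Om x.
  have oC : open (~` closure Om) by rewrite openC; exact: closed_closure.
  exact: (open_nbhs_nbhs (conj oC npO)).
have grad_near : \forall x \near p, (A `\` closure Om) x -> enorm (grad u x) < k1.
  have l0 : 0 < k1 - lambda by lra.
  have /cvgrPdist_lt/(_ _ l0) := bernoulli_grad B bp.
  rewrite near_withinE; apply: filterS => x H Ax.
  by have := H Ax; rewrite ltr_distl; lra.
have /near_enorm[rho rho0 rhoP] : \forall x \near p, [/\ ~ closure Om x,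
   (A `\` closure Om) x -> enorm (grad u x) < k1 &
   enorm x < r -> c + K0 * (ln r - ln (enorm x)) <= u x].
  by near=> x; split; near: x.
pose t1 := Num.min (1 / 2) (rho / (2 * r)).
have t10 : 0 < t1 by rewrite lt_min; apply/andP; split; rewrite divr_gt0 // mulr_gt0.
have t1h : t1 <= 1 / 2 by rewrite ge_min lexx.
have t1r : t1 * r < rho.
  have : t1 <= rho / (2 * r) by rewrite ge_min lexx orbT.
  by rewrite ler_pdivlMr ?mulr_gt0 //; lra.
pose g (t : R) : R * R := ((1 - t) * p.1, (1 - t) * p.2).
have gr t : 0 <= t <= t1 -> enorm (g t) = (1 - t) * r.
  by move=> /andP[a b]; rewrite enormZ pr ger0_norm //; lra.
have gp t : 0 <= t <= t1 -> enorm (g t - p) < rho.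
  move=> /andP[a b]; have -> : g t - p = ((- t) * p.1, (- t) * p.2).
    rewrite [X in _ - X]surjective_pairing; congr (_, _) => /=; ring.
  rewrite enormZ pr normrN ger0_norm //; apply: le_lt_trans t1r.
  by rewrite ler_pM2r.
have gA t : 0 < t <= t1 -> A (g t).
  move=> /andP[a b]; apply: rA; rewrite gr; last lra.
  by rewrite gtr_pMl //; lra.
have g0 : g 0 = p by rewrite /g subr0 !mul1r -surjective_pairing.
have gdom t : 0 <= t <= t1 -> (closure A `\` Om) (g t).
  move=> ht; have [nO _ _] := rhoP _ (gp _ ht).
  split; last by move=> /subset_closure.
  have [t0|t0] := ltP 0 t; first by apply/subset_closure/gA; lra.
  have -> : t = 0 by lra.
  by rewrite g0; case: bp.
have [[C1u _ _] _] := bernoulli_harmonic B.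
have oW := open_domain A Om oA.
have gW t : 0 < t <= t1 -> (A `\` closure Om) (g t).
  by move=> ht; split; [exact: gA|have [|//] := rhoP (g t); apply: gp; lra].
have dg1 (t : R) : is_derive t 1 (fun t => (1 - t) * p.1) (- p.1).
  by apply: is_derive_eq; rewrite /GRing.scale /=; ring.
have dg2 (t : R) : is_derive t 1 (fun t => (1 - t) * p.2) (- p.2).
  by apply: is_derive_eq; rewrite /GRing.scale /=; ring.
pose df t := 'D_(e1 R) u (g t) * (- p.1) + 'D_(e2 R) u (g t) * (- p.2).
have du t : 0 < t <= t1 -> is_derive t 1 (fun t => u (g t)) (df t).
  move=> /gW Wt; have := (chain_curve _ u (g t) (fun t => (1 - t) * p.1) (fun t => (1 - t) * p.2) t _ _ oW C1u Wt erefl (dg1 t) (dg2 t)); exact.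
have cg : continuous g.
  by move=> t; apply: cvg_to_pair; [exact: (is_derive_continuous _ _ _ (dg1 t))|exact: (is_derive_continuous _ _ _ (dg2 t))].
have [||t tt1 E] := @MVT _ (fun t => u (g t)) df 0 t1 t10.
- by move=> t; rewrite in_itv /= => ht; apply: du; lra.
- have gK : [set` `[0, t1]] `<=` g @^-1` (closure A `\` Om).
    by move=> t /=; rewrite in_itv /=; exact: gdom.
  exact: within_comp _ _ g u cg gK (bernoulli_continuous B).
move: tt1; rewrite in_itv /= => tt1.
have Wt : (A `\` closure Om) (g t) by apply: gW; lra.
have [_ /(_ Wt) gradt _] : [/\ ~ closure Om (g t),
   (A `\` closure Om) (g t) -> enorm (grad u (g t)) < k1 &
   enorm (g t) < r -> c + K0 * (ln r - ln (enorm (g t))) <= u (g t)].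
  by apply/rhoP/gp; lra.
have dft : df t <= k1 * r.
  have := cauchy_schwarz (grad u (g t)) (- p); rewrite enormN pr /= => h.
  apply: le_trans h _; rewrite ler_pM2r //; exact: ltW.
have [_ _] : [/\ ~ closure Om (g t1),
   (A `\` closure Om) (g t1) -> enorm (grad u (g t1)) < k1 &
   enorm (g t1) < r -> c + K0 * (ln r - ln (enorm (g t1))) <= u (g t1)].
  by apply/rhoP/gp; lra.
have ht1 : 0 <= t1 <= t1 by lra.
have l1 : 0 < 1 - t1 by lra.
rewrite gr //; have -> : (1 - t1) * r < r by rewrite gtr_pMl //; lra.
move=> /(_ isT); rewrite lnM ?posrE // => lb1.
have ln1 : ln (1 - t1) <= - t1 by apply: le_ln1Dx; lra.
have K1 : K0 * t1 <= K0 * (ln r - (ln (1 - t1) + ln r)) by rewrite ler_wpM2l //; lra.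
move: E; rewrite g0 (bernoulli_outer B bp) subr0 => E.
have h1 : df t * t1 <= k1 * r * t1 by rewrite ler_pM2r.
have h2 : k1 * r * t1 < K0 * t1 by rewrite ltr_pM2r.
lra.
Unshelve. all: by end_near. Qed.

End InnerTouch.

(** * Polar coordinates as a covering *)

Section PolarCoordinates.
Context {R : realType}.
Implicit Types (p q x z w : R * R).

Lemma logpolar_enorm (e : R) z : enorm (logpolar e z) = expR (e * z.1).
Proof.
have := enormZ (expR (e * z.1)) (cos (e * z.2), sin (e * z.2)).
rewrite /logpolar /= => ->; rewrite -[enorm _]ger0_norm ?enorm_ge0 // -[`|enorm _|]sqrtr_sqr enorm_sqr /= cos2Dsin2 sqrtr1 mulr1.
by rewrite ger0_norm // expR_ge0.
Qed.

Lemma polar_surj x : exists t, x = (enorm x * cos t, enorm x * sin t).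
Proof.
have [x0|x0] := eqVneq (enorm x) 0.
  by exists 0; rewrite x0 !mul0r; exact: enorm0_eq.
have r0 : 0 < enorm x by rewrite lt0r x0 enorm_ge0.
pose a := x.1 / enorm x.
have a1 : -1 <= a <= 1.
  rewrite -ler_norml normrM normfV (gtr0_norm r0) ler_pdivrMr // mul1r.
  exact: normr1_le_enorm.
have ca : enorm x * cos (acos a) = x.1.
  by rewrite acosK // mulrC divfK.
have sa : enorm x * sin (acos a) = `|x.2|.
  apply/eqP; rewrite -(eqrXn2 (n := 2)) //; last first.
    by rewrite mulr_ge0 ?enorm_ge0 // sin_acos // sqrtr_ge0.
  apply/eqP; rewrite exprMn sin2cos2 mulrBr mulr1 -exprMn ca real_normK ?num_real //.
  by rewrite enorm_sqr addrC addKr.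
have [x2|x2] := leP 0 x.2.
  by exists (acos a); rewrite ca sa ger0_norm // -surjective_pairing.
exists (- acos a); rewrite cosN sinN ca mulrN sa ltr0_norm // opprK.
exact: surjective_pairing.
Qed.

Lemma mulr_divK (e y : R) : 0 < e -> e * (y / e) = y.
Proof. by move=> e0; rewrite mulrC divfK // gt_eqF. Qed.

Lemma logpolar_surj (e : R) x : 0 < e -> x != 0 -> exists z, logpolar e z = x.
Proof.
move=> e0 x0; have [t xt] := polar_surj x.
have r0 : 0 < enorm x.
  by rewrite lt0r enorm_ge0 andbT; apply: contra_neq x0; exact: enorm0_eq.
exists (ln (enorm x) / e, t / e).
by rewrite /logpolar /= !mulr_divK // lnK ?posrE.
Qed.

Lemma logpolar_periodic (e P : R) z : e * P = pi *+ 2 ->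
  logpolar e (z.1, z.2 + P) = logpolar e z.
Proof. by move=> eP; rewrite /logpolar /= mulrDr eP sinD2pi cosD2pi. Qed.

Lemma periodic_shift {T : Type} (f : R -> T) (P : R) (n : nat) t :
  (forall s, f (s + P) = f s) -> f (t + n%:R * P) = f t.
Proof.
move=> fP; elim: n => [|n IH]; first by rewrite mul0r addr0.
by rewrite -natr1 mulrDl mul1r addrA fP.
Qed.

Lemma shift_into_period (P : R) (t : R) : 0 < P ->
  exists m k : nat, 0 <= t + m%:R * P - k%:R * P < P.
Proof.
move=> P0; pose m := (Num.truncn (`|t| / P)).+1.
have tm : 0 <= t + m%:R * P.
  have /truncn_itv/andP[_] : 0 <= `|t| / P by rewrite divr_ge0 // ltW.
  rewrite -/m ltr_pdivrMr // => h; have := ler_norm (- t); rewrite normrN; lra.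
exists m, (Num.truncn ((t + m%:R * P) / P)).
have /truncn_itv/andP[] : 0 <= (t + m%:R * P) / P by rewrite divr_ge0 // ltW.
rewrite ler_pdivlMr // ltr_pdivrMr // -natr1 => h1 h2; lra.
Qed.

Lemma periodic_reduce {T : Type} (f : R -> T) (P : R) t : 0 < P ->
  (forall s, f (s + P) = f s) -> exists2 s, 0 <= s < P & f t = f s.
Proof.
move=> P0 fP; have [m [k mk]] := shift_into_period P t P0.
exists (t + m%:R * P - k%:R * P) => //.
by rewrite -(periodic_shift f P m t fP) -[in RHS](periodic_shift f P k _ fP) subrK.
Qed.

(** Cosine and sine determine the angle up to the period of [f]. *)
Lemma periodic_angle {T : Type} (f : R -> T) a b :
  (forall s, f (s + pi *+ 2) = f s) -> cos a = cos b -> sin a = sin b -> f a = f b.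
Proof.
move=> fP cab sab.
have p2 : 0 < (pi : R) *+ 2 by rewrite mulrn_wgt0 // pi_gt0.
have [m [k]] := shift_into_period (pi *+ 2) (a - b) p2.
set d := _ - _ => dP.
have cd : cos d = 1.
  rewrite -(periodic_shift cos (pi *+ 2) k d (@cosD2pi R)) subrK.
  by rewrite (periodic_shift cos (pi *+ 2) m _ (@cosD2pi R)) cosB cab sab -!expr2 cos2Dsin2.
have d0 : d = 0.
  have p0 := @pi_gt0 R; have z0 : 0 \in `[0 : R, pi] by rewrite in_itv /=; lra.
  have [dpi|dpi] := leP d pi.
    by apply: cos_inj => //; rewrite ?cos0 // in_itv /=; move: dP; rewrite -mulr_natl; lra.
  have : pi *+ 2 - d = 0.
    apply: cos_inj => //; first by rewrite in_itv /=; move: dP; rewrite -mulr_natl; lra.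
    by rewrite cos0 -cosN opprB -cd -[in RHS](subrK (pi *+ 2) d) cosD2pi.
  lra.
have -> : a = b + k%:R * (pi *+ 2) - m%:R * (pi *+ 2) by rewrite /d in d0; lra.
by rewrite -(periodic_shift f _ m _ fP) subrK (periodic_shift f _ k _ fP).
Qed.

(** The local inverse is the polar angle measured from the direction of the
image point, so that [atan] suffices. *)
Lemma logpolar_open (e : R) (W : set (R * R)) : 0 < e -> open W ->
  open (logpolar e @` W).
Proof.
move=> e0 oW; rewrite openE => _ [z Wz <-]; rewrite /interior /=.
set p := logpolar e z.
pose C := cos (e * z.2); pose S := sin (e * z.2).
have CS : C ^+ 2 + S ^+ 2 = 1 by exact: cos2Dsin2.
pose X q := q.1 * C + q.2 * S; pose Y q := q.2 * C - q.1 * S.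
pose w q := (ln (enorm q) / e, z.2 + atan (Y q / X q) / e).
have Xp : X p = expR (e * z.1).
  rewrite /X /p /logpolar /= -/C -/S; transitivity (expR (e * z.1) * (C ^+ 2 + S ^+ 2)); first ring.
  by rewrite CS mulr1.
have Yp : Y p = 0 by rewrite /Y /p /logpolar /= -/C -/S; ring.
have Xp0 : 0 < X p by rewrite Xp expR_gt0.
have wp : w p = z.
  rewrite /w Yp mul0r atan0 mul0r addr0 logpolar_enorm expRK mulrC mulKf ?gt_eqF //.
  exact/esym/surjective_pairing.
have cX : {for p, continuous X}.
  by apply: cvgD; apply: cvgM; try exact: cvg_cst; [exact: cvg_fst|exact: cvg_snd].
have cY : {for p, continuous Y}.
  by apply: cvgB; apply: cvgM; try exact: cvg_cst; [exact: cvg_snd|exact: cvg_fst].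
have cw : w q @[q --> p] --> z.
  rewrite -wp; apply: cvg_to_pair => /=.
    apply: cvgM; last exact: cvg_cst.
    have cl : {for enorm p, continuous (@ln R)}.
      by apply: continuous_ln; rewrite logpolar_enorm expR_gt0.
    exact: (@cvg_comp _ _ _ (@enorm R) (@ln R) _ _ _ (@enorm_continuous R p) cl).
  apply: cvgD; first exact: cvg_cst.
  apply: cvgM; last exact: cvg_cst.
  have cYX : Y q / X q @[q --> p] --> Y p / X p.
    by apply: cvgM => //; apply: cvgV => //; rewrite gt_eqF.
  by apply: cvg_comp cYX _; exact: continuous_atan.
have nearX : \forall q \near p, 0 < X q.
  have /cvgrPdist_lt/(_ _ Xp0) := cX; apply: filterS => q; rewrite ltr_distl; lra.
have nearW : \forall q \near p, W (w q).
  by apply: cw; exact: (open_nbhs_nbhs (conj oW Wz)).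
have : \forall q \near p, W (w q) /\ 0 < X q by near=> q; split; near: q.
apply: filterS => q [Ww Xq]; exists (w q) => //.
have XY : X q ^+ 2 + Y q ^+ 2 = enorm q ^+ 2.
  rewrite enorm_sqr /X /Y; transitivity ((q.1 ^+ 2 + q.2 ^+ 2) * (C ^+ 2 + S ^+ 2)); first ring.
  by rewrite CS mulr1.
have q0 : 0 < enorm q.
  rewrite lt0r enorm_ge0 andbT -sqrf_eq0 -XY gt_eqF // ltr_pwDl ?sqr_ge0 //.
  exact: exprn_gt0.
have ca : enorm q * cos (atan (Y q / X q)) = X q.
  rewrite cos_atan.
  have -> : 1 + (Y q / X q) ^+ 2 = (enorm q / X q) ^+ 2.
    by rewrite !expr_div_n -XY mulrDl divff // expf_neq0 // gt_eqF.
  by rewrite sqrtr_sqr gtr0_norm ?divr_gt0 // invf_div mulrC divfK // gt_eqF.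
have sa : enorm q * sin (atan (Y q / X q)) = Y q.
  have : tan (atan (Y q / X q)) = Y q / X q by exact: atanK.
  have c0 : cos (atan (Y q / X q)) != 0.
    by apply: contra_eq_neq ca => ->; rewrite mulr0 lt_eqF.
  rewrite /tan => /(congr1 (fun y => y * cos (atan (Y q / X q)))); rewrite divfK // => ->.
  by rewrite mulrCA ca divfK // gt_eqF.
rewrite /logpolar /w /= mulr_divK // lnK ?posrE //.
rewrite mulrDr mulr_divK // cosD sinD -/C -/S.
rewrite mulrBr mulrDr ![enorm q * (_ * _)]mulrCA ca sa.
rewrite [RHS]surjective_pairing; congr (_, _).
  transitivity (q.1 * (C ^+ 2 + S ^+ 2)); [rewrite /X /Y; ring|by rewrite CS mulr1].
transitivity (q.2 * (C ^+ 2 + S ^+ 2)); [rewrite /X /Y; ring|by rewrite CS mulr1].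
Unshelve. all: by end_near. Qed.

End PolarCoordinates.

(** * Comparison in logarithmic coordinates *)

Section LogarithmicDomain.
Context {R : realType}.
Implicit Types (u : R * R -> R) (A Om K O : set (R * R)) (p q x z : R * R).

Lemma periodic_max_principle K O (F G : R * R -> R) (P a b : R) :
  0 < P -> closed K -> (forall z, K z -> a <= z.1 <= b) ->
  (forall s t, K (s, t + P) = K (s, t)) ->
  (forall s t, F (s, t + P) = F (s, t)) ->
  open O -> O `<=` K -> has_lap O F G -> (forall z, O z -> 0 <= G z) ->
  {within K, continuous F} ->
  (forall z, K z -> ~ O z -> F z <= 0) -> forall z, K z -> F z <= 0.
Proof.
move=> P0 clK Kab perK perF oO OK lapF G0 cF bF.
pose Kc := K `&` ([set` `[a, b]] `*` [set` `[0, P]]).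
have cKc : compact Kc.
  have cc : compact ([set` `[a, b]] `*` [set` `[0, P]]).
    by apply: compact_setX; exact: segment_compact.
  by rewrite /Kc setIC; exact: compact_closedI.
apply: (max_principle K Kc O F G (Num.max `|a| `|b|)) => //.
- exact: subIsetl.
- move=> [s t] Kz.
  have [t' t'P [eK eF]] := periodic_reduce (fun t => (K (s, t), F (s, t))) P t P0
    (fun t => congr2 pair (perK s t) (perF s t)).
  exists (s, t'); last by split => //; rewrite -eF.
  have Kt' : K (s, t') by rewrite -eK.
  split => //; split; rewrite /= in_itv /=; first exact: (Kab _ Kt').
  by case/andP: t'P => -> /ltW ->.
- move=> z /Kab/andP[az zb]; rewrite le_max.
  have [z0|z0] := leP 0 z.1.
    by apply/orP; right; rewrite ger0_norm // (le_trans zb) // ler_norm.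
  by apply/orP; left; rewrite ltr0_norm // -normrN (le_trans _ (ler_norm _)) // lerN2.
Qed.

Definition logdom (e : R) Om A : set (R * R) :=
  logpolar e @^-1` (closure A `\` Om).

Definition logint (e : R) Om A : set (R * R) :=
  logpolar e @^-1` (A `\` closure Om).

Lemma logdom_closed e Om A : open Om -> closed (logdom e Om A).
Proof.
move=> oO; apply: preimage_closed; first by move=> z _; exact: logpolar_continuous.
by rewrite setDE; apply: closedI; [exact: closed_closure|exact: open_closedC].
Qed.

Lemma logint_open e Om A : open A -> open (logint e Om A).
Proof.
by move=> oA; apply: open_comp; [move=> z _; exact: logpolar_continuous|exact: open_domain].
Qed.

Lemma logint_sub e Om A : logint e Om A `<=` logdom e Om A.
Proof. by move=> z [Az nO]; split; [exact: subset_closure|move=> /subset_closure]. Qed.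

Lemma logdom_periodic (e P : R) Om A s t : e * P = pi *+ 2 ->
  logdom e Om A (s, t + P) = logdom e Om A (s, t).
Proof.
by move=> eP; rewrite /logdom /preimage /mkset (logpolar_periodic e P (s, t) eP).
Qed.

Lemma logdom_boundary lambda c Om A u (e : R) z : bernoulli_solution lambda c Om A u ->
  logdom e Om A z -> ~ logint e Om A z ->
  (u (logpolar e z) = 1 /\ closure Om (logpolar e z)) \/
  (u (logpolar e z) = c /\ ~ A (logpolar e z)).
Proof.
move=> B [clA nO] nW.
have [Az|nAz] := pselect (A (logpolar e z)).
  have clO : closure Om (logpolar e z) by apply: contrapT => nclO; apply: nW.
  by left; split => //; apply: (bernoulli_inner B); split => // /interior_subset.
by right; split => //; apply: (bernoulli_outer B); exact: notin_boundary.
Qed.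

(** The maximum principle for combinations of the potential with a test
function [Psi].  The sign condition is asked on all of [K] outside the open set
where both are harmonic; there [logdom_boundary] supplies the values of [u]. *)
Lemma bernoulli_comparison lambda c Om A u (e P a b sg : R) K Oi Psi :
  bernoulli_solution lambda c Om A u -> open Om -> 0 < P -> e * P = pi *+ 2 ->
  closed K -> K `<=` logdom e Om A -> (forall z, K z -> a <= z.1 <= b) ->
  (forall s t, K (s, t + P) = K (s, t)) ->
  (forall s t, Psi (s, t + P) = Psi (s, t)) ->
  open Oi -> logint e Om A `&` Oi `<=` K ->
  has_lap (logint e Om A `&` Oi) Psi (fun=> 0) -> {within K, continuous Psi} ->
  (forall z, K z -> ~ (logint e Om A `&` Oi) z ->
     sg * u (logpolar e z) + Psi z <= 0) ->
  forall z, K z -> sg * u (logpolar e z) + Psi z <= 0.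
Proof.
move=> B oOm P0 eP clK Kd Kab perK perPsi oOi OiK lapPsi cPsi bd.
have oW := open_domain A Om (bernoulli_open B).
pose U z := u (logpolar e z).
apply: (periodic_max_principle K (logint e Om A `&` Oi)
  (fun z => sg * U z + Psi z) (fun z => sg * 0 + 0) P a b) => //.
- by move=> s t; rewrite /U (logpolar_periodic e P (s, t) eP) perPsi.
- by apply: openI => //; exact: logint_open (bernoulli_open B).
- apply: has_lapD => //; apply: has_lapZ.
  apply: has_lap_subset (harmonic_logpolar _ u e oW (bernoulli_harmonic B)).
  exact: subIsetl.
- by move=> z _; rewrite mulr0 addr0.
- apply: within_continuousD => //.
  have cU : {within K, continuous (u \o logpolar e)}.
    apply: (within_comp K (closure A `\` Om)) (bernoulli_continuous B) => //.
    exact: logpolar_continuous.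
  by move=> z; apply: cvgM; [exact: cvg_cst|exact: cU].
Qed.

Lemma closed_fst_ge (s : R) : closed [set z : R * R | s <= z.1].
Proof.
exact: (@preimage_closed _ _ (@fst R R) [set t : R | s <= t] (fun z _ => @cvg_fst _ _ _ _ _) (@closed_ge R s)).
Qed.

Lemma closed_fst_le (s : R) : closed [set z : R * R | z.1 <= s].
Proof.
exact: (@preimage_closed _ _ (@fst R R) [set t : R | t <= s] (fun z _ => @cvg_fst _ _ _ _ _) (@closed_le R s)).
Qed.

Lemma open_fst_gt (s : R) : open [set z : R * R | s < z.1].
Proof.
exact: (@open_comp _ _ (@fst R R) [set t : R | s < t] (fun z _ => @cvg_fst _ _ _ _ _) (@open_gt R s)).
Qed.

Lemma open_fst_lt (s : R) : open [set z : R * R | z.1 < s].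
Proof.
exact: (@open_comp _ _ (@fst R R) [set t : R | t < s] (fun z _ => @cvg_fst _ _ _ _ _) (@open_lt R s)).
Qed.

Lemma affine_fst_continuous (a b : R) : continuous (fun z : R * R => a * z.1 + b).
Proof.
by move=> z; apply: cvgD; [apply: cvgM; [exact: cvg_cst|exact: cvg_fst]|exact: cvg_cst].
Qed.

Lemma two_pi_div (e : R) : 0 < e -> 0 < pi *+ 2 / e /\ e * (pi *+ 2 / e) = pi *+ 2.
Proof.
by move=> e0; split; [rewrite divr_gt0 // mulrn_wgt0 // pi_gt0|exact: mulr_divK].
Qed.

Lemma expR_le_cancel (e s t : R) : 0 < e -> (expR (e * s) <= expR (e * t)) = (s <= t).
Proof. by move=> e0; rewrite ler_expR ler_pM2l. Qed.

Lemma expR_lt_cancel (e s t : R) : 0 < e -> (expR (e * s) < expR (e * t)) = (s < t).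
Proof. by move=> e0; rewrite ltr_expR ltr_pM2l. Qed.

Lemma bernoulli_bounds lambda c Om A u (r M : R) : c < 1 -> 0 < r ->
  bernoulli_solution lambda c Om A u -> open Om ->
  (forall x, enorm x < r -> Om x) -> (forall x, closure A x -> enorm x <= M) ->
  forall x, (closure A `\` Om) x -> c <= u x <= 1.
Proof.
move=> c1 r0 B oOm rOm AM.
have e0 : 0 < 1 :> R by [].
have [P0 eP] := two_pi_div 1 e0.
have dom z : logdom 1 Om A z -> ln r <= z.1 <= ln (Num.max M 1).
  move=> [clA nO]; have M0 : 0 < Num.max M 1 by rewrite lt_max ltr01 orbT.
  rewrite -[z.1]mul1r -ler_expR -[X in _ && X]ler_expR !lnK ?posrE // -logpolar_enorm.
  rewrite le_max AM // andbT leNgt; apply/negP; by move=> /rOm.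
have W1 s t : logdom 1 Om A (s, t + pi *+ 2 / 1) = logdom 1 Om A (s, t).
  exact: logdom_periodic.
have bd (sg k : R) : (forall v, v = 1 \/ v = c -> sg * v + k <= 0) ->
    forall z, logdom 1 Om A z -> sg * u (logpolar 1 z) + k <= 0.
  move=> H; apply: (bernoulli_comparison lambda c Om A u 1 _ _ _ sg _ setT (fun=> k) B oOm P0 eP _ _ dom) => //.
  - exact: logdom_closed.
  - exact: openT.
  - by move=> z [/logint_sub].
  - have := has_lap_affine (logint 1 Om A `&` setT) 0 k.
    by under eq_fun do rewrite mul0r add0r.
  - by apply: continuous_subspaceT => z; exact: cvg_cst.
  - move=> z dz; rewrite setIT => nz; apply: H.
    by have [[-> _]|[-> _]] := logdom_boundary lambda c Om A u 1 z B dz nz; [left|right].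
move=> x [clx nOx].
have x0 : x != 0.
  apply/eqP => x0; apply/nOx/rOm.
  by rewrite x0 /enorm /= expr0n /= addr0 sqrtr0.
have [z zx] := logpolar_surj 1 x e0 x0.
have dz : logdom 1 Om A z by rewrite /logdom /preimage /mkset zx.
apply/andP; split.
  have := bd (- 1) c _ z dz; rewrite zx => /(_ _)/wrap[v [->|->]|]; lra.
have := bd 1 (- 1) _ z dz; rewrite zx => /(_ _)/wrap[v [->|->]|]; lra.
Qed.

(** Hadamard's three-circles theorem between the level [s0], above the
obstacle, and the level of the outermost boundary point.  The part of the free
boundary that lies in between causes no harm, because [u] takes its minimum
there. *)
Lemma outer_line lambda c Om A u (e Tm s0 y : R) : 0 < e ->
  bernoulli_solution lambda c Om A u -> open Om ->
  (forall x, closure A x -> enorm x <= expR (e * Tm)) -> s0 < Tm ->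
  (forall z, closure Om (logpolar e z) -> z.1 <= s0) -> c <= y ->
  (forall z, logdom e Om A z -> z.1 = s0 -> u (logpolar e z) <= y) ->
  forall z, logdom e Om A z -> s0 <= z.1 ->
  u (logpolar e z) <= c + (y - c) * ((Tm - z.1) / (Tm - s0)).
Proof.
move=> e0 B oOm AT sT Os cy Hy z dz zs.
have [P0 eP] := two_pi_div e e0.
have Ts : 0 < Tm - s0 by lra.
pose k := (y - c) / (Tm - s0).
have k0 : 0 <= k by rewrite divr_ge0 //; lra.
have kT : k * (Tm - s0) = y - c by rewrite /k divfK // gt_eqF.
have domT w : logdom e Om A w -> w.1 <= Tm.
  by move=> [/AT]; rewrite logpolar_enorm expR_le_cancel.
suff : 1 * u (logpolar e z) + (k * z.1 + (- c - k * Tm)) <= 0.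
  have -> : (y - c) * ((Tm - z.1) / (Tm - s0)) = k * (Tm - z.1) by rewrite /k; ring.
  by rewrite mul1r; lra.
apply: (bernoulli_comparison lambda c Om A u e _ s0 Tm 1
  (logdom e Om A `&` [set z | s0 <= z.1]) [set z | s0 < z.1]
  (fun z => k * z.1 + (- c - k * Tm)) B oOm P0 eP) => //.
- by apply: closedI; [exact: logdom_closed|exact: closed_fst_ge].
- by move=> w [/domT h1 /= h2]; rewrite h1 h2.
- by move=> s t; rewrite /setI /mkset logdom_periodic.
- exact: open_fst_gt.
- by move=> w [/logint_sub dw /= /ltW].
- exact: has_lap_affine.
- by apply: continuous_subspaceT; exact: affine_fst_continuous.
- move=> w [dw /= sw] nO; rewrite mul1r.
  have lvl : w.1 = s0 -> u (logpolar e w) + (k * w.1 + (- c - k * Tm)) <= 0.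
    by move=> ws; have := Hy _ dw ws; rewrite ws; lra.
  have [ws|ws] := leP w.1 s0; first by apply: lvl; lra.
  have nW : ~ logint e Om A w by move=> Ww; apply: nO.
  have [[_ /Os ws']|[-> _]] := logdom_boundary lambda c Om A u e w B dw nW; first by lra.
  have : 0 <= k * (Tm - w.1) by rewrite mulr_ge0 // subr_ge0 domT.
  lra.
Qed.

(** Below the level of the innermost boundary point the whole annulus belongs
to the domain.  The obstacle may reach above [s0], because [u] takes its maximum
there. *)
Lemma inner_line lambda c Om A u (e Tm s0 y : R) : 0 < e ->
  bernoulli_solution lambda c Om A u -> open Om ->
  (forall x, enorm x < expR (e * Tm) -> A x) -> s0 < Tm ->
  (forall x, (closure A `\` Om) x -> c <= u x) -> c <= y <= 1 ->
  (forall z, logdom e Om A z -> z.1 = s0 -> y <= u (logpolar e z)) ->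
  forall z, logdom e Om A z -> s0 <= z.1 <= Tm ->
  c + (y - c) * ((Tm - z.1) / (Tm - s0)) <= u (logpolar e z).
Proof.
move=> e0 B oOm TA sT uc cy Hy z dz zs.
have [P0 eP] := two_pi_div e e0.
have Ts : 0 < Tm - s0 by lra.
pose k := (y - c) / (Tm - s0).
have k0 : 0 <= k by rewrite divr_ge0 //; lra.
have kT : k * (Tm - s0) = y - c by rewrite /k divfK // gt_eqF.
suff : - 1 * u (logpolar e z) + (- k * z.1 + (c + k * Tm)) <= 0.
  have -> : (y - c) * ((Tm - z.1) / (Tm - s0)) = k * (Tm - z.1) by rewrite /k; ring.
  lra.
apply: (bernoulli_comparison lambda c Om A u e _ s0 Tm (- 1)
  (logdom e Om A `&` ([set z | s0 <= z.1] `&` [set z | z.1 <= Tm]))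
  ([set z | s0 < z.1] `&` [set z | z.1 < Tm])
  (fun z => - k * z.1 + (c + k * Tm)) B oOm P0 eP) => //.
- apply: closedI; first exact: logdom_closed.
  by apply: closedI; [exact: closed_fst_ge|exact: closed_fst_le].
- by move=> w [_ [/= h1 h2]]; rewrite h1 h2.
- by move=> s t; rewrite /setI /mkset logdom_periodic.
- by apply: openI; [exact: open_fst_gt|exact: open_fst_lt].
- by move=> w [/logint_sub dw [/= /ltW h1 /ltW h2]].
- exact: has_lap_affine.
- by apply: continuous_subspaceT; exact: affine_fst_continuous.
- move=> w [dw [/= sw wT]] nO.
  have lvl : w.1 = s0 -> - 1 * u (logpolar e w) + (- k * w.1 + (c + k * Tm)) <= 0.
    by move=> ws; have := Hy _ dw ws; rewrite ws; lra.
  have top : w.1 = Tm -> - 1 * u (logpolar e w) + (- k * w.1 + (c + k * Tm)) <= 0.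
    by move=> ->; have := uc _ dw; lra.
  have [ws|ws] := leP w.1 s0; first by apply: lvl; lra.
  have [Tw|Tw] := leP Tm w.1; first by apply: top; lra.
  have nW : ~ logint e Om A w by move=> Ww; apply: nO.
  have [[-> _]|[_ nA]] := logdom_boundary lambda c Om A u e w B dw nW.
    have : k * (Tm - w.1) <= k * (Tm - s0) by rewrite ler_wpM2l //; lra.
    lra.
  by exfalso; apply/nA/TA; rewrite logpolar_enorm expR_lt_cancel.
- split => //; by case/andP: zs.
Qed.

Lemma logpolar_log (e : R) x : 0 < e -> x != 0 ->
  exists2 z, logpolar e z = x & e * z.1 = ln (enorm x).
Proof.
move=> e0 x0; have [z zx] := logpolar_surj e x e0 x0.
by exists z => //; rewrite -zx logpolar_enorm expRK.
Qed.

Lemma near_enorm_gt p (r : R) : r < enorm p -> \forall x \near p, r < enorm x.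
Proof.
move=> pr; have d0 : 0 < enorm p - r by lra.
have /cvgrPdist_lt/(_ _ d0) := @enorm_continuous R p.
by apply: filterS => x; rewrite ltr_distl; lra.
Qed.

Lemma outer_slope lambda c Om A u (e Tm s0 y : R) p : 0 < e -> c < 1 ->
  bernoulli_solution lambda c Om A u -> open Om ->
  (forall x, closure A x -> enorm x <= expR (e * Tm)) -> s0 < Tm ->
  (forall z, closure Om (logpolar e z) -> z.1 <= s0) -> c <= y ->
  (forall x, (closure A `\` Om) x -> c <= u x) ->
  (forall z, logdom e Om A z -> z.1 = s0 -> u (logpolar e z) <= y) ->
  boundary A p -> enorm p = expR (e * Tm) ->
  lambda * expR (e * Tm) <= (y - c) / (e * (Tm - s0)).
Proof.
move=> e0 c1 B oOm AT sT Os cy uc Hy bp pT.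
rewrite -ler_pdivlMr ?expR_gt0 //.
have Ts : 0 < e * (Tm - s0) by rewrite mulr_gt0 // subr_gt0.
apply: (outer_touch lambda c Om A u p (expR (e * Tm)) ((y - c) / (e * (Tm - s0)))) => //.
- exact: expR_gt0.
- by rewrite divr_ge0 //; [lra|exact: ltW].
- by move=> x Wx; apply: uc; split; [case: Wx => /subset_closure|case: Wx => _ nO /subset_closure].
- by move=> x /subset_closure/AT.
have : \forall x \near p, expR (e * s0) < enorm x.
  by apply: near_enorm_gt; rewrite pT expR_lt_cancel.
apply: filterS => x sx [Ax nO].
have x0 : x != 0.
  apply/eqP => x0; move: sx; rewrite x0 /enorm /= expr0n /= addr0 sqrtr0.
  by rewrite ltNge expR_ge0.
have [z zx ez] := logpolar_log e x e0 x0.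
have dz : logdom e Om A z.
  by split; rewrite zx; [exact: subset_closure|move=> /subset_closure].
have := outer_line lambda c Om A u e Tm s0 y e0 B oOm AT sT Os cy Hy z dz.
have -> : s0 <= z.1 by rewrite ltW // -(expR_lt_cancel e) // -logpolar_enorm zx.
move=> /(_ isT); rewrite zx => /le_trans; apply.
rewrite expRK -ez -mulrBr lerD2l.
have -> : (y - c) / (e * (Tm - s0)) * (e * (Tm - z.1)) = (y - c) * ((Tm - z.1) / (Tm - s0)).
  by field; rewrite !gt_eqF // subr_gt0.
by [].
Qed.

Lemma inner_slope lambda c Om A u (e Tm s0 y : R) p : 0 < e -> c < 1 ->
  bernoulli_solution lambda c Om A u -> open Om ->
  (forall x, enorm x < expR (e * Tm) -> A x) -> s0 < Tm ->
  (forall x, (closure A `\` Om) x -> c <= u x) -> c <= y <= 1 ->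
  (forall z, logdom e Om A z -> z.1 = s0 -> y <= u (logpolar e z)) ->
  boundary A p -> enorm p = expR (e * Tm) ->
  (y - c) / (e * (Tm - s0)) <= lambda * expR (e * Tm).
Proof.
move=> e0 c1 B oOm TA sT uc cy Hy bp pT.
rewrite -ler_pdivrMr ?expR_gt0 //.
have Ts : 0 < e * (Tm - s0) by rewrite mulr_gt0 // subr_gt0.
apply: (inner_touch lambda c Om A u p (expR (e * Tm)) ((y - c) / (e * (Tm - s0)))) => //.
- exact: expR_gt0.
- by rewrite divr_ge0 //; [lra|exact: ltW].
have npO : ~ closure Om p.
  by move=> /(closure_obstacle_sub _ _ _ _ _ c1 B); apply: boundary_notin => //; exact: bernoulli_open B.
have nclO : \forall x \near p, ~ closure Om x.
  have oC : open (~` closure Om) by rewrite openC; exact: closed_closure.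
  exact: (open_nbhs_nbhs (conj oC npO)).
have : \forall x \near p, expR (e * s0) < enorm x.
  by apply: near_enorm_gt; rewrite pT expR_lt_cancel.
apply: filterS2 nclO => x nO sx xT.
have Ax := TA _ xT.
have x0 : x != 0.
  apply/eqP => x0; move: sx; rewrite x0 /enorm /= expr0n /= addr0 sqrtr0.
  by rewrite ltNge expR_ge0.
have [z zx ez] := logpolar_log e x e0 x0.
have dz : logdom e Om A z.
  by split; rewrite zx; [exact: subset_closure|move=> /subset_closure].
have := inner_line lambda c Om A u e Tm s0 y e0 B oOm TA sT uc cy Hy z dz.
have -> : s0 <= z.1 <= Tm.
  rewrite ltW /=; last by rewrite -(expR_lt_cancel e) // -logpolar_enorm zx.
  by rewrite ltW // -(expR_lt_cancel e) // -logpolar_enorm zx.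
move=> /(_ isT); rewrite zx; apply: le_trans.
rewrite expRK -ez -mulrBr lerD2l.
have -> : (y - c) / (e * (Tm - s0)) * (e * (Tm - z.1)) = (y - c) * ((Tm - z.1) / (Tm - s0)).
  by field; rewrite !gt_eqF // subr_gt0.
by [].
Qed.

End LogarithmicDomain.

(** * The oscillating obstacle *)

Section Obstacle.
Context {R : realType}.
Implicit Types (u : R * R -> R) (A Om : set (R * R)) (p q x z : R * R) (h : R -> R).

(** The obstacle boundary as a graph over the angle, in logarithmic
coordinates: [-h - O(e)]. *)
Definition bottom h (e t : R) : R := ln (1 - e * h t) / e.

Record profile h (H e : R) : Prop := Profile {
  profile_ge0 : forall t, 0 <= h t;
  profile_le : forall t, h t <= H;
  profile_periodic : forall t, h (t + pi *+ 2) = h t;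
  profile_continuous : continuous h;
  profile_scale_gt0 : 0 < e;
  profile_scale_nat : exists n : nat, e^-1 = n%:R;
  profile_small : e * H <= 1 / 2 }.

Lemma profile_arg h H e t : profile h H e -> 1 / 2 <= 1 - e * h t <= 1.
Proof.
move=> [h0 hH _ _ e0 _ sm].
have : e * h t <= e * H by rewrite ler_pM2l.
have : 0 <= e * h t by rewrite mulr_ge0 // ltW.
lra.
Qed.

(** Polar angles are only determined modulo [2 pi]; rescaled by the integer
[e^-1], the ambiguity becomes a multiple of the period of [h]. *)
Lemma Omega_logpolar h H e z : profile h H e ->
  Omega h e (logpolar e z) <-> z.1 < bottom h e z.2.
Proof.
move=> hP; have [h0 hH hp hc e0 [n en] sm] := hP.
have a0 t : 0 < 1 - e * h t by have := profile_arg _ _ _ t hP; lra.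
rewrite /bottom ltr_pdivlMr // -ltr_expR lnK ?posrE // mulrC.
split=> [[r [t [r0 rt E]]]|lt1]; last first.
  exists (expR (e * z.1)), (e * z.2); split; rewrite ?expR_ge0 //.
  by rewrite [e * z.2]mulrC mulfK // gt_eqF.
have rE : r = expR (e * z.1).
  rewrite -logpolar_enorm E; have := enormZ r (cos t, sin t) => /= ->.
  by rewrite ger0_norm // /enorm /= cos2Dsin2 sqrtr1 mulr1.
have [E1 E2] : expR (e * z.1) * cos (e * z.2) = r * cos t /\ expR (e * z.1) * sin (e * z.2) = r * sin t.
  by move: E => [].
have r1 : expR (e * z.1) != 0 by rewrite gt_eqF // expR_gt0.
rewrite -rE; suff -> : h z.2 = h (t / e) by [].
have -> : z.2 = (e * z.2) / e by rewrite mulrC mulKf // gt_eqF.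
apply: (periodic_angle (fun a => h (a / e))).
- by move=> s; rewrite mulrDl en mulrC -[_ * n%:R]mulrC (periodic_shift h (pi *+ 2) n _ hp) mulrC.
- by apply: (mulfI r1); rewrite E1 rE.
- by apply: (mulfI r1); rewrite E2 rE.
Qed.

Lemma Omega_ball h H e x : profile h H e -> enorm x < 1 - e * H -> Omega h e x.
Proof.
move=> [h0 hH hp hc e0 [n en] sm] xH; have [t xt] := polar_surj x.
exists (enorm x), t; split => //; first exact: enorm_ge0.
by apply: lt_le_trans xH _; rewrite lerD2l lerN2 ler_pM2l.
Qed.

Lemma Omega_enorm h H e x : profile h H e -> Omega h e x -> enorm x < 1.
Proof.
move=> hP [r [t [r0 rt ->]]]; have := enormZ r (cos t, sin t) => /= ->.
rewrite ger0_norm // /enorm /= cos2Dsin2 sqrtr1 mulr1.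
by have := profile_arg _ _ _ (t / e) hP; lra.
Qed.

Lemma bottom_continuous h H e : profile h H e -> continuous (bottom h e).
Proof.
move=> hP t; have [h0 hH hp hc e0 [n en] sm] := hP.
apply: cvgM; last exact: cvg_cst.
have c1 : (fun t => 1 - e * h t) @ t --> 1 - e * h t.
  by apply: cvgB; [exact: cvg_cst|apply: cvgM; [exact: cvg_cst|exact: hc]].
by apply: cvg_comp c1 _; apply: continuous_ln; have := profile_arg _ _ _ t hP; lra.
Qed.

Lemma bottom_periodic h H e t : profile h H e -> bottom h e (t + pi *+ 2) = bottom h e t.
Proof. by move=> hP; rewrite /bottom (profile_periodic _ _ _ hP). Qed.

Lemma height_gap_continuous h H e : profile h H e ->
  continuous (fun z : R * R => z.1 - bottom h e z.2).
Proof.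
move=> hP z; apply: cvgB; first exact: cvg_fst.
exact: (@cvg_comp _ _ _ (@snd R R) (bottom h e) _ _ _ (@cvg_snd _ _ _ _ _) (bottom_continuous _ _ _ hP z.2)).
Qed.

Lemma open_above_bottom h H e : profile h H e -> open [set z : R * R | bottom h e z.2 < z.1].
Proof.
move=> hP; have := @open_comp _ _ (fun z : R * R => z.1 - bottom h e z.2) [set t : R | 0 < t]
  (fun z _ => height_gap_continuous _ _ _ hP z) (@open_gt R 0).
by congr open; apply/seteqP; split => z /=; rewrite subr_gt0.
Qed.

Lemma open_below_bottom h H e : profile h H e -> open [set z : R * R | z.1 < bottom h e z.2].
Proof.
move=> hP; have := @open_comp _ _ (fun z : R * R => z.1 - bottom h e z.2) [set t : R | t < 0]
  (fun z _ => height_gap_continuous _ _ _ hP z) (@open_lt R 0).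
by congr open; apply/seteqP; split => z /=; rewrite subr_lt0.
Qed.

Lemma closed_above_bottom h H e : profile h H e -> closed [set z : R * R | bottom h e z.2 <= z.1].
Proof.
move=> hP; have := open_closedC (open_below_bottom _ _ _ hP).
by congr closed; apply/seteqP; split => z /=; [move=> /negP; rewrite -leNgt|rewrite leNgt => /negP].
Qed.

Lemma Omega_open h H e : profile h H e -> open (Omega h e).
Proof.
move=> hP; have [h0 hH hp hc e0 [n en] sm] := hP.
rewrite openE => x Ox; rewrite /interior /=.
have [->|x0] := eqVneq x 0.
  apply/near_enorm; exists (1 - e * H); first lra.
  by move=> q; rewrite subr0; exact: Omega_ball hP.
have [z zx] := logpolar_surj e x e0 x0.
have Wz : z.1 < bottom h e z.2 by apply/(Omega_logpolar _ _ _ _ hP); rewrite zx.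
have oW := logpolar_open e _ e0 (open_below_bottom _ _ _ hP).
have : nbhs x (logpolar e @` [set z | z.1 < bottom h e z.2]).
  by apply: open_nbhs_nbhs; split => //; exists z.
by apply: filterS => _ [w Ww <-]; apply/(Omega_logpolar _ _ _ _ hP).
Qed.

(** The open map property of [logpolar] separates the points above the graph
from the obstacle. *)
Lemma closure_Omega h H e z : profile h H e ->
  closure (Omega h e) (logpolar e z) -> z.1 <= bottom h e z.2.
Proof.
move=> hP cz; rewrite leNgt; apply/negP => zb.
have oW := logpolar_open e _ (profile_scale_gt0 _ _ _ hP) (open_above_bottom _ _ _ hP).
have : nbhs (logpolar e z) (logpolar e @` [set z | bottom h e z.2 < z.1]).
  by apply: open_nbhs_nbhs; split => //; exists z.
move=> /cz[x [Ow [w /= bw wE]]]; move: Ow; rewrite -wE => /(Omega_logpolar _ _ _ _ hP).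
by rewrite ltNge ltW.
Qed.

Lemma ln_1B_bounds (x : R) : 0 <= x <= 1 / 2 -> - x - 2 * x ^+ 2 <= ln (1 - x) <= - x.
Proof.
move=> x01; have x1 : 0 < 1 - x by lra.
apply/andP; split; last by apply: le_ln1Dx; lra.
have : ln ((1 - x)^-1) <= x / (1 - x).
  have E : (1 - x)^-1 = 1 + x / (1 - x) by field; rewrite gt_eqF.
  rewrite {1}E.
  by apply: le_ln1Dx; apply: lt_le_trans (_ : 0 <= _); rewrite ?ltrN10 // divr_ge0 //; lra.
rewrite lnV ?posrE // => h1.
have : x / (1 - x) <= x + 2 * x ^+ 2.
  by rewrite ler_pdivrMr //; have := sqr_ge0 x; nra.
lra.
Qed.

Lemma bottom_bounds h H e t : profile h H e ->
  - h t - 2 * e * H ^+ 2 <= bottom h e t <= - h t.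
Proof.
move=> hP; have [h0 hH hp hc e0 _ sm] := hP.
have [a b] : 0 <= e * h t /\ e * h t <= 1 / 2 by have := profile_arg _ _ _ t hP; lra.
have /andP[l1 l2] := ln_1B_bounds (e * h t) (introT andP (conj a b)).
rewrite /bottom ler_pdivlMr // ler_pdivrMr //; apply/andP; split; last lra.
apply: le_trans l1; have : h t ^+ 2 <= H ^+ 2 by rewrite lerXn2r // nnegrE // (le_trans (h0 t)).
have e2 : 0 <= e ^+ 2 by exact: sqr_ge0.
move=> /(ler_wpM2l e2); lra.
Qed.

End Obstacle.

(** * Contact points and radial bounds on the free boundary *)

Section ContactPoints.
Context {R : realType}.
Implicit Types (u : R * R -> R) (A Om : set (R * R)) (p q x z : R * R).

Lemma bounded_enorm A : bounded_set A -> exists M : R, forall x, closure A x -> enorm x <= M.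
Proof.
move=> [M [_ HM]]; exists (2 * (`|M| + 2)).
have AM : A `<=` [set x | enorm x <= 2 * (`|M| + 2)].
  move=> x Ax /=; rewrite -[x]subr0; apply/ltW/ball_enorm.
  have xM : `|x| <= `|M| + 1 by apply: HM => //; have := ler_norm M; lra.
  split; rewrite -ball_normE /= sub0r normrN.
    by apply: le_lt_trans (_ : `|x| < _); [rewrite prod_normE /= le_max lexx|lra].
  by apply: le_lt_trans (_ : `|x| < _); [rewrite prod_normE /= le_max lexx orbT|lra].
by move=> x /(closureS AM)/closed_enorm_le.
Qed.

Lemma shrink_point p (d : R) : 0 < enorm p -> 0 < d ->
  exists x, enorm (x - p) < d /\ enorm x < enorm p.
Proof.
move=> p0 d0; pose t := Num.min (1 / 2) (d / (2 * enorm p)).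
have t0 : 0 < t by rewrite lt_min; apply/andP; split; rewrite divr_gt0 // mulr_gt0.
have th : t <= 1 / 2 by rewrite ge_min lexx.
have td : t * enorm p < d.
  have : t <= d / (2 * enorm p) by rewrite ge_min lexx orbT.
  by rewrite ler_pdivlMr ?mulr_gt0 //; lra.
exists ((1 - t) * p.1, (1 - t) * p.2); split.
  have -> : ((1 - t) * p.1, (1 - t) * p.2) - p = ((- t) * p.1, (- t) * p.2).
    rewrite [X in _ - X]surjective_pairing; congr (_, _) => /=; ring.
  by rewrite enormZ normrN gtr0_norm.
by rewrite enormZ ger0_norm; [rewrite gtr_pMl //; lra|lra].
Qed.

Lemma outer_contact lambda c Om A u : bernoulli_solution lambda c Om A u -> Om !=set0 ->
  exists2 p, boundary A p & forall x, closure A x -> enorm x <= enorm p.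
Proof.
move=> B [y Oy]; have [M AM] := bounded_enorm A (bernoulli_bounded B).
have cA : compact (closure A) by apply: (compact_enorm_le _ M) => //; exact: closed_closure.
have A0 : closure A !=set0 by exists y; apply/subset_closure/(bernoulli_sub B).
have cE : {within closure A, continuous (@enorm R)}.
  by apply: continuous_subspaceT; exact: enorm_continuous.
have [p /set_mem Ap pmax] := compact_EVT_max A0 cA cE.
exists p; last by move=> x clx; apply: pmax; rewrite inE.
apply: notin_boundary => // Ap'.
have /near_enorm[r r0 rA] : nbhs p A.
  exact: (open_nbhs_nbhs (conj (bernoulli_open B) Ap')).
have [p0|p0] := eqVneq (enorm p) 0.
  have := rA (r / 2, 0); rewrite (enorm0_eq _ p0) subr0.
  have E : enorm (r / 2, 0) = r / 2.
    by rewrite /enorm /= expr0n /= addr0 sqrtr_sqr gtr0_norm // divr_gt0.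
  have r2 : r / 2 < r by lra.
  rewrite E => /(_ r2) Ax; have := pmax (r / 2, 0).
  rewrite inE E p0 => /(_ (subset_closure Ax)); lra.
have {}p0 : 0 < enorm p by rewrite lt0r p0 enorm_ge0.
pose t := r / (2 * enorm p).
have t0 : 0 < t by rewrite divr_gt0 // mulr_gt0.
pose q := ((1 + t) * p.1, (1 + t) * p.2).
have qp : q - p = (t * p.1, t * p.2).
  by rewrite /q [X in _ - X]surjective_pairing; congr (_, _) => /=; ring.
have tp : t * enorm p = r / 2 by rewrite /t; field; rewrite gt_eqF.
have Aq : A q by apply: rA; rewrite qp enormZ gtr0_norm // tp; lra.
have := pmax q; rewrite inE => /(_ (subset_closure Aq)); rewrite enormZ ger0_norm; last lra.
lra.
Qed.

Lemma inner_contact lambda c Om A u (r : R) : c < 1 -> 0 < r ->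
  bernoulli_solution lambda c Om A u -> (forall x, enorm x < r -> Om x) ->
  exists p, [/\ boundary A p, forall x, enorm x < enorm p -> A x & r < enorm p].
Proof.
move=> c1 r0 B rO; have oA := bernoulli_open B.
have O0 : Om !=set0 by exists 0; apply: rO; rewrite /enorm /= expr0n /= addr0 sqrtr0.
have [p0 bp0 _] := outer_contact _ _ _ _ _ B O0.
have nAp0 := boundary_notin _ _ oA bp0.
pose C := ~` A `&` [set x | enorm x <= enorm p0].
have cC : compact C.
  apply: (compact_enorm_le _ (enorm p0)); last by move=> x [].
  by apply: closedI; [exact: open_closedC|exact: closed_enorm_le].
have C0 : C !=set0 by exists p0; split => //=.
have cE : {within C, continuous (fun x => - @enorm R x)}.
  by apply: continuous_subspaceT => x; apply: cvgN; exact: enorm_continuous.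
have [p /set_mem [nAp pp0] pmax] := compact_EVT_max C0 cC cE.
have lep x : enorm x < enorm p -> A x.
  move=> xp; apply: contrapT => nAx; have := pmax x; rewrite inE.
  have Cx : C x by split => //=; exact: le_trans (ltW xp) pp0.
  by move=> /(_ Cx); rewrite lerN2 leNgt xp.
have approx (D : set (R * R)) : 0 < enorm p -> (forall x, enorm x < enorm p -> D x) -> closure D p.
  move=> ep DP N /near_enorm[d d0 dN]; have [x [xp1 xp2]] := shrink_point p d ep d0.
  by exists x; split; [exact: DP|exact: dN].
have rp : r < enorm p.
  rewrite ltNge; apply/negP => pr; apply: nAp.
  have [ep|ep] := eqVneq (enorm p) 0.
    by apply: (bernoulli_sub B); apply: rO; rewrite ep.
  apply: (closure_obstacle_sub _ _ _ _ _ c1 B); apply: approx.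
    by rewrite lt0r ep enorm_ge0.
  by move=> x xp; apply: rO; exact: lt_le_trans pr.
exists p; split => //; apply: notin_boundary => //; apply: approx => //.
exact: lt_trans rp.
Qed.

(** Comparison with the radial potential of the annulus between the unit
circle, which encloses the obstacle, and the outermost circle. *)
Lemma outer_radius_bound lambda c Om A u p : c < 1 ->
  bernoulli_solution lambda c Om A u -> open Om -> Om 0 ->
  (forall x, Om x -> enorm x < 1) -> boundary A p ->
  (forall x, closure A x -> enorm x <= enorm p) -> 1 < enorm p ->
  lambda * enorm p * ln (enorm p) <= 1 - c.
Proof.
move=> c1 B oOm O0 O1 bp pmax p1.
have /near_enorm[r r0 rO] : nbhs (0 : R * R) Om by exact: (open_nbhs_nbhs (conj oOm O0)).
have {}rO x : enorm x < r -> Om x by rewrite -{1}[x]subr0; exact: rO.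
have bd := bernoulli_bounds _ _ _ _ _ r _ c1 r0 B oOm rO pmax.
have p0 : 0 < enorm p by lra.
have E : expR (1 * ln (enorm p)) = enorm p by rewrite mul1r lnK ?posrE.
have l0 : 0 < ln (enorm p) by exact: ln_gt0.
have clO x : closure Om x -> enorm x <= 1.
  by move=> clx; apply: closed_enorm_le; apply: closureS clx => y /O1/ltW.
have := outer_slope lambda c Om A u 1 (ln (enorm p)) 0 1 p ltr01 c1 B oOm.
rewrite E subr0 mul1r => /(_ pmax l0) H; rewrite -ler_pdivlMr //; apply: H => //.
- by move=> z /clO; rewrite logpolar_enorm mul1r -[leRHS]expR0 ler_expR.
- exact: ltW.
- by move=> x /bd/andP[].
- by move=> z dz _; have /andP[] := bd _ dz.
Qed.

Lemma inner_level_value lambda c Om A u (e r : R) z : 0 < r ->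
  bernoulli_solution lambda c Om A u -> (forall x, enorm x < r -> Om x) ->
  logdom e Om A z -> enorm (logpolar e z) = r -> u (logpolar e z) = 1.
Proof.
move=> r0 B rO [_ nO] zE; apply: (bernoulli_inner B); split; last by move=> /interior_subset.
move=> N /near_enorm[d d0 dN].
have [|x [xp1 xp2]] := shrink_point (logpolar e z) d _ d0; first by rewrite zE.
by exists x; split; [apply: rO; rewrite -zE|exact: dN].
Qed.

(** The same with a disc of radius [r] inside the obstacle and the innermost
circle. *)
Lemma inner_radius_bound lambda c Om A u p (r : R) : c < 1 -> 0 < r ->
  bernoulli_solution lambda c Om A u -> open Om ->
  (forall x, enorm x < r -> Om x) -> boundary A p ->
  (forall x, enorm x < enorm p -> A x) -> r < enorm p ->
  1 - c <= lambda * enorm p * (ln (enorm p) - ln r).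
Proof.
move=> c1 r0 B oOm rO bp pin rp.
have [M AM] := bounded_enorm A (bernoulli_bounded B).
have bd := bernoulli_bounds _ _ _ _ _ r _ c1 r0 B oOm rO AM.
have p0 : 0 < enorm p by lra.
have E : expR (1 * ln (enorm p)) = enorm p by rewrite mul1r lnK ?posrE.
have l0 : ln r < ln (enorm p) by rewrite ltr_ln ?posrE.
have := inner_slope lambda c Om A u 1 (ln (enorm p)) (ln r) 1 p ltr01 c1 B oOm.
rewrite E mul1r => /(_ pin l0) H; rewrite -ler_pdivrMr ?subr_gt0 //; apply: H => //.
- by move=> x /bd/andP[].
- by rewrite lexx ltW.
move=> z dz zr; rewrite (inner_level_value _ _ _ _ _ _ r _ r0 B rO dz) //.
by rewrite logpolar_enorm mul1r zr lnK ?posrE.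
Qed.

End ContactPoints.

(** * The normalised potential *)

Section ScaledPotential.
Context {R : realType}.
Implicit Types (u : R * R -> R) (A Om : set (R * R)) (p q x z : R * R) (h : R -> R).

(** [expR l] is the free radius of the unperturbed problem. *)
Lemma unperturbed_radius (lambda : R) : 0 < lambda ->
  exists2 l, 0 < l & lambda * l * expR l = 1.
Proof.
move=> l0; have b0 : 0 <= lambda^-1 by rewrite invr_ge0 ltW.
have cf : continuous (fun l : R => lambda * l * expR l).
  move=> l; apply: cvgM; last exact: continuous_expR.
  by apply: cvgM; [exact: cvg_cst|exact: cvg_id].
have e1 : 1 <= expR lambda^-1 by rewrite -expR0 ler_expR.
have [|l] := IVT (v := 1) b0 (continuous_subspaceT cf).
  by rewrite mulr0 mul0r divff ?gt_eqF // mul1r ge_min le_max ler01 e1 orbT.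
rewrite in_itv /= => /andP[l1 l2] E; exists l => //.
rewrite lt_neqAle l1 andbT; apply/eqP => l3; move: E; rewrite -l3 mulr0 mul0r => /eqP.
by rewrite eq_sym oner_eq0.
Qed.

Definition potential (l e : R) u z : R := l / e * (1 - u (logpolar e z)).

(** Contact points are part of the data, since it is there that the slope of the
potential gets compared with [lambda]. *)
Record radii (e T tau : R) A : Prop := Radii {
  radii_outer : exists2 p, boundary A p & enorm p = expR (e * T);
  radii_outer_bound : forall x, closure A x -> enorm x <= expR (e * T);
  radii_inner : exists2 p, boundary A p & enorm p = expR (e * tau);
  radii_inner_ball : forall x, enorm x < expR (e * tau) -> A x;
  radii_le : tau <= T }.

(** The normalisation makes [potential] grow like the first coordinate: by
comparison with radial harmonic functions, whose slopes on the free boundary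
are prescribed, it stays within [2 H] of it. *)
Lemma potential_bounds (lambda l H e : R) h A u : 0 < lambda -> 0 < l ->
  lambda * l * expR l = 1 -> profile h H e -> 2 * H * e < l ->
  bernoulli_solution lambda 0 (Omega h e) A u ->
  exists T tau, [/\ radii e T tau A, e * T <= l, l - 2 * H * e <= e * tau &
    forall z, logdom e (Omega h e) A z ->
    [/\ 0 <= potential l e u z <= l / e, z.1 <= potential l e u z &
        z.1 <= tau -> potential l e u z <= z.1 + 2 * H]].
Proof.
move=> lam0 l0 lE hP Hel B; have [h0 hH hp hc e0 _ sm] := hP.
have H0 : 0 <= H by exact: le_trans (h0 0) (hH 0).
have c1 : (0 : R) < 1 by [].
pose r := 1 - e * H.
have r0 : 0 < r by rewrite /r; lra.
have oOm := Omega_open _ _ _ hP.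
have rO x : enorm x < r -> Omega h e x by exact: Omega_ball hP.
have O0 : Omega h e 0 by apply: rO; rewrite /enorm /= expr0n /= addr0 sqrtr0.
have O1 x : Omega h e x -> enorm x < 1 by exact: Omega_enorm hP.
have [p bp pmax] := outer_contact _ _ _ _ _ B (ex_intro _ _ O0).
have [q [bq qin rq]] := inner_contact _ _ _ _ _ r c1 r0 B rO.
have q0 : 0 < enorm q by lra.
have qp : enorm q <= enorm p by apply: pmax; case: bq.
have p0 : 0 < enorm p by lra.
have inn := inner_radius_bound _ _ _ _ _ q r c1 r0 B oOm rO bq qin rq.
have el1 : 1 < expR l by rewrite -expR0 ltr_expR.
(* [x * ln x] is increasing beyond 1. *)
have p_le : enorm p <= expR l.
  rewrite leNgt; apply/negP => lp.
  have := outer_radius_bound _ _ _ _ _ p c1 B oOm O0 O1 bp pmax (lt_trans el1 lp).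
  rewrite subr0 -lE; apply/negP; rewrite -ltNge.
  have lnp : l < ln (enorm p) by rewrite -[l]expRK ltr_ln ?posrE ?expR_gt0.
  rewrite -!mulrA ltr_pM2l // mulrC; apply: ltr_pM => //; exact: ltW.
have lnr : - (2 * H * e) <= ln r.
  have eH0 : 0 <= e * H by rewrite mulr_ge0 // ltW.
  have /andP[+ _] := ln_1B_bounds (e * H) (introT andP (conj eH0 sm)).
  apply: le_trans; have : (e * H) ^+ 2 <= e * H * (1 / 2) by rewrite expr2 ler_wpM2l.
  lra.
have lnqr : l <= ln (enorm q) - ln r.
  have d0 : 0 <= ln (enorm q) - ln r by rewrite subr_ge0 ler_ln ?posrE // ltW.
  have : 1 <= lambda * expR l * (ln (enorm q) - ln r).
    move: inn; rewrite subr0 => /le_trans; apply; apply: ler_wpM2r => //.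
    by rewrite ler_pM2l //; exact: le_trans p_le.
  rewrite -lE -mulrA [l * _]mulrC mulrA ler_pM2l //.
  by rewrite mulr_gt0 ?expR_gt0.
have lnr0 : ln r <= 0 by rewrite -ln1 ler_ln ?posrE // /r gerDl oppr_le0 mulr_ge0 // ltW.
have lnq0 : 0 < ln (enorm q) by lra.
have lnqp : ln (enorm q) <= ln (enorm p) by rewrite ler_ln ?posrE.
have lnp : ln (enorm p) <= l by rewrite -[l]expRK ler_ln ?posrE ?expR_gt0.
pose T := ln (enorm p) / e; pose tau := ln (enorm q) / e; pose s0 := ln r / e.
have eT : e * T = ln (enorm p) by exact: mulr_divK.
have et : e * tau = ln (enorm q) by exact: mulr_divK.
have es : e * s0 = ln r by exact: mulr_divK.
have xT : expR (e * T) = enorm p by rewrite eT lnK ?posrE.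
have xt : expR (e * tau) = enorm q by rewrite et lnK ?posrE.
have xs : expR (e * s0) = r by rewrite es lnK ?posrE.
have T0 : 0 < T by rewrite divr_gt0 //; lra.
have le0 : 0 < l / e by rewrite divr_gt0.
have bd := bernoulli_bounds _ _ _ _ _ r _ c1 r0 B oOm rO pmax.
exists T, tau; split.
- split; rewrite ?xT ?xt //; [by exists p|by exists q|].
  by rewrite /tau /T ler_pM2r // invr_gt0.
- by rewrite eT.
- by rewrite et; lra.
move=> z dz; have /andP[u0 u1] := bd _ dz.
have W01 : 0 <= potential l e u z <= l / e.
  apply/andP; split; first by rewrite mulr_ge0 ?(ltW le0) // subr_ge0.
  by rewrite /potential ger_pMr //; lra.
split => //.
  have [z0|z0] := leP 0 z.1; last by case/andP: W01; lra.
  have := outer_line lambda 0 (Omega h e) A u e T 0 1 e0 B oOm.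
  rewrite xT subr0 => /(_ pmax T0).
  have clO w : closure (Omega h e) (logpolar e w) -> w.1 <= 0.
    by move=> /(closure_Omega _ _ _ _ hP) wb; have := bottom_bounds _ _ _ w.2 hP; have := h0 w.2; lra.
  have lvl w : logdom e (Omega h e) A w -> w.1 = 0 -> u (logpolar e w) <= 1.
    by move=> /bd/andP[].
  move=> /(_ clO ler01 lvl z dz z0); rewrite add0r subr0 mul1r => uz.
  have zT : z.1 <= T by case: dz => /pmax; rewrite logpolar_enorm -xT expR_le_cancel.
  have : z.1 / T <= 1 - u (logpolar e z).
    by move: uz; rewrite mulrBl divff ?gt_eqF //; lra.
  move=> /(ler_wpM2l (ltW le0)); apply: le_trans.
  have -> : l / e * (z.1 / T) = z.1 * (l / (e * T)).
    by field; rewrite !gt_eqF.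
  apply: ler_peMr => //; rewrite ler_pdivlMr; [by rewrite mul1r eT|by rewrite mulr_gt0].
move=> zt.
have ts0 : s0 < tau by rewrite /s0 /tau ltr_pM2r ?invr_gt0 //; lra.
have zs : s0 <= z.1.
  rewrite -(expR_le_cancel e) // -logpolar_enorm xs leNgt; apply/negP => /rO.
  by case: dz.
have := inner_line lambda 0 (Omega h e) A u e tau s0 1 e0 B oOm.
rewrite xt => /(_ qin ts0) H1.
have lvl w : logdom e (Omega h e) A w -> w.1 = s0 -> 1 <= u (logpolar e w).
  move=> dw ws; rewrite (inner_level_value _ _ _ _ _ e r w r0 B rO dw) //.
  by rewrite logpolar_enorm ws xs.
have := H1 _ _ lvl z dz; rewrite zs zt ler01 lexx => /(_ _ isT isT).
have u0' x : (closure A `\` Omega h e) x -> 0 <= u x by move=> /bd/andP[].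
move=> /(_ u0'); rewrite add0r subr0 mul1r => uz.
have ts : l <= e * (tau - s0) by rewrite mulrBr et es.
have ts1 : 0 < tau - s0 by lra.
have : 1 - u (logpolar e z) <= (z.1 - s0) / (tau - s0).
  have : (tau - z.1) / (tau - s0) = 1 - (z.1 - s0) / (tau - s0) by field; rewrite gt_eqF.
  lra.
move=> /(ler_wpM2l (ltW le0)) => h1; apply: le_trans h1 _.
have -> : l / e * ((z.1 - s0) / (tau - s0)) = (z.1 - s0) * (l / (e * (tau - s0))).
  by field; rewrite !gt_eqF.
have : (z.1 - s0) * (l / (e * (tau - s0))) <= z.1 - s0.
  apply: ler_piMr; first by rewrite subr_ge0.
  by rewrite ler_pdivrMr; [rewrite mul1r|rewrite mulr_gt0].
have : - (2 * H) <= s0 by rewrite /s0 ler_pdivlMr //; lra.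
lra.
Qed.

End ScaledPotential.

(** * Truncated boundary layer functions *)

Section CellFunction.
Context {R : realType}.
Implicit Types (u V F : R * R -> R) (A Om O : set (R * R)) (p q x z : R * R) (h b : R -> R).

Lemma has_lap_isometry O F G (a c sg : R) : sg ^+ 2 = 1 -> has_lap O F G ->
  has_lap [set z | O (z.1 + a, sg * z.2 + c)]
    (fun z => F (z.1 + a, sg * z.2 + c)) (fun z => G (z.1 + a, sg * z.2 + c)).
Proof.
move=> sg2 [F1 [F2 [F11 [F22 H]]]].
exists (fun z => F1 (z.1 + a, sg * z.2 + c)), (fun z => sg * F2 (z.1 + a, sg * z.2 + c)),
  (fun z => F11 (z.1 + a, sg * z.2 + c)), (fun z => F22 (z.1 + a, sg * z.2 + c)) => z Oz.
have [d1 d2 d11 d22 <-] := H _ Oz.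
have i1 (s : R) : is_derive s 1 (fun s => s + a) 1.
  by apply: is_derive_eq; rewrite addr0.
have i2 (t : R) : is_derive t 1 (fun t => sg * t + c) sg.
  by apply: is_derive_eq; rewrite /GRing.scale /=; ring.
split => //=.
- have := @is_derive1_comp _ (fun s => F (s, sg * z.2 + c)) (fun s => s + a) z.1 _ _ d1 (i1 z.1).
  by rewrite mulr1.
- have := @is_derive1_comp _ (fun t => F (z.1 + a, t)) (fun t => sg * t + c) z.2 _ _ d2 (i2 z.2).
  by rewrite mulrC.
- have := @is_derive1_comp _ (fun s => F1 (s, sg * z.2 + c)) (fun s => s + a) z.1 _ _ d11 (i1 z.1).
  by rewrite mulr1.
- have := @is_derive1_comp _ (fun t => F2 (z.1 + a, t)) (fun t => sg * t + c) z.2 _ _ d22 (i2 z.2).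
  move=> d; apply: is_derive_cast (is_deriveZ sg d) _.
  by rewrite /GRing.scale /= mulrCA -expr2 sg2 mulr1.
Qed.

Lemma has_lap_sum O (F : nat -> R * R -> R) (k : nat) :
  (forall j, has_lap O (F j) (fun=> 0)) ->
  has_lap O (fun z => \sum_(j < k) F j z) (fun=> 0).
Proof.
move=> HF; elim: k => [|k IH].
  have := has_lap_affine O 0 0.
  by under eq_fun do rewrite mul0r add0r; under [X in _ -> has_lap _ X _]eq_fun do rewrite big_ord0.
have := has_lapD _ _ _ _ _ IH (HF k); rewrite addr0.
by under [X in _ -> has_lap _ X _]eq_fun do rewrite big_ord_recr.
Qed.

Lemma within_continuous_sum (K : set (R * R)) (F : nat -> R * R -> R) (k : nat) :
  (forall j, {within K, continuous (F j)}) ->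
  {within K, continuous (fun z => \sum_(j < k) F j z)}.
Proof.
move=> HF; elim: k => [|k IH].
  under eq_fun do rewrite big_ord0.
  by apply: continuous_subspaceT => z; exact: cvg_cst.
under eq_fun do rewrite big_ord_recr /=.
exact: within_continuousD.
Qed.

Definition strip_above b (tau : R) : set (R * R) :=
  [set z | b z.2 <= z.1 /\ z.1 <= tau].
Definition strip_above_int b (tau : R) : set (R * R) :=
  [set z | b z.2 < z.1 /\ z.1 < tau].

(** The classical boundary layer function lives on the whole region above the
graph of [b]; truncation at [tau] is what a solution at finite scale can offer. *)
Record cell b (tau H : R) V : Prop := Cell {
  cell_periodic : forall s t, V (s, t + pi *+ 2) = V (s, t);
  cell_continuous : {within strip_above b tau, continuous V};
  cell_lap : has_lap (strip_above_int b tau) V (fun=> 0);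
  cell_bottom : forall t, b t <= tau -> V (b t, t) = 0;
  cell_bounds : forall z, strip_above b tau z ->
    [/\ 0 <= V z, z.1 <= V z & V z <= z.1 + 2 * H] }.

Lemma strip_above_logdom h H e T tau A : profile h H e -> radii e T tau A ->
  strip_above (bottom h e) tau `<=` logdom e (Omega h e) A.
Proof.
move=> hP rA z [bz zt]; split; last by move=> /(Omega_logpolar _ _ _ _ hP); rewrite ltNge bz.
have e0 := profile_scale_gt0 _ _ _ hP.
move=> N /near_enorm[d d0 dN].
have [|x [xp1 xp2]] := shrink_point (logpolar e z) d _ d0.
  by rewrite logpolar_enorm expR_gt0.
exists x; split; last exact: dN.
apply: (radii_inner_ball _ _ _ _ rA); apply: lt_le_trans xp2 _.
by rewrite logpolar_enorm expR_le_cancel.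
Qed.

Lemma strip_above_int_logint h H e T tau A : profile h H e -> radii e T tau A ->
  strip_above_int (bottom h e) tau `<=` logint e (Omega h e) A.
Proof.
move=> hP rA z [bz zt]; have e0 := profile_scale_gt0 _ _ _ hP; split.
  by apply: (radii_inner_ball _ _ _ _ rA); rewrite logpolar_enorm expR_lt_cancel.
by move=> /(closure_Omega _ _ _ _ hP); rewrite leNgt bz.
Qed.

Lemma bottom_closure h H e t : profile h H e ->
  closure (Omega h e) (logpolar e (bottom h e t, t)).
Proof.
move=> hP N nN.
have /near_section1 /nbhs_ballP[r /= r0 rN] := logpolar_continuous e (bottom h e t, t) _ nN.
exists (logpolar e (bottom h e t - r / 2, t)); split.
  by apply/(Omega_logpolar _ _ _ _ hP); rewrite /= gtrBl divr_gt0.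
by apply: rN; rewrite -ball_normE /= opprB addrC subrK gtr0_norm; lra.
Qed.

Lemma sum_shift (f : nat -> R) (n : nat) : f n = f 0%N ->
  \sum_(j < n) f j.+1 = \sum_(j < n) f j.
Proof.
case: n => [|n] fn; first by rewrite !big_ord0.
by rewrite big_ord_recr big_ord_recl /= fn addrC.
Qed.

(** Averaging over the [n] rotations that preserve the obstacle makes the
potential [2 pi]-periodic; no symmetry of the free boundary is known. *)
Lemma cell_average (lambda l H e : R) h A u T tau : 0 < l -> profile h H e ->
  bernoulli_solution lambda 0 (Omega h e) A u -> radii e T tau A ->
  (forall z, logdom e (Omega h e) A z ->
    [/\ 0 <= potential l e u z <= l / e, z.1 <= potential l e u z &
        z.1 <= tau -> potential l e u z <= z.1 + 2 * H]) ->
  exists V, cell (bottom h e) tau H V.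
Proof.
move=> l0 hP B rA W; have [h0 hH hp hc e0 [n en] sm] := hP.
pose S j (z : R * R) : R * R := (z.1 + 0, 1 * z.2 + j%:R * (pi *+ 2)).
pose C := strip_above (bottom h e) tau.
have bS j t : bottom h e (1 * t + j%:R * (pi *+ 2)) = bottom h e t.
  rewrite mul1r (periodic_shift (bottom h e) (pi *+ 2) j t) // => s.
  exact: bottom_periodic hP.
have CS j z : C z -> C (S j z) by move=> [c1 c2]; split; rewrite /= ?bS addr0.
have CiS j z : strip_above_int (bottom h e) tau z -> strip_above_int (bottom h e) tau (S j z).
  by move=> [c1 c2]; split; rewrite /= ?bS addr0.
have Cd := strip_above_logdom _ _ _ _ _ _ hP rA.
have Cl := strip_above_int_logint _ _ _ _ _ _ hP rA.
have n0 : (0 < n)%N.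
  by rewrite lt0n; apply/eqP => n0; move: en; rewrite n0 => /eqP; rewrite invr_eq0 gt_eqF.
have ne : e * n%:R = 1 by rewrite -en divff // gt_eqF.
pose V z := e * \sum_(j < n) potential l e u (S j z).
have Vb (c d : R) z : (forall j : 'I_n, c <= potential l e u (S j z) <= d) -> c <= V z <= d.
  move=> H1.
  have E (k : R) : k = e * \sum_(j < n) k.
    by rewrite sumr_const card_ord -[k *+ n]mulr_natr mulrCA ne mulr1.
  rewrite (E c) (E d) /V !ler_pM2l //.
  by apply/andP; split; apply: ler_sum => j _; have /andP[] := H1 j.
exists V; split.
- move=> s t; rewrite /V; congr (_ * _).
  have := sum_shift (fun j => potential l e u (S j (s, t))) n.
  rewrite /potential /S /= => <-.
    apply: eq_bigr => j _; congr (_ * (1 - u (logpolar _ (_, _)))).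
    by rewrite -natr1; ring.
  congr (_ * (1 - u _)); rewrite mul0r [X in _ = logpolar _ (_, X)]addr0.
  by apply: (logpolar_periodic e (n%:R * (pi *+ 2)) (s + 0, 1 * t)); rewrite mulrA ne mul1r.
- have cS j : continuous (S j).
    move=> z; apply: cvg_to_pair => /=.
      by apply: cvgD; [exact: cvg_fst|exact: cvg_cst].
    apply: cvgD; last exact: cvg_cst.
    by apply: cvgM; [exact: cvg_cst|exact: cvg_snd].
  have cW : {within logdom e (Omega h e) A, continuous (potential l e u)}.
    have cU : {within logdom e (Omega h e) A, continuous (u \o logpolar e)}.
      apply: (within_comp _ (closure A `\` Omega h e)) (bernoulli_continuous B) => //.
      exact: logpolar_continuous.
    move=> z; apply: cvgM; first exact: cvg_cst.
    by apply: cvgB; [exact: cvg_cst|exact: cU].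
  have cV := @within_continuous_sum C (fun j z => potential l e u (S j z)) n.
  move=> z; apply: cvgM; first exact: cvg_cst.
  apply: cV => j; apply: (within_comp _ _ (S j)) cW; first exact: cS.
  by move=> w /(CS j)/Cd.
- have lapW : has_lap (logint e (Omega h e) A) (potential l e u) (fun=> 0).
    have oW := open_domain A (Omega h e) (bernoulli_open B).
    have L := harmonic_logpolar _ u e oW (bernoulli_harmonic B).
    have := has_lapD _ _ _ _ _ (has_lap_affine _ 0 (l / e)) (has_lapZ _ _ _ (- (l / e)) L).
    rewrite mulr0 addr0; congr (has_lap _ _ _); apply/funext => z.
    by rewrite /potential /= mul0r add0r; ring.
  have := has_lapZ _ _ _ e (@has_lap_sum (strip_above_int (bottom h e) tau) (fun j z => potential l e u (S j z)) n _).
  under [X in _ -> has_lap _ _ X]eq_fun do rewrite -(mulr0 e).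
  apply => j; have one : (1 : R) ^+ 2 = 1 by rewrite expr1n.
  apply: has_lap_subset (has_lap_isometry _ _ _ 0 (j%:R * (pi *+ 2)) 1 one lapW).
  by move=> z /(CiS j)/Cl.
- move=> t bt; rewrite /V big1 ?mulr0 // => j _.
  rewrite /potential /S /= addr0 -(bS j t); set t' := 1 * t + _.
  have clO := bottom_closure h H e t' hP.
  rewrite (bernoulli_inner B) ?subrr ?mulr0 //; split => // /interior_subset.
  by move=> /(Omega_logpolar _ _ _ _ hP) /=; rewrite ltxx.
- move=> z Cz; have Wj j := W _ (Cd _ (CS j _ Cz)).
  have H1 (j : 'I_n) : 0 <= potential l e u (S j z) <= l / e by have [] := Wj j.
  have H2 (j : 'I_n) : z.1 <= potential l e u (S j z) <= z.1 + 2 * H.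
    have [_ w1 w2] := Wj j; move: w1 w2; rewrite /= addr0 => -> w2.
    by apply: w2; case: Cz.
  have /andP[v0 _] := Vb 0 (l / e) z H1.
  by have /andP[v1 v2] := Vb z.1 (z.1 + 2 * H) z H2.
Qed.

Lemma cos_ge_half (x : R) : `|x| <= pi / 4 -> 1 / 2 <= cos x.
Proof.
move=> xp; have p0 := @pi_gt0 R.
have [x1 x2] : - (pi / 4) <= x /\ x <= pi / 4 by move: xp; rewrite ler_norml => /andP.
have c0 : 0 <= cos x by apply: cos_ge0_pihalf; lra.
have : 0 <= cos (x *+ 2) by apply: cos_ge0_pihalf; rewrite -mulr_natl; lra.
rewrite cos_mulr2n => h.
apply: le_of_sqr => //; have := sqr_ge0 (cos x); lra.
Qed.

(** Decaying modes of half the frequency of the profile: positive on a half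
period, hence available as barriers there. *)
Lemma has_lap_barrier O (tau c : R) :
  has_lap O (fun z => (expR (- z.1 / 2) + expR (- (tau - z.1) / 2)) * cos ((z.2 - c) / 2)) (fun=> 0).
Proof.
exists (fun z => (- (1 / 2) * expR (- z.1 / 2) + 1 / 2 * expR (- (tau - z.1) / 2)) * cos ((z.2 - c) / 2)).
exists (fun z => - (1 / 2) * ((expR (- z.1 / 2) + expR (- (tau - z.1) / 2)) * sin ((z.2 - c) / 2))).
exists (fun z => 1 / 4 * ((expR (- z.1 / 2) + expR (- (tau - z.1) / 2)) * cos ((z.2 - c) / 2))).
exists (fun z => - (1 / 4) * ((expR (- z.1 / 2) + expR (- (tau - z.1) / 2)) * cos ((z.2 - c) / 2))).
move=> [s t] _ /=; split.
- by apply: is_derive_eq; rewrite /GRing.scale /=; field.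
- by apply: is_derive_eq; rewrite /GRing.scale /=; field.
- by apply: is_derive_eq; rewrite /GRing.scale /=; field.
- by apply: is_derive_eq; rewrite /GRing.scale /=; field.
- by ring.
Qed.

Lemma cell_continuous_isometry b tau H V (c sg : R) (K : set (R * R)) :
  cell b tau H V -> (forall z, K z -> strip_above b tau (z.1 + 0, sg * z.2 + c)) ->
  {within K, continuous (fun z => V (z.1 + 0, sg * z.2 + c))}.
Proof.
move=> cV KC; apply: (within_comp K (strip_above b tau) (fun z => (z.1 + 0, sg * z.2 + c)) V).
- move=> z; apply: cvg_to_pair => /=.
    by apply: cvgD; [exact: cvg_fst|exact: cvg_cst].
  apply: cvgD; last exact: cvg_cst.
  by apply: cvgM; [exact: cvg_cst|exact: cvg_snd].
- by move=> z /KC.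
- exact: cell_continuous cV.
Qed.

(** Reflection about an angle [c]: the difference of [V] and its mirror image
vanishes at [c] and, by periodicity, at [c + pi]; on the rectangle in between
it is dominated by a barrier. *)
Lemma cell_oscillation b tau H V s t1 t2 : cell b tau H V -> (forall t, b t <= 0) ->
  0 <= H -> 0 <= s <= tau ->
  V (s, t1) - V (s, t2) <= 4 * H * (expR (- s / 2) + expR (- (tau - s) / 2)).
Proof.
move=> cV b0 H0 st.
have p0 := @pi_gt0 R.
have p2 : 0 < (pi : R) *+ 2 by rewrite mulrn_wgt0.
pose g (s : R) := expR (- s / 2) + expR (- (tau - s) / 2).
have g0 (r : R) : 0 <= g r by rewrite addr_ge0 ?expR_ge0.
pose f c (z : R * R) := V (z.1 + 0, 1 * z.2 + c) + (-1) * V (z.1 + 0, -1 * z.2 + c).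
have Vper r t : V (r, t - pi *+ 2) = V (r, t).
  by rewrite -(cell_periodic _ _ _ _ cV r (t - _)) subrK.
pose K := [set` `[0, tau]] `*` [set` `[0, (pi : R)]] : set (R * R).
pose O := [set` `]0, tau[] `*` [set` `]0, (pi : R)[] : set (R * R).
have C1 c z : K z -> strip_above b tau (z.1 + 0, 1 * z.2 + c).
  move=> [/=]; rewrite in_itv /= => /andP[z0 zt] _; split; rewrite /= addr0 //.
  exact: le_trans (b0 _) z0.
have C2 c z : K z -> strip_above b tau (z.1 + 0, -1 * z.2 + c).
  move=> [/=]; rewrite in_itv /= => /andP[z0 zt] _; split; rewrite /= addr0 //.
  exact: le_trans (b0 _) z0.
have main c d : 0 <= d <= pi -> f c (s, d) <= 4 * H * g s.
  move=> dp.
  have cK : compact K by apply: compact_setX; exact: segment_compact.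
  pose Bz (z : R * R) := g z.1 * cos ((z.2 - pi / 2) / 2).
  have Kcos z : K z -> 1 / 2 <= cos ((z.2 - pi / 2) / 2).
    move=> [_ /=]; rewrite in_itv /= => zp; apply: cos_ge_half.
    by rewrite ler_norml; lra.
  have H4 : 0 <= 4 * H by lra.
  have lapF : has_lap O (fun z => f c z + (- (4 * H)) * Bz z)
      (fun=> (0 + (-1) * 0) + (- (4 * H)) * 0).
    have one : (1 : R) ^+ 2 = 1 by rewrite expr1n.
    have none : (-1 : R) ^+ 2 = 1 by rewrite sqrrN expr1n.
    have OC (sg : R) : O `<=` [set z | strip_above_int b tau (z.1 + 0, sg * z.2 + c)].
      move=> z [/=]; rewrite in_itv /= => /andP[z0 zt] _; split; rewrite /= addr0 //.
      exact: le_lt_trans (b0 _) z0.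
    apply: has_lapD; last by apply: has_lapZ; exact: has_lap_barrier.
    apply: has_lapD.
      exact: has_lap_subset (OC 1) (has_lap_isometry _ _ _ 0 c 1 one (cell_lap _ _ _ _ cV)).
    apply: has_lapZ.
    exact: has_lap_subset (OC (-1)) (has_lap_isometry _ _ _ 0 c (-1) none (cell_lap _ _ _ _ cV)).
  have Ksd : K (s, d) by split; rewrite /= in_itv.
  have := max_principle K K O _ _ tau cK (@subset_refl _ K) _ _ _ _ lapF _ _ _ (s, d) Ksd.
  have B1 : Bz (s, d) <= g s by rewrite /Bz /= ler_piMr // cos_le1.
  have B2 := ler_wpM2l H4 B1.
  move=> MP; suff : f c (s, d) + - (4 * H) * Bz (s, d) <= 0 by lra.
  apply: MP.
  - by move=> z Kz; exists z.
  - by move=> z [/=]; rewrite in_itv /= => /andP[z0 zt] _; rewrite ger0_norm.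
  - have opre (T : topologicalType) (k : T -> R) (a c' : R) : continuous k -> open (k @^-1` `]a, c'[).
      by move=> ck; apply: open_comp; [move=> x _; exact: ck|exact: interval_open].
    have -> : O = (@fst R R) @^-1` `]0, tau[ `&` (@snd R R) @^-1` `]0, pi[.
      by apply/seteqP; split => z [].
    by apply: openI; apply: opre => z; [exact: cvg_fst|exact: cvg_snd].
  - move=> z [/= h1 h2]; split; exact: subset_itv_oo_cc.
  - by move=> z _; rewrite !mulr0 !addr0.
  - apply: within_continuousD.
      apply: within_continuousD.
        by apply: (cell_continuous_isometry b tau H V c 1 K cV) => z /(C1 c).
      have cV2 := cell_continuous_isometry b tau H V c (-1) K cV (C2 c).
      by move=> z; apply: cvgM; [exact: cvg_cst|exact: cV2].
    apply: continuous_subspaceT => z; apply: cvgM; first exact: cvg_cst.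
    have cg : {for z.1, continuous g}.
      by apply: (is_derive_continuous g z.1 (- (1 / 2) * expR (- z.1 / 2) + 1 / 2 * expR (- (tau - z.1) / 2))); apply: is_derive_eq; rewrite /GRing.scale /=; field.
    have cc : {for z.2, continuous (fun t : R => cos ((t - pi / 2) / 2))}.
      by apply: (is_derive_continuous _ z.2 (- (1 / 2) * sin ((z.2 - pi / 2) / 2))); apply: is_derive_eq; rewrite /GRing.scale /=; field.
    apply: cvgM.
      exact: (@cvg_comp _ _ _ (@fst R R) g _ _ _ (@cvg_fst _ _ _ _ _) cg).
    exact: (@cvg_comp _ _ _ (@snd R R) (fun t : R => cos ((t - pi / 2) / 2)) _ _ _ (@cvg_snd _ _ _ _ _) cc).
  - move=> z Kz nO; have := Kcos _ Kz; set cz := cos _ => hc.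
    have Bz0 : 0 <= 4 * H * Bz z by rewrite !mulr_ge0 // -/cz; lra.
    have side : f c z = 0 -> f c z + - (4 * H) * Bz z <= 0 by move=> ->; lra.
    have level : 1 <= g z.1 -> f c z + - (4 * H) * Bz z <= 0.
      move=> g1; have [_ v1 v2] := cell_bounds _ _ _ _ cV _ (C1 c z Kz).
      have [_ v3 v4] := cell_bounds _ _ _ _ cV _ (C2 c z Kz).
      have : 1 / 2 <= Bz z.
        rewrite /Bz -/cz; apply: (le_trans hc); rewrite ler_peMl //; lra.
      move=> /(ler_wpM2l H4); rewrite /f; rewrite /= in v1 v2 v3 v4; lra.
    case: Kz => /=; rewrite !in_itv /= => z1 z2.
    have [a1|a1] := leP z.1 0.
      apply: level; have -> : z.1 = 0 by lra.
      by rewrite /g oppr0 mul0r expR0 lerDl expR_ge0.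
    have [a2|a2] := leP tau z.1.
      apply: level; have -> : z.1 = tau by lra.
      by rewrite /g subrr oppr0 mul0r expR0 lerDr expR_ge0.
    apply: side; rewrite /f.
    have [a3|a3] := leP z.2 0.
      have -> : z.2 = 0 by lra.
      by rewrite !mulr0 mulN1r subrr.
    have [a4|a4] := leP pi z.2.
      have -> : z.2 = pi by lra.
      rewrite -(cell_periodic _ _ _ _ cV (z.1 + 0) (-1 * pi + c)).
      have -> : -1 * pi + c + pi *+ 2 = 1 * pi + c by rewrite -mulr_natl; ring.
      by rewrite mulN1r subrr.
    by exfalso; apply: nO; split; rewrite /= in_itv /= ?a1 ?a2 ?a3 ?a4.
pose c := (t1 + t2) / 2; pose d := (t1 - t2) / 2.
have fE : V (s, t1) - V (s, t2) = f c (s, d).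
  by rewrite /f /= addr0 mulN1r; congr (V (_, _) - V (_, _)); rewrite /c /d; field.
have fper r : f c (s, r + pi *+ 2) = f c (s, r).
  rewrite /f /= !mul1r !mulN1r addrAC (cell_periodic _ _ _ _ cV).
  by rewrite opprD addrAC Vper.
have [r /andP[r0 r2] rE] := periodic_reduce (fun r => f c (s, r)) (pi *+ 2) d p2 fper.
rewrite fE rE; have [rp|rp] := leP r pi; first by apply: main; rewrite r0.
have -> : f c (s, r) = f (c + pi) (s, r - pi).
  rewrite /f /= !mul1r !mulN1r; congr (V (_, _) - _); first by ring.
  rewrite -(cell_periodic _ _ _ _ cV (s + 0) (- r + c)); congr (V (_, _)).
  by rewrite -mulr_natl; ring.
by apply: main; move: r2; rewrite -mulr_natl; lra.
Qed.

End CellFunction.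

(** * Asymptotics of boundary layer functions *)

Section CellAsymptotics.
Context {R : realType}.
Implicit Types (u V : R * R -> R) (A Om : set (R * R)) (z : R * R) (h b : R -> R).

Lemma cell_strip_max b (tau H s r sg k m : R) V : cell b tau H V ->
  (forall t, b t <= 0) -> 0 <= s -> r <= tau ->
  (forall t, sg * V (s, t) + (k * s + m) <= 0) ->
  (forall t, sg * V (r, t) + (k * r + m) <= 0) ->
  forall z, s <= z.1 <= r -> sg * V z + (k * z.1 + m) <= 0.
Proof.
move=> cV b0 s0 rt Hs Hr z zsr.
have p2 : 0 < (pi : R) *+ 2 by rewrite mulrn_wgt0 // pi_gt0.
pose K := [set z : R * R | s <= z.1] `&` [set z | z.1 <= r].
have Kz : K z by case/andP: zsr.
move: z Kz {zsr}; apply: (periodic_max_principle K ([set z : R * R | s < z.1] `&` [set z | z.1 < r])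
  (fun z => sg * V z + (k * z.1 + m)) (fun=> sg * 0 + 0) (pi *+ 2) s r) => //.
- by apply: closedI; [exact: closed_fst_ge|exact: closed_fst_le].
- by move=> z [/= -> ->].
- by move=> x t; rewrite (cell_periodic _ _ _ _ cV).
- by apply: openI; [exact: open_fst_gt|exact: open_fst_lt].
- by move=> z [/= /ltW h1 /ltW h2].
- apply: has_lapD; last exact: has_lap_affine.
  apply: has_lapZ; apply: has_lap_subset (cell_lap _ _ _ _ cV) => z [/= h1 h2]; split.
    by apply: le_lt_trans (b0 _) _; exact: le_lt_trans h1.
  exact: lt_le_trans rt.
- by move=> z _; rewrite mulr0 addr0.
- apply: within_continuousD; last by apply: continuous_subspaceT; exact: affine_fst_continuous.
  have KC : K `<=` strip_above b tau.
    move=> z [/= h1 h2]; split; last exact: le_trans rt.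
    by apply: le_trans (b0 _) _; exact: le_trans h1.
  have cV' := continuous_subspaceW KC (cell_continuous _ _ _ _ cV).
  by move=> z; apply: cvgM; [exact: cvg_cst|exact: cV'].
- move=> [x t] [/= h1 h2] nO.
  have [xs|xs] := leP x s; first by have -> : x = s by lra.
  have [xr|xr] := leP r x; first by have -> : x = r by lra.
  by exfalso; apply: nO.
Qed.

(** The line through the values of [V] at the heights [tau / 4] and [tau / 2]
fits [V] up to its oscillation at lower heights: [V] is within that oscillation
of the chord from [s] to [tau / 2], by the maximum principle, and two lines that
agree at [tau / 2] and nearly agree at [tau / 4] are close below. *)
Lemma cell_linear b (tau H : R) V : cell b tau H V -> (forall t, b t <= 0) ->
  0 <= H -> 0 < tau ->
  exists alpha beta, `|alpha - 1| <= 8 * H / tau /\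
  forall s t, 0 <= s <= tau / 4 ->
    `|V (s, t) - (alpha * s + beta)| <= 24 * H * expR (- s / 2).
Proof.
move=> cV b0 H0 tau0.
pose v s := V (s, 0).
pose alpha := (v (tau / 2) - v (tau / 4)) / (tau / 4).
pose beta := v (tau / 2) - alpha * (tau / 2).
have t4 : 0 < tau / 4 by lra.
have at4 : alpha * (tau / 4) = v (tau / 2) - v (tau / 4) by rewrite /alpha divfK // gt_eqF.
have inC s t : 0 <= s <= tau -> strip_above b tau (s, t).
  by move=> /andP[s0 st]; split => //=; exact: le_trans (b0 _) s0.
exists alpha, beta; split.
  have [|_ a1 a2] := cell_bounds _ _ _ _ cV (tau / 2, 0); first by apply: inC; lra.
  have [|_ a3 a4] := cell_bounds _ _ _ _ cV (tau / 4, 0); first by apply: inC; lra.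
  have e1 : (alpha - 1) * (tau / 4) = v (tau / 2) - v (tau / 4) - tau / 4 by rewrite mulrBl at4 mul1r.
  rewrite /= in a1 a2 a3 a4.
  rewrite ler_pdivlMr // -{1}(gtr0_norm tau0) -normrM.
  have -> : (alpha - 1) * tau = 4 * ((alpha - 1) * (tau / 4)) by field.
  by rewrite e1 /v ler_norml; lra.
move=> s t /andP[s0 s4].
pose d := 8 * H * expR (- s / 2).
have osc r t1 t2 : s <= r <= tau / 2 -> V (r, t1) - V (r, t2) <= d.
  move=> /andP[sr r2]; have rt : 0 <= r <= tau by lra.
  apply: le_trans (cell_oscillation b tau H V r t1 t2 cV b0 H0 rt) _.
  have : expR (- r / 2) <= expR (- s / 2) by rewrite ler_expR; lra.
  have : expR (- (tau - r) / 2) <= expR (- s / 2) by rewrite ler_expR; lra.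
  move=> h1 h2; have H4 : 0 <= 4 * H by lra.
  have := ler_wpM2l H4 (lerD h2 h1); rewrite /d; lra.
(* The chord from height [s] to height [tau / 2]. *)
pose D := tau / 2 - s.
have D0 : 0 < D by rewrite /D; lra.
pose k := (v (tau / 2) - v s) / D.
have kD : k * D = v (tau / 2) - v s by rewrite /k divfK // gt_eqF.
have chord sg : sg = 1 \/ sg = -1 ->
    sg * V (tau / 4, 0) + ((- (sg * k)) * (tau / 4) + (sg * (k * s - v s) - d)) <= 0.
  move=> sgP; apply: (cell_strip_max b tau H s (tau / 2) sg (- (sg * k)) (sg * (k * s - v s) - d) V cV b0 s0 _ _ _ (tau / 4, 0)).
  - lra.
  - move=> t'; have := osc s t' 0; have := osc s 0 t'.
    have -> : s <= s <= tau / 2 by lra.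
    by move=> /(_ isT) h1 /(_ isT) h2; case: sgP => ->; rewrite /v; lra.
  - move=> t'; have := osc (tau / 2) t' 0; have := osc (tau / 2) 0 t'.
    have -> : s <= tau / 2 <= tau / 2 by lra.
    move=> /(_ isT) h1 /(_ isT) h2; rewrite /D in kD.
    by case: sgP => ->; rewrite -/(v _) in h1 h2; lra.
  - by rewrite /=; lra.
have c1 := chord 1 (or_introl erefl); have c2 := chord (-1) (or_intror erefl).
have e0 : 0 <= d by rewrite /d !mulr_ge0 ?expR_ge0.
(* Distance of the two lines at height [s], from their distance at [tau / 4]. *)
have vs : `|v s - (alpha * s + beta)| <= 2 * d.
  pose q := v (tau / 4) - (v s + k * (tau / 4 - s)).
  have qd : `|q| <= d by rewrite ler_norml /q /v; rewrite /v in c1 c2; lra.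
  have E : (v s - (alpha * s + beta)) * (tau / 4) = - D * q.
    have kq : k = (v (tau / 2) - v s) / D by [].
    rewrite /q /beta.
    have -> : v (tau / 4) = v (tau / 2) - alpha * (tau / 4) by lra.
    have -> : v s = v (tau / 2) - k * D by lra.
    by rewrite /D; field.
  rewrite -(ler_pM2r t4) -{1}(gtr0_norm t4) -normrM E normrM normrN (gtr0_norm D0).
  have : D * `|q| <= D * d by rewrite ler_pM2l.
  have : D * d <= (tau / 2) * d by rewrite ler_wpM2r // /D; lra.
  lra.
have := osc s t 0; have := osc s 0 t; have -> : s <= s <= tau / 2 by lra.
move=> /(_ isT) h1 /(_ isT) h2; move: vs; rewrite !ler_norml /d => /andP[h3 h4].
rewrite -/(v s) in h1 h2; rewrite /d in h1 h2.
by apply/andP; split; lra.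
Qed.

End CellAsymptotics.

(** * Free radii from a boundary layer function *)

Section FreeRadiusEstimates.
Context {R : realType}.
Implicit Types (u V : R * R -> R) (A Om : set (R * R)) (z : R * R) (h b : R -> R).

(** The hypotheses shared by the two estimates below.  The shift [s0] absorbs
the difference between the lower boundaries at the two scales: [V] moved up by
[s0] is a lower barrier, and moved down an upper barrier.  Of the asymptotics of
[V] only the linear fit at the two heights [S1] and [S2] enters. *)
Record comparable_data (lambda l H e e' T tau tau' s0 S1 S2 d alpha beta : R) h A u V : Prop := ComparableData {
  cd_l : 0 < l;
  cd_profile : profile h H e;
  cd_profile' : profile h H e';
  cd_solution : bernoulli_solution lambda 0 (Omega h e) A u;
  cd_radii : radii e T tau A;
  cd_potential : forall z, logdom e (Omega h e) A z ->
    [/\ 0 <= potential l e u z <= l / e, z.1 <= potential l e u z &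
        z.1 <= tau -> potential l e u z <= z.1 + 2 * H];
  cd_cell : cell (bottom h e') tau' H V;
  cd_bottom : forall t, `|bottom h e t - bottom h e' t| <= s0;
  cd_S1 : 0 <= S1 - s0;
  cd_S12 : S1 < S2;
  cd_S2 : S2 < tau;
  cd_S2' : S2 + s0 <= tau';
  cd_d : 0 <= d;
  cd_fit_minus : forall S t, S = S1 \/ S = S2 -> `|V (S - s0, t) - (alpha * S + beta)| <= d;
  cd_fit_plus : forall S t, S = S1 \/ S = S2 -> `|V (S + s0, t) - (alpha * S + beta)| <= d;
  cd_slope : 2 * d <= alpha * (S2 - S1);
  cd_level : 2 * d < S2;
  cd_top : S2 + 2 * H <= l / e }.

Lemma bottom_le0 h H e t : profile h H e -> bottom h e t <= 0.
Proof.
move=> hP; have := bottom_bounds _ _ _ t hP; have := profile_ge0 _ _ _ hP t; lra.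
Qed.

Lemma scale_period h H e : profile h H e ->
  exists n : nat, 0 < n%:R * (pi *+ 2) :> R /\ e * (n%:R * (pi *+ 2)) = pi *+ 2.
Proof.
move=> hP; have e0 := profile_scale_gt0 _ _ _ hP; have [n en] := profile_scale_nat _ _ _ hP.
exists n; rewrite -en; split; first by rewrite mulr_gt0 ?invr_gt0 // mulrn_wgt0 // pi_gt0.
by rewrite mulrA divff ?mul1r // gt_eqF.
Qed.

Lemma bottom_value lambda h H e A u t : profile h H e ->
  bernoulli_solution lambda 0 (Omega h e) A u ->
  u (logpolar e (bottom h e t, t)) = 1.
Proof.
move=> hP B; apply: (bernoulli_inner B); split; first exact: bottom_closure hP.
by move=> /interior_subset /(Omega_logpolar _ _ _ _ hP) /=; rewrite ltxx.
Qed.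

Lemma cell_shift_continuous b tau H V (s : R) (K : set (R * R)) : cell b tau H V ->
  (forall z, K z -> strip_above b tau (z.1 + s, 1 * z.2 + 0)) ->
  {within K, continuous (fun z => V (z.1 + s, 1 * z.2 + 0))}.
Proof.
move=> cV KC; apply: (within_comp K (strip_above b tau) (fun z => (z.1 + s, 1 * z.2 + 0)) V).
- move=> z; apply: cvg_to_pair => /=.
    by apply: cvgD; [exact: cvg_fst|exact: cvg_cst].
  apply: cvgD; last exact: cvg_cst.
  by apply: cvgM; [exact: cvg_cst|exact: cvg_snd].
- by move=> z /KC.
- exact: cell_continuous cV.
Qed.

(** With [y := (N - x) / (T - S2)] both bounds on [x] become linear in [y], and
[x] can be eliminated. *)
Lemma chord_algebra_upper (T S1 S2 N alpha beta d x w Y : R) :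
  S1 < S2 -> S2 < T -> 0 <= d -> 0 <= alpha * S2 + beta ->
  0 < alpha * S2 + beta + d -> 2 * d <= alpha * (S2 - S1) -> x <= N ->
  w * (alpha * S2 + beta + d) = x * (alpha * S1 + beta - d) ->
  N - (N - w) * ((T - S2) / (T - S1)) <= x ->
  Y <= (N - x) / (T - S2) ->
  Y * (alpha * T + beta) <= N * (alpha + 2 * d / (S2 - S1)).
Proof.
move=> s12 s2 d0 L2 L2d sl xN wE xlow.
have T1 : 0 < T - S1 by lra.
have T2 : 0 < T - S2 by lra.
have D0 : 0 < S2 - S1 by lra.
set y := _ / _ => sly.
have yD : y * (T - S2) = N - x by rewrite /y divfK // gt_eqF.
have y0 : 0 <= y by rewrite /y divr_ge0 //; lra.
have yG : y * (T - S1) <= N - w.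
  have h1 : y * (T - S2) <= (N - w) * ((T - S2) / (T - S1)) by lra.
  have T21 : 0 < (T - S2) / (T - S1) by rewrite divr_gt0.
  rewrite -(ler_pM2r T21).
  have -> : y * (T - S1) * ((T - S2) / (T - S1)) = y * (T - S2) by field; rewrite gt_eqF.
  by [].
have key : y * (alpha * T + beta) * (S2 - S1) <= N * (alpha * (S2 - S1) + 2 * d).
  have h2 : w * (alpha * S2 + beta + d) <= (N - y * (T - S1)) * (alpha * S2 + beta + d).
    by rewrite ler_pM2r //; lra.
  have xE : x = N - y * (T - S2) by lra.
  rewrite wE xE in h2.
  have h3 : 0 <= y * d * (T - S2 + (T - S1)).
    by apply: mulr_ge0; [exact: mulr_ge0|lra].
  lra.
have LT : 0 <= alpha * T + beta.
  have a0 : 0 <= alpha by rewrite -(pmulr_lge0 _ D0); lra.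
  have : alpha * S2 <= alpha * T by rewrite ler_wpM2l //; lra.
  lra.
apply: le_trans (ler_wpM2r LT sly) _.
rewrite -(ler_pM2r D0); apply: le_trans key _.
by rewrite le_eqVlt; apply/orP; left; apply/eqP; field; rewrite gt_eqF.
Qed.

Lemma chord_algebra_lower (T S1 S2 N alpha beta d x w Y : R) :
  S1 < S2 -> S2 < T -> 0 <= d ->
  0 < alpha * S2 + beta - d -> 2 * d <= alpha * (S2 - S1) -> x <= N ->
  w * (alpha * S2 + beta - d) = x * (alpha * S1 + beta + d) ->
  x <= N - (N - w) * ((T - S2) / (T - S1)) ->
  (N - x) / (T - S2) <= Y ->
  N * (alpha - 2 * d / (S2 - S1)) <= Y * (alpha * T + beta).
Proof.
move=> s12 s2 d0 L2d sl xN wE xup.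
have T1 : 0 < T - S1 by lra.
have T2 : 0 < T - S2 by lra.
have D0 : 0 < S2 - S1 by lra.
set y := _ / _ => sly.
have yD : y * (T - S2) = N - x by rewrite /y divfK // gt_eqF.
have y0 : 0 <= y by rewrite /y divr_ge0 //; lra.
have yG : N - w <= y * (T - S1).
  have h1 : (N - w) * ((T - S2) / (T - S1)) <= y * (T - S2) by lra.
  have T21 : 0 < (T - S2) / (T - S1) by rewrite divr_gt0.
  rewrite -(ler_pM2r T21).
  have -> : y * (T - S1) * ((T - S2) / (T - S1)) = y * (T - S2) by field; rewrite gt_eqF.
  by [].
have key : N * (alpha * (S2 - S1) - 2 * d) <= y * (alpha * T + beta) * (S2 - S1).
  have h2 : (N - y * (T - S1)) * (alpha * S2 + beta - d) <= w * (alpha * S2 + beta - d).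
    by rewrite ler_pM2r //; lra.
  have xE : x = N - y * (T - S2) by lra.
  rewrite wE xE in h2.
  have h3 : 0 <= y * d * (T - S2 + (T - S1)).
    by apply: mulr_ge0; [exact: mulr_ge0|lra].
  lra.
have LT : 0 <= alpha * T + beta.
  have a0 : 0 <= alpha by rewrite -(pmulr_lge0 _ D0); lra.
  have : alpha * S2 <= alpha * T by rewrite ler_wpM2l //; lra.
  lra.
apply: le_trans (ler_wpM2r LT sly).
rewrite -(ler_pM2r D0); apply: le_trans key.
by rewrite le_eqVlt; apply/orP; left; apply/eqP; field; rewrite gt_eqF.
Qed.

Section Comparison.
Context (lambda l H e e' T tau tau' s0 S1 S2 d alpha beta : R).
Context (h : R -> R) (A : set (R * R)) (u V : R * R -> R).
Context (CD : comparable_data lambda l H e e' T tau tau' s0 S1 S2 d alpha beta h A u V).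

Let W := potential l e u.
Let N := l / e.

Lemma level_logdom S t : 0 <= S -> S <= tau -> logdom e (Omega h e) A (S, t).
Proof.
case: CD => _ hP _ _ rA _ _ _ _ _ _ _ _ _ _ _ _ _ S0 St.
apply: (strip_above_logdom _ _ _ _ _ _ hP rA); split => //=.
exact: le_trans (bottom_le0 _ _ _ _ hP) S0.
Qed.

(** Both functions are harmonic above the lower boundary of the shifted [V],
where [V] vanishes and [W] is nonnegative. *)
Lemma potential_ge_cell (c : R) : 0 <= c ->
  (forall t, c * V (S2 - s0, t) <= W (S2, t)) ->
  forall t, c * V (S1 - s0, t) <= W (S1, t).
Proof.
move=> c0 Hc t; have [l0 hP hP' B rA Wb cV bb s1 s12 s2 s2' _ _ _ _ _ _] := CD.
have e0 := profile_scale_gt0 _ _ _ hP.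
have s00 : 0 <= s0 by exact: le_trans (normr_ge0 _) (bb 0).
have [n [P0 eP]] := scale_period _ _ _ hP.
have bper h' H' k x : profile h' H' k -> bottom h' k (x + n%:R * (pi *+ 2)) = bottom h' k x.
  by move=> kP; apply: periodic_shift => y; exact: bottom_periodic kP.
have Vper x y : V (x, y + n%:R * (pi *+ 2)) = V (x, y).
  exact: (periodic_shift (fun y => V (x, y)) (pi *+ 2) n y (cell_periodic _ _ _ _ cV x)).
pose b' := bottom h e'.
have bb' x : bottom h e x <= b' x + s0 by have := bb x; rewrite ler_norml /b'; lra.
pose K := [set z : R * R | b' z.2 <= z.1 - s0] `&` [set z | z.1 <= S2].
pose Oi := [set z : R * R | b' z.2 < z.1 - s0] `&` [set z | z.1 < S2].
have KC z : K z -> strip_above b' tau' (z.1 + - s0, 1 * z.2 + 0).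
  by move=> [/= k1 k2]; rewrite mul1r addr0; split => //=; lra.
have Kd : K `<=` logdom e (Omega h e) A.
  move=> z [/= k1 k2]; apply: (strip_above_logdom _ _ _ _ _ _ hP rA); split.
    by have := bb' z.2; lra.
  lra.
have gap : continuous (fun z : R * R => z.1 - s0 - b' z.2).
  move=> z; have -> : (fun z : R * R => z.1 - s0 - b' z.2) = (fun z : R * R => (z.1 - b' z.2) - s0).
    by apply/funext => w; ring.
  by apply: cvgB; [exact: height_gap_continuous hP' z|exact: cvg_cst].
have one : (1 : R) ^+ 2 = 1 by rewrite expr1n.
have K1 : K (S1, t).
  split => /=; last exact: ltW.
  by apply: le_trans (bottom_le0 _ _ _ _ hP') s1.
have MP := bernoulli_comparison lambda 0 (Omega h e) A u e (n%:R * (pi *+ 2))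
  (- H - 2 * e' * H ^+ 2) S2 N K Oi (fun z => c * V (z.1 + - s0, 1 * z.2 + 0) - N)
  B (Omega_open _ _ _ hP) P0 eP _ Kd.
suff : N * u (logpolar e (S1, t)) + (c * V (S1 - s0, t) - N) <= 0.
  by rewrite /W /potential -/N; lra.
have -> : V (S1 - s0, t) = V (S1 + - s0, 1 * t + 0) by rewrite mul1r addr0.
apply: (MP _ _ _ _ _ _ _ _ _ (S1, t) K1).
- apply: closedI; last exact: closed_fst_le.
  have := @preimage_closed _ _ (fun z : R * R => z.1 - s0 - b' z.2) [set t : R | 0 <= t]
    (fun z _ => gap z) (@closed_ge R 0).
  by congr closed; apply/seteqP; split => z /=; rewrite subr_ge0.
- move=> z [/= k1 k2]; rewrite k2 andbT.
  have := bottom_bounds _ _ _ z.2 hP'; have := profile_le _ _ _ hP' z.2.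
  rewrite -/b'; lra.
- move=> x y; rewrite /K /setI /mkset /= /b' (bper _ _ _ _ hP') //.
- by move=> x y /=; rewrite !mul1r !addr0 Vper.
- apply: openI; last exact: open_fst_lt.
  have := @open_comp _ _ (fun z : R * R => z.1 - s0 - b' z.2) [set t : R | 0 < t]
    (fun z _ => gap z) (@open_gt R 0).
  by congr open; apply/seteqP; split => z /=; rewrite subr_gt0.
- by move=> z [_ [/= /ltW k1 /ltW k2]].
- have L := has_lap_isometry _ _ _ (- s0) 0 1 one (cell_lap _ _ _ _ cV).
  have := has_lapD _ _ _ _ _ (has_lapZ _ _ _ c L) (has_lap_affine _ 0 (- N)).
  under [X in has_lap _ X _]eq_fun do rewrite mul0r add0r.
  under [X in has_lap _ _ X]eq_fun do rewrite mulr0 addr0.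
  apply: has_lap_subset => z [_ [/= k1 k2]]; rewrite /strip_above_int /= mul1r addr0; split => //.
  lra.
- apply: within_continuousB; last by apply: continuous_subspaceT => z; exact: cvg_cst.
  have cVs := cell_shift_continuous _ _ _ _ (- s0) K cV KC.
  by move=> z; apply: cvgM; [exact: cvg_cst|exact: cVs].
- move=> [x y] [/= k1 k2] nO; rewrite mul1r addr0.
  have dz : logdom e (Omega h e) A (x, y) by apply: Kd.
  have [/andP[w0 _] _ _] := Wb _ dz.
  suff : c * V (x - s0, y) <= W (x, y) by rewrite /W /potential -/N; lra.
  have [xs|xs] := leP S2 x; first by have -> : x = S2 by lra.
  have [xb|xb] := leP (x - s0) (b' y).
    have -> : x - s0 = b' y by lra.
    by rewrite (cell_bottom _ _ _ _ cV) ?mulr0 //; have := bottom_le0 _ _ _ y hP'; rewrite -/(b' y); lra.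
  exfalso; apply: nO; split => //.
  apply: (strip_above_int_logint _ _ _ _ _ _ hP rA); split => /=; last by lra.
  by have := bb' y; lra.
Qed.

(** With the opposite shift it is [W] that vanishes on the lower boundary, where
[V] is nonnegative. *)
Lemma potential_le_cell (c : R) : 0 <= c ->
  (forall t, W (S2, t) <= c * V (S2 + s0, t)) ->
  forall t, W (S1, t) <= c * V (S1 + s0, t).
Proof.
move=> c0 Hc t; have [l0 hP hP' B rA Wb cV bb s1 s12 s2 s2' _ _ _ _ _ _] := CD.
have e0 := profile_scale_gt0 _ _ _ hP.
have s00 : 0 <= s0 by exact: le_trans (normr_ge0 _) (bb 0).
have [n [P0 eP]] := scale_period _ _ _ hP.
have bper x : bottom h e (x + n%:R * (pi *+ 2)) = bottom h e x.
  by apply: periodic_shift => y; exact: bottom_periodic hP.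
have Vper x y : V (x, y + n%:R * (pi *+ 2)) = V (x, y).
  exact: (periodic_shift (fun y => V (x, y)) (pi *+ 2) n y (cell_periodic _ _ _ _ cV x)).
pose b' := bottom h e'.
have bb' x : b' x <= bottom h e x + s0 by have := bb x; rewrite ler_norml /b'; lra.
pose K := strip_above (bottom h e) S2.
pose Oi := [set z : R * R | bottom h e z.2 < z.1] `&` [set z | z.1 < S2].
have KC z : K z -> strip_above b' tau' (z.1 + s0, 1 * z.2 + 0).
  by move=> [/= k1 k2]; rewrite mul1r addr0; split => /=; [have := bb' z.2; lra|lra].
have Kd : K `<=` logdom e (Omega h e) A.
  move=> z [/= k1 k2]; apply: (strip_above_logdom _ _ _ _ _ _ hP rA); split => //.
  lra.
have one : (1 : R) ^+ 2 = 1 by rewrite expr1n.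
have K1 : K (S1, t).
  split => /=; last exact: ltW.
  by apply: le_trans (bottom_le0 _ _ _ _ hP) _; lra.
have MP := bernoulli_comparison lambda 0 (Omega h e) A u e (n%:R * (pi *+ 2))
  (- H - 2 * e * H ^+ 2) S2 (- N) K Oi (fun z => - c * V (z.1 + s0, 1 * z.2 + 0) + N)
  B (Omega_open _ _ _ hP) P0 eP _ Kd.
suff : - N * u (logpolar e (S1, t)) + (- c * V (S1 + s0, t) + N) <= 0.
  by rewrite /W /potential -/N; lra.
have -> : V (S1 + s0, t) = V (S1 + s0, 1 * t + 0) by rewrite mul1r addr0.
apply: (MP _ _ _ _ _ _ _ _ _ (S1, t) K1).
- by apply: closedI; [exact: closed_above_bottom hP|exact: closed_fst_le].
- move=> z [/= k1 k2]; rewrite k2 andbT.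
  have := bottom_bounds _ _ _ z.2 hP; have := profile_le _ _ _ hP z.2.
  lra.
- by move=> x y; rewrite /K /strip_above /mkset /= bper.
- by move=> x y /=; rewrite !mul1r !addr0 Vper.
- by apply: openI; [exact: open_above_bottom hP|exact: open_fst_lt].
- by move=> z [_ [/= /ltW k1 /ltW k2]].
- have L := has_lap_isometry _ _ _ s0 0 1 one (cell_lap _ _ _ _ cV).
  have := has_lapD _ _ _ _ _ (has_lapZ _ _ _ (- c) L) (has_lap_affine _ 0 N).
  under [X in has_lap _ X _]eq_fun do rewrite mul0r add0r.
  under [X in has_lap _ _ X]eq_fun do rewrite mulr0 addr0.
  apply: has_lap_subset => z [_ [/= k1 k2]]; rewrite /strip_above_int /= mul1r addr0.
  by split; [have := bb' z.2; rewrite /b'; lra|lra].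
- apply: within_continuousD; last by apply: continuous_subspaceT => z; exact: cvg_cst.
  have cVs := cell_shift_continuous _ _ _ _ s0 K cV KC.
  by move=> z; apply: cvgM; [exact: cvg_cst|exact: cVs].
- move=> [x y] Kxy nO; have [/= k1 k2] := Kxy; rewrite mul1r addr0.
  have [v0 _ _] := cell_bounds _ _ _ _ cV _ (KC _ Kxy); rewrite /= mul1r addr0 in v0.
  suff : W (x, y) <= c * V (x + s0, y) by rewrite /W /potential -/N; lra.
  have [xs|xs] := leP S2 x; first by have -> : x = S2 by lra.
  have [xb|xb] := leP x (bottom h e y).
    have xE : x = bottom h e y by lra.
    by rewrite {1}xE /W /potential (bottom_value _ _ _ _ _ _ _ hP B) subrr mulr0 mulr_ge0.
  exfalso; apply: nO; split => //.
  apply: (strip_above_int_logint _ _ _ _ _ _ hP rA); split => //=.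
  lra.
Qed.

Lemma potential_threshold (S t w : R) :
  (w <= W (S, t)) = (u (logpolar e (S, t)) <= 1 - w / N) /\
  (W (S, t) <= w) = (1 - w / N <= u (logpolar e (S, t))).
Proof.
have [l0 hP _ _ _ _ _ _ _ _ _ _ _ _ _ _ _ _] := CD.
have N0 : 0 < N by rewrite divr_gt0 // (profile_scale_gt0 _ _ _ hP).
have wN : w / N * N = w by rewrite divfK // gt_eqF.
split; rewrite /W /potential -/N; apply/idP/idP => H1.
- by rewrite -(ler_pM2r N0); lra.
- by move: H1; rewrite -(ler_pM2r N0); lra.
- by rewrite -(ler_pM2r N0); lra.
- by move: H1; rewrite -(ler_pM2r N0); lra.
Qed.

(** Let [x] be the infimum of [W] over the level [S2].  Comparison with [V]
below that level bounds [W] on the level [S1] in terms of [x]; the chord from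
[S1] to the outermost level then improves the bound at [S2], which forces [x] to
be as large as the linear fit of [V] predicts; the chord from [S2] yields the
slope on the free boundary. *)
Lemma outer_estimate :
  lambda * expR (e * T) * l * (alpha * T + beta) <= N * (alpha + 2 * d / (S2 - S1)).
Proof.
have [l0 hP hP' B rA Wb cV bb s1 s12 s2 s2' d0 fm fp sl lv tp] := CD.
have e0 := profile_scale_gt0 _ _ _ hP.
have s00 : 0 <= s0 by exact: le_trans (normr_ge0 _) (bb 0).
have N0 : 0 < N by rewrite divr_gt0.
have tT := radii_le _ _ _ _ rA.
have S10 : 0 <= S1 by lra.
have Wl S t : 0 <= S -> S <= tau -> [/\ 0 <= W (S, t) <= N, S <= W (S, t) & W (S, t) <= S + 2 * H].
  by move=> h1 h2; have [w1 w2 w3] := Wb _ (level_logdom S t h1 h2); split => //; exact: w3.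
pose E := [set W (S2, t) | t in [set: R]].
have E0 : E !=set0 by exists (W (S2, 0)); exists 0.
have lbE : lbound E S2 by move=> _ [t _ <-]; have [] := Wl S2 t _ (ltW s2) => //; lra.
pose x := inf E.
have xle t : x <= W (S2, t) by apply: ge_inf; [exists S2|exists t].
have xge y : (forall t, y <= W (S2, t)) -> y <= x.
  by move=> yE; apply: lb_le_inf => // _ [t _ <-].
have xS : S2 <= x by apply: lb_le_inf.
have L2 : S2 - d <= alpha * S2 + beta.
  have := fp S2 0 (or_intror erefl).
  have [_ v1 _] : [/\ 0 <= V (S2 + s0, 0), (S2 + s0, (0:R)).1 <= V (S2 + s0, 0) & V (S2 + s0, 0) <= (S2 + s0, (0:R)).1 + 2 * H].
    apply: (cell_bounds _ _ _ _ cV); split => //=.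
    by apply: le_trans (bottom_le0 _ _ _ _ hP') _; lra.
  by rewrite /= in v1; rewrite ler_norml; lra.
have L2d : 0 < alpha * S2 + beta + d by lra.
pose c := x / (alpha * S2 + beta + d).
have cL2 : c * (alpha * S2 + beta + d) = x by rewrite /c divfK // gt_eqF.
have c0 : 0 <= c by rewrite /c divr_ge0 //; [lra|exact: ltW].
pose w1 := c * (alpha * S1 + beta - d).
have w1W t : w1 <= W (S1, t).
  apply: le_trans (potential_ge_cell c c0 _ t).
    by rewrite ler_wpM2l //; have := fm S1 t (or_introl erefl); rewrite ler_norml; lra.
  move=> t'; apply: le_trans (xle t'); rewrite -cL2 ler_wpM2l //.
  by have := fm S2 t' (or_intror erefl); rewrite ler_norml; lra.
have clO z : closure (Omega h e) (logpolar e z) -> z.1 <= 0.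
  by move=> /(closure_Omega _ _ _ _ hP) zb; exact: le_trans zb (bottom_le0 _ _ _ _ hP).
have w1N : w1 <= N by have [/andP[_ h1] _ _] := Wl S1 0 S10 ltac:(lra); exact: le_trans h1.
have xN : x <= N by have [/andP[_ h1] _ _] := Wl S2 0 ltac:(lra) (ltW s2); exact: le_trans h1.
have T1 : 0 < T - S1 by lra.
have T2 : 0 < T - S2 by lra.
have xlow : N - (N - w1) * ((T - S2) / (T - S1)) <= x.
  apply: xge => t.
  have := outer_line lambda 0 (Omega h e) A u e T S1 (1 - w1 / N) e0 B (Omega_open _ _ _ hP)
    (radii_outer_bound _ _ _ _ rA).
  move=> /(_ _ _ _ _ (S2, t)) ol.
  have : u (logpolar e (S2, t)) <= 0 + (1 - w1 / N - 0) * ((T - S2) / (T - S1)).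
    apply: ol.
    - lra.
    - by move=> z /clO h1; lra.
    - by rewrite subr_ge0 ler_pdivrMr // mul1r.
    - move=> [z1 z2] dz /= zE; rewrite zE.
      by have [<- _] := potential_threshold S1 z2 w1.
    - by apply: level_logdom; lra.
    - exact: ltW.
  move=> h1; have [-> _] := potential_threshold S2 t (N - (N - w1) * ((T - S2) / (T - S1))).
  apply: le_trans h1 _; rewrite add0r subr0.
  have -> : (N - (N - w1) * ((T - S2) / (T - S1))) / N = 1 - (1 - w1 / N) * ((T - S2) / (T - S1)).
    by field; rewrite !gt_eqF.
  lra.
have [p bp pT] := radii_outer _ _ _ _ rA.
have slope : lambda * expR (e * T) <= (1 - x / N - 0) / (e * (T - S2)).
  apply: (outer_slope lambda 0 (Omega h e) A u e T S2 (1 - x / N) p e0 ltr01 B (Omega_open _ _ _ hP) (radii_outer_bound _ _ _ _ rA)) => //.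
  - lra.
  - by move=> z /clO h1; lra.
  - by rewrite subr_ge0 ler_pdivrMr // mul1r.
  - have r0 : 0 < 1 - e * H by have := profile_small _ _ _ hP; lra.
    move=> y dy; have := bernoulli_bounds _ _ _ _ _ _ _ ltr01 r0 B (Omega_open _ _ _ hP) (fun y => Omega_ball _ _ _ y hP) (radii_outer_bound _ _ _ _ rA) y dy.
    by case/andP.
  - move=> [z1 z2] dz /= zE; rewrite zE.
    by have [<- _] := potential_threshold S2 z2 x.
have S2T : S2 < T by lra.
apply: (chord_algebra_upper _ _ _ _ _ _ _ x w1 _ s12 S2T d0 _ L2d sl xN _ xlow).
- lra.
- by rewrite /w1 -cL2; ring.
have -> : (N - x) / (T - S2) = (1 - x / N - 0) / (e * (T - S2)) * l.
  by rewrite /N; field; rewrite !gt_eqF.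
by rewrite ler_pM2r.
Qed.

(** The mirror image of the outer estimate, with suprema and the inner radius. *)
Lemma inner_estimate :
  N * (alpha - 2 * d / (S2 - S1)) <= lambda * expR (e * tau) * l * (alpha * tau + beta).
Proof.
have [l0 hP hP' B rA Wb cV bb s1 s12 s2 s2' d0 fm fp sl lv tp] := CD.
have e0 := profile_scale_gt0 _ _ _ hP.
have s00 : 0 <= s0 by exact: le_trans (normr_ge0 _) (bb 0).
have N0 : 0 < N by rewrite divr_gt0.
have S10 : 0 <= S1 by lra.
have Wl S t : 0 <= S -> S <= tau -> [/\ 0 <= W (S, t) <= N, S <= W (S, t) & W (S, t) <= S + 2 * H].
  by move=> h1 h2; have [w1 w2 w3] := Wb _ (level_logdom S t h1 h2); split => //; exact: w3.
pose E := [set W (S2, t) | t in [set: R]].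
have E0 : E !=set0 by exists (W (S2, 0)); exists 0.
have ubE : ubound E (S2 + 2 * H).
  by move=> _ [t _ <-]; have [] := Wl S2 t _ (ltW s2) => //; lra.
pose x := sup E.
have xge t : W (S2, t) <= x by apply: ub_le_sup; [exists (S2 + 2 * H)|exists t].
have xle y : (forall t, W (S2, t) <= y) -> x <= y.
  by move=> yE; apply: ge_sup => // _ [t _ <-].
have x0 : 0 <= x.
  by apply: le_trans (xge 0); have [/andP[]] := Wl S2 0 ltac:(lra) (ltW s2).
have xN : x <= N by apply: le_trans tp; apply: ge_sup.
have L2 : S2 - d <= alpha * S2 + beta.
  have := fp S2 0 (or_intror erefl).
  have [_ v1 _] : [/\ 0 <= V (S2 + s0, 0), (S2 + s0, (0:R)).1 <= V (S2 + s0, 0) & V (S2 + s0, 0) <= (S2 + s0, (0:R)).1 + 2 * H].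
    apply: (cell_bounds _ _ _ _ cV); split => //=.
    by apply: le_trans (bottom_le0 _ _ _ _ hP') _; lra.
  by rewrite /= in v1; rewrite ler_norml; lra.
have L2d : 0 < alpha * S2 + beta - d by lra.
pose c := x / (alpha * S2 + beta - d).
have cL2 : c * (alpha * S2 + beta - d) = x by rewrite /c divfK // gt_eqF.
have c0 : 0 <= c by rewrite /c divr_ge0 // ltW.
pose w1 := c * (alpha * S1 + beta + d).
have w1W t : W (S1, t) <= w1.
  apply: le_trans (potential_le_cell c c0 _ t) _.
    move=> t'; apply: le_trans (xge t') _; rewrite -cL2 ler_wpM2l //.
    by have := fp S2 t' (or_intror erefl); rewrite ler_norml; lra.
  by rewrite ler_wpM2l //; have := fp S1 t (or_introl erefl); rewrite ler_norml; lra.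
have w1x : w1 <= x by rewrite -cL2 ler_wpM2l //; lra.
have w10 : 0 <= w1.
  by apply: le_trans (w1W 0); have [/andP[]] := Wl S1 0 S10 ltac:(lra).
have T1 : 0 < tau - S1 by lra.
have T2 : 0 < tau - S2 by lra.
have u0 y : (closure A `\` Omega h e) y -> 0 <= u y.
  have r0 : 0 < 1 - e * H by have := profile_small _ _ _ hP; lra.
  move=> dy; have := bernoulli_bounds _ _ _ _ _ _ _ ltr01 r0 B (Omega_open _ _ _ hP) (fun y => Omega_ball _ _ _ y hP) (radii_outer_bound _ _ _ _ rA) y dy.
  by case/andP.
have xup : x <= N - (N - w1) * ((tau - S2) / (tau - S1)).
  apply: xle => t.
  have := inner_line lambda 0 (Omega h e) A u e tau S1 (1 - w1 / N) e0 B (Omega_open _ _ _ hP)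
    (radii_inner_ball _ _ _ _ rA).
  move=> /(_ _ u0 _ _ (S2, t)) ol.
  have : 0 + (1 - w1 / N - 0) * ((tau - S2) / (tau - S1)) <= u (logpolar e (S2, t)).
    apply: ol.
    - lra.
    - rewrite subr_ge0 ler_pdivrMr // mul1r gerBl divr_ge0 ?(ltW N0) // andbT; lra.
    - move=> [z1 z2] dz /= zE; rewrite zE.
      by have [_ <-] := potential_threshold S1 z2 w1.
    - by apply: level_logdom; lra.
    - by rewrite /= !ltW.
  move=> h1; have [_ ->] := potential_threshold S2 t (N - (N - w1) * ((tau - S2) / (tau - S1))).
  apply: le_trans h1; rewrite add0r subr0.
  have -> : (N - (N - w1) * ((tau - S2) / (tau - S1))) / N = 1 - (1 - w1 / N) * ((tau - S2) / (tau - S1)).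
    by field; rewrite !gt_eqF.
  lra.
have [p bp pT] := radii_inner _ _ _ _ rA.
have slope : (1 - x / N - 0) / (e * (tau - S2)) <= lambda * expR (e * tau).
  apply: (inner_slope lambda 0 (Omega h e) A u e tau S2 (1 - x / N) p e0 ltr01 B (Omega_open _ _ _ hP) (radii_inner_ball _ _ _ _ rA)) => //.
  - by rewrite subr_ge0 ler_pdivrMr // mul1r xN gerBl divr_ge0 // ltW.
  - move=> [z1 z2] dz /= zE; rewrite zE.
    by have [_ <-] := potential_threshold S2 z2 x.
apply: (chord_algebra_lower _ _ _ _ _ _ _ x w1 _ s12 s2 d0 L2d sl xN _ xup).
- by rewrite /w1 -cL2; ring.
have -> : (N - x) / (tau - S2) = (1 - x / N - 0) / (e * (tau - S2)) * l.
  by rewrite /N; field; rewrite !gt_eqF.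
by rewrite ler_pM2r.
Qed.

End Comparison.
End FreeRadiusEstimates.

(** * The boundary layer shift *)

Section BoundaryLayerConstant.
Context {R : realType}.
Implicit Types (u V : R * R -> R) (A Om X Y : set (R * R)) (z p q : R * R) (h : R -> R).

(** Coefficient of [e] in the error of the linear fit at heights of order
[l / e]: the tail of the exponential decay, and the effect of the shift between
the lower boundaries. *)
Definition fit_error (l H : R) : R := 24 * (128 * H) / l + 4 * H ^+ 2.

Lemma fit_error_ge0 (l H : R) : 0 < l -> 0 <= H -> 0 <= fit_error l H.
Proof.
move=> l0 H0; rewrite /fit_error; apply: addr_ge0; last by rewrite mulr_ge0 ?exprn_ge0.
by rewrite divr_ge0 ?mulr_ge0 // ltW.
Qed.

Record fine_scale (l H e : R) h : Prop := FineScale {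
  fine_profile : profile h H e;
  fine_height : 32 * H * e <= l;
  fine_shift : 128 * H ^+ 2 * e ^+ 2 <= l;
  fine_fit : 128 * fit_error l H * e ^+ 2 <= l }.

Record controlled_solution (lambda l H e T tau : R) h A u : Prop := ControlledSolution {
  ctl_solution : bernoulli_solution lambda 0 (Omega h e) A u;
  ctl_radii : radii e T tau A;
  ctl_outer : e * T <= l;
  ctl_inner : l - 2 * H * e <= e * tau;
  ctl_potential : forall z, logdom e (Omega h e) A z ->
    [/\ 0 <= potential l e u z <= l / e, z.1 <= potential l e u z &
        z.1 <= tau -> potential l e u z <= z.1 + 2 * H] }.

(** The height shift that a free boundary at logarithmic radius [S] reveals: the
gradient condition on that circle means that the affine profile of the potential
vanishes at [- layer_shift]. *)
Definition layer_shift (lambda e S : R) : R := (e * lambda * expR (e * S))^-1 - S.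

Lemma expRN_le_inv (x : R) : 0 < x -> expR (- x) <= x^-1.
Proof.
move=> x0; rewrite expRN lef_pV2 ?posrE ?expR_gt0 //.
by have := expR_ge1Dx x; lra.
Qed.

(** The heights [N / 32] and [N / 16] leave room for the shifts, both below the
inner free radii and below the range of the linear fit. *)
Lemma window_arith (H N tau tau' s0 d alpha : R) :
  0 < N -> 32 * H <= N -> 15 / 16 * N <= tau -> 15 / 16 * N <= tau' ->
  0 <= s0 -> s0 <= N / 64 -> 0 <= d -> d <= N / 128 -> 1 / 2 <= alpha ->
  [/\ 0 <= N / 32 - s0, N / 32 < N / 16, N / 16 < tau, N / 16 + s0 <= tau' &
      2 * d <= alpha * (N / 16 - N / 32)] /\
  [/\ 2 * d < N / 16, N / 16 + 2 * H <= N & forall S s, S = N / 32 \/ S = N / 16 ->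
      `|s| <= s0 -> N / 64 <= S + s <= tau' / 4].
Proof.
move=> N0 NH Nt Nt' s00 s0N d0 dN al; split; split; try lra.
  have : 1 / 2 * (N / 16 - N / 32) <= alpha * (N / 16 - N / 32) by rewrite ler_wpM2r //; lra.
  lra.
by move=> S s SP; rewrite ler_norml => /andP[h1 h2]; case: SP => ->; lra.
Qed.

Lemma window_quotient (N alpha d : R) : 0 < N ->
  N * (alpha + 2 * d / (N / 16 - N / 32)) = N * alpha + 64 * d /\
  N * (alpha - 2 * d / (N / 16 - N / 32)) = N * alpha - 64 * d.
Proof.
move=> N0; have -> : N / 16 - N / 32 = N / 32 by field.
by split; field; rewrite gt_eqF.
Qed.

Lemma cell_fit_shifted (V : R * R -> R) (H N tau' s0 alpha beta S s t : R) :
  (forall s t, 0 <= s <= tau' / 4 ->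
    `|V (s, t) - (alpha * s + beta)| <= 24 * H * expR (- s / 2)) ->
  0 <= H -> 0 < N -> 0 <= alpha <= 2 ->
  N / 64 <= S + s -> S + s <= tau' / 4 -> `|s| <= s0 ->
  `|V (S + s, t) - (alpha * S + beta)| <= 24 * (128 * H) / N + 2 * s0.
Proof.
move=> fit H0 N0 /andP[alow aup] h1 h2 h3.
have hS : 0 <= S + s <= tau' / 4 by rewrite h2 andbT; lra.
have ex : expR (- (S + s) / 2) <= 128 / N.
  have x0 : 0 < (S + s) / 2 by lra.
  rewrite mulNr; apply: le_trans (expRN_le_inv _ x0) _.
  by rewrite ler_pdivlMr // mulrC ler_pdivrMr //; lra.
have H24 : 0 <= 24 * H by lra.
have f3 : `|alpha * s| <= 2 * s0.
  by rewrite normrM; apply: ler_pM => //; rewrite ger0_norm.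
have -> : V (S + s, t) - (alpha * S + beta) =
  (V (S + s, t) - (alpha * (S + s) + beta)) + alpha * s by ring.
apply: le_trans (ler_normD _ _) _; apply: lerD f3.
apply: le_trans (fit (S + s) t hS) _; apply: le_trans (ler_wpM2l H24 ex) _.
by rewrite le_eqVlt; apply/orP; left; apply/eqP; ring.
Qed.

(** The estimates on the free radii, solved for [beta / alpha]. *)
Lemma shift_of_estimate (lambda l e alpha beta d S : R) :
  0 < lambda -> 0 < l -> 0 < e -> 0 <= d -> 1 / 2 <= alpha -> 0 <= S ->
  (lambda * expR (e * S) * l * (alpha * S + beta) <= l / e * alpha + 64 * d ->
     beta / alpha <= layer_shift lambda e S + 128 * d / (lambda * l)) /\
  (l / e * alpha - 64 * d <= lambda * expR (e * S) * l * (alpha * S + beta) ->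
     layer_shift lambda e S - 128 * d / (lambda * l) <= beta / alpha).
Proof.
move=> lam0 l0 e0 d0 alow S0; have a0 : 0 < alpha by lra.
rewrite /layer_shift -!(mulrA e); set r := lambda * expR _.
have r0 : 0 < r by rewrite mulr_gt0 ?expR_gt0.
have rlam : lambda <= r by rewrite /r ler_peMr ?(ltW lam0) // -expR0 ler_expR mulr_ge0 // ltW.
clearbody r; have q0 : 0 < r * l * alpha by rewrite !mulr_gt0.
have f1 : (e * r)^-1 * (r * l * alpha) = l / e * alpha by field; rewrite !gt_eqF.
have f2 : 64 * d <= 128 * d / (lambda * l) * (r * l * alpha).
  have -> : 128 * d / (lambda * l) * (r * l * alpha) = 128 * (d * ((r / lambda) * alpha)).
    by field; rewrite !gt_eqF.
  have rl : 1 <= r / lambda by rewrite ler_pdivlMr // mul1r.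
  have : 1 / 2 <= r / lambda * alpha.
    by apply: le_trans alow _; rewrite ler_peMl // ltW.
  by move=> /(ler_wpM2l d0); lra.
have f3 : beta / alpha * (r * l * alpha) = r * l * beta by field; rewrite gt_eqF.
have f4 : r * l * (alpha * S + beta) = S * (r * l * alpha) + r * l * beta by ring.
rewrite f4; set P := r * l * alpha in q0 f1 f2 f3 *; set K := 128 * d / _ in f2 *.
have g1 : ((e * r)^-1 - S + K) * P = l / e * alpha - S * P + K * P.
  by rewrite 2!mulrDl mulNr f1.
have g2 : ((e * r)^-1 - S - K) * P = l / e * alpha - S * P - K * P.
  by rewrite 2!mulrDl 2!mulNr f1.
split=> H1; rewrite -(ler_pM2r q0) f3 ?g1 ?g2; move: H1 f2.
  generalize (S * P) (K * P) (r * l * beta) (l / e * alpha); clear => *; lra.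
generalize (S * P) (K * P) (r * l * beta) (l / e * alpha); clear => *; lra.
Qed.

(** All solutions at coarser scales [e] see the shift [gamma] of one fine
boundary layer function, up to [O(e)]: the boundary layer depends on [e] only
through the height of the obstacle, which changes by [O(e)]. *)
Lemma fine_layer_shift (lambda l H e' T' tau' : R) h A' u' :
  0 < lambda -> 0 < l -> fine_scale l H e' h ->
  controlled_solution lambda l H e' T' tau' h A' u' ->
  exists gamma, forall e T tau A u, fine_scale l H e h -> e' <= e ->
    controlled_solution lambda l H e T tau h A u ->
    layer_shift lambda e tau - 128 * fit_error l H / (lambda * l) * e <= gamma /\
    gamma <= layer_shift lambda e T + 128 * fit_error l H / (lambda * l) * e.
Proof.
move=> lam0 l0 [hP' fh' fs' ff'] [B' rA' eT' et' Wb'].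
have e'0 := profile_scale_gt0 _ _ _ hP'.
have H0 : 0 <= H by exact: le_trans (profile_ge0 _ _ _ hP' 0) (profile_le _ _ _ hP' 0).
have [V cV] := cell_average lambda l H e' h A' u' T' tau' l0 hP' B' rA' Wb'.
have N'tau : 15 / 16 * (l / e') <= tau'.
  by rewrite mulrA ler_pdivrMr //; lra.
have N'0 : 0 < l / e' by rewrite divr_gt0.
have tau'0 : 0 < tau' by lra.
have N'H : 32 * H <= l / e' by rewrite ler_pdivlMr.
have b0 t : bottom h e' t <= 0 by exact: bottom_le0 hP'.
have [alpha [beta [a1 fit]]] := cell_linear _ tau' H V cV b0 H0 tau'0.
have [alow aup] : 1 / 2 <= alpha /\ alpha <= 2.
  have : 8 * H / tau' <= 1 / 2 by rewrite ler_pdivrMr //; lra.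
  move=> h1; have := le_trans a1 h1; rewrite ler_norml => /andP[h2 h3].
  by split; lra.
exists (beta / alpha) => e T tau A u [hP fh fs ff] ee [B rA eT et Wb].
have e0 := profile_scale_gt0 _ _ _ hP.
pose N := l / e; pose s0 := 2 * e * H ^+ 2; pose d := fit_error l H * e.
have N0 : 0 < N by rewrite divr_gt0.
have Ne : N * e = l by rewrite /N divfK // gt_eqF.
have NN' : N <= l / e' by rewrite ler_pM2l // lef_pV2.
have NH : 32 * H <= N by rewrite ler_pdivlMr.
have Ntau : 15 / 16 * N <= tau.
  have E : 15 / 16 * N * e = 15 / 16 * l by rewrite -Ne; ring.
  by rewrite -(ler_pM2r e0) E; lra.
have s00 : 0 <= s0 by rewrite !mulr_ge0 ?exprn_ge0 // ltW.
have s0N : s0 <= N / 64.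
  have E : N / 64 * e = l / 64 by rewrite -Ne; ring.
  by rewrite -(ler_pM2r e0) E /s0; lra.
have K0 := fit_error_ge0 _ _ l0 H0.
have d0 : 0 <= d by rewrite mulr_ge0 // ltW.
have dN : d <= N / 128.
  have E : N / 128 * e = l / 128 by rewrite -Ne; ring.
  by rewrite -(ler_pM2r e0) E /d; lra.
have dE : d = 24 * (128 * H) / N + 2 * s0.
  by rewrite /d /fit_error /s0 /N; field; rewrite !gt_eqF.
have fitS S s t : N / 64 <= S + s -> S + s <= tau' / 4 -> `|s| <= s0 ->
    `|V (S + s, t) - (alpha * S + beta)| <= d.
  by rewrite dE; apply: cell_fit_shifted fit H0 N0 _; lra.
have bb t : `|bottom h e t - bottom h e' t| <= s0.
  have bE := bottom_bounds _ _ _ t hP; have bE' := bottom_bounds _ _ _ t hP'.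
  have s0' : 2 * e' * H ^+ 2 <= s0 by rewrite /s0 ler_wpM2r ?exprn_ge0 // ler_pM2l.
  by move: bE bE' s0'; rewrite -/s0 ler_norml; clear; lra.
have n16 : 0 < 15 / 16 :> R by [].
have [[w1 w2 w3 w4 w5] [w6 w7 w8]] :=
  window_arith H N tau tau' s0 d alpha N0 NH Ntau (le_trans (ler_wpM2l (ltW n16) NN') N'tau)
    s00 s0N d0 dN alow.
have CD : comparable_data lambda l H e e' T tau tau' s0 (N / 32) (N / 16) d alpha beta h A u V.
  split => // S t SP.
    have ns : `|- s0| <= s0 by rewrite normrN ger0_norm.
    by have /andP[h1 h2] := w8 S (- s0) SP ns; exact: fitS.
  have ns : `|s0| <= s0 by rewrite ger0_norm.
  by have /andP[h1 h2] := w8 S s0 SP ns; exact: fitS.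
have out := outer_estimate _ _ _ _ _ _ _ _ _ _ _ _ _ _ _ _ _ _ CD.
have inn := inner_estimate _ _ _ _ _ _ _ _ _ _ _ _ _ _ _ _ _ _ CD.
have [q1 q2] := window_quotient N alpha d N0.
rewrite -/N q1 in out; rewrite -/N q2 in inn.
have tT := radii_le _ _ _ _ rA.
have tau0 : 0 <= tau by apply: le_trans Ntau; rewrite mulr_ge0 // ltW.
have kE : 128 * fit_error l H / (lambda * l) * e = 128 * d / (lambda * l).
  by rewrite /d; ring.
rewrite kE; split.
- exact: (proj2 (shift_of_estimate lambda l e alpha beta d tau lam0 l0 e0 d0 alow tau0)).
- exact: (proj1 (shift_of_estimate lambda l e alpha beta d T lam0 l0 e0 d0 alow (le_trans tau0 tT))).
Qed.

(** Any two scales can be compared through the finer one, so the intervals that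
the solutions prescribe for the shift intersect pairwise, hence have a common
point. *)
Lemma boundary_layer_shift (lambda l H : R) h : 0 < lambda -> 0 < l ->
  exists gamma, forall e T tau A u, fine_scale l H e h ->
    controlled_solution lambda l H e T tau h A u ->
    layer_shift lambda e tau - 128 * fit_error l H / (lambda * l) * e <= gamma /\
    gamma <= layer_shift lambda e T + 128 * fit_error l H / (lambda * l) * e.
Proof.
move=> lam0 l0; pose k := 128 * fit_error l H / (lambda * l).
pose lows := [set y : R | exists e T tau A u, [/\ fine_scale l H e h,
    controlled_solution lambda l H e T tau h A u & y = layer_shift lambda e tau - k * e]].
have cross e1 T1 tau1 A1 u1 e2 T2 tau2 A2 u2 :
    fine_scale l H e1 h -> controlled_solution lambda l H e1 T1 tau1 h A1 u1 ->
    fine_scale l H e2 h -> controlled_solution lambda l H e2 T2 tau2 h A2 u2 ->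
    layer_shift lambda e1 tau1 - k * e1 <= layer_shift lambda e2 T2 + k * e2.
  move=> F1 S1 F2 S2; have [e12|/ltW e21] := leP e1 e2.
    have [g gP] := fine_layer_shift _ _ _ _ _ _ _ _ _ lam0 l0 F1 S1.
    have [g1 _] := gP _ _ _ _ _ F1 (lexx _) S1; have [_ g2] := gP _ _ _ _ _ F2 e12 S2.
    exact: le_trans g1 g2.
  have [g gP] := fine_layer_shift _ _ _ _ _ _ _ _ _ lam0 l0 F2 S2.
  have [g1 _] := gP _ _ _ _ _ F1 e21 S1; have [_ g2] := gP _ _ _ _ _ F2 (lexx _) S2.
  exact: le_trans g1 g2.
exists (sup lows) => e T tau A u F S; split.
  apply: ub_le_sup; last by exists e, T, tau, A, u.
  exists (layer_shift lambda e T + k * e) => _ [e1 [T1 [tau1 [A1 [u1 [F1 S1 ->]]]]]].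
  exact: cross F1 S1 F S.
apply: ge_sup; first by exists (layer_shift lambda e tau - k * e), e, T, tau, A, u.
move=> _ [e1 [T1 [tau1 [A1 [u1 [F1 S1 ->]]]]]].
exact: cross F1 S1 F S.
Qed.

End BoundaryLayerConstant.

(** * Hausdorff distance and the disc *)

Section HausdorffEstimate.
Context {R : realType}.
Implicit Types (u V : R * R -> R) (A Om X Y : set (R * R)) (z p q : R * R) (h : R -> R).

Lemma dist_to_le_of_ball X p (a b D : R) : 0 < a -> 0 <= D -> b - a <= D ->
  (forall q, enorm q < a -> X q) -> enorm p <= b -> (dist_to p X <= D%:E)%E.
Proof.
move=> a0 D0 abD aX pb.
have [pa|ap] := ltP (enorm p) a.
  apply: ge_ereal_inf; exists (enorm (p - p))%:E; first by exists p => //; exact: aX.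
  by rewrite lee_fin subrr /enorm /= expr0n /= addr0 sqrtr0.
apply/lee_addgt0Pr => e e0.
pose t := Num.min (a / 2) e.
have t0 : 0 < t by rewrite lt_min e0 divr_gt0.
have ta : t <= a / 2 by rewrite ge_min lexx.
have te : t <= e by rewrite ge_min lexx orbT.
have p0 : 0 < enorm p by lra.
pose s := (a - t) / enorm p.
have sp : s * enorm p = a - t by rewrite /s divfK // gt_eqF.
have s1 : s <= 1 by rewrite /s ler_pdivrMr // mul1r; lra.
have s0 : 0 <= s by rewrite /s divr_ge0 //; lra.
pose q := (s * p.1, s * p.2).
apply: ge_ereal_inf; exists (enorm (p - q))%:E.
  by exists q => //; apply: aX; rewrite enormZ ger0_norm // sp; lra.
rewrite -EFinD lee_fin.
have -> : p - q = ((1 - s) * p.1, (1 - s) * p.2).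
  by rewrite {1}[p]surjective_pairing /q; congr (_, _) => /=; ring.
rewrite enormZ ger0_norm; last by rewrite subr_ge0.
lra.
Qed.

Lemma hausdorff_le_of_balls X Y (a1 b1 a2 b2 D : R) : 0 < a1 -> 0 < a2 -> 0 <= D ->
  b1 - a2 <= D -> b2 - a1 <= D ->
  (forall q, enorm q < a1 -> X q) -> (forall q, X q -> enorm q <= b1) ->
  (forall q, enorm q < a2 -> Y q) -> (forall q, Y q -> enorm q <= b2) ->
  (hausdorff_dist X Y <= D%:E)%E.
Proof.
move=> a10 a20 D0 h1 h2 aX Xb aY Yb; rewrite /hausdorff_dist ge_max.
apply/andP; split; apply: ge_ereal_sup => _ [p Pp <-].
  exact: dist_to_le_of_ball a20 D0 h1 aY (Xb _ Pp).
exact: dist_to_le_of_ball a10 D0 h2 aX (Yb _ Pp).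
Qed.

Lemma ln_ge_1BV (x : R) : 0 < x -> 1 - x^-1 <= ln x.
Proof.
move=> x0; have := @le_ln1Dx R (x^-1 - 1).
have -> : 1 + (x^-1 - 1) = x^-1 by ring.
rewrite lnV ?posrE //; have : 0 < x^-1 by rewrite invr_gt0.
by move=> h1 h2; have := h2 ltac:(lra); lra.
Qed.

Lemma xlnx_increase (a b : R) : 1 <= a -> a <= b -> b - a <= b * ln b - a * ln a.
Proof.
move=> a1 ab; have b0 : 0 < b by lra. have a0 : 0 < a by lra.
have : 1 - (b / a)^-1 <= ln (b / a) by apply: ln_ge_1BV; rewrite divr_gt0.
rewrite ln_div ?posrE // invf_div => h1.
have h2 : b * (1 - a / b) = b - a by field; rewrite gt_eqF.
have := ler_wpM2l (ltW b0) h1; rewrite h2.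
have : 0 <= (b - a) * ln a by rewrite mulr_ge0 ?ln_ge0 // subr_ge0.
lra.
Qed.

(** For the disc the two radius bounds coincide, so the free boundary is the
circle given by the explicit radial solution. *)
Lemma disc_solution (lambda c : R) A u : 0 < lambda -> c < 1 ->
  bernoulli_solution lambda c (Omega0 R) A u ->
  exists rho, [/\ 1 < rho, lambda * (rho * ln rho) = 1 - c,
    forall x, enorm x < rho -> A x & forall x, A x -> enorm x <= rho].
Proof.
move=> lam0 c1 B.
have oOm : open (Omega0 R).
  exact: (@open_comp _ _ (@enorm R) [set t : R | t < 1] (fun t _ => @enorm_continuous R t) (@open_lt R 1)).
have O0 : Omega0 R 0 by rewrite /Omega0 /= /enorm /= expr0n /= addr0 sqrtr0.
have O1 x : enorm x < 1 -> Omega0 R x by [].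
have [p bp pmax] := outer_contact _ _ _ _ _ B (ex_intro _ _ O0).
have [q [bq qin rq]] := inner_contact _ _ _ _ _ 1 c1 ltr01 B O1.
have qp : enorm q <= enorm p by apply: pmax; case: bq.
have inn := inner_radius_bound _ _ _ _ _ q 1 c1 ltr01 B oOm O1 bq qin rq.
have out := outer_radius_bound _ _ _ _ _ p c1 B oOm O0 (fun x => id) bp pmax (lt_le_trans rq qp).
rewrite ln1 subr0 in inn.
have incr := xlnx_increase _ _ (ltW rq) qp.
have : lambda * (enorm p * ln (enorm p) - enorm q * ln (enorm q)) <= 0 by lra.
rewrite pmulr_rle0 // => h1.
have pq : enorm p = enorm q by lra.
exists (enorm q); split => //; last by move=> x Ax; rewrite -pq; apply: pmax; exact: subset_closure.
by rewrite pq in out; lra.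
Qed.

Lemma lipschitz_continuous (h : R -> R) :
  [lipschitz h x | x in [set: R]] -> continuous h.
Proof.
move=> [M0 [_ HM]] t; pose M := `|M0| + 1.
have M0' : M0 < M by rewrite /M; have := ler_norm M0; lra.
have Mp : 0 < M by rewrite /M; have := normr_ge0 M0; lra.
have L := HM M M0'.
apply/cvgrPdist_lt => e e0; apply/nbhs_ballP; exists (e / M); first by rewrite /= divr_gt0.
move=> s; rewrite -?ball_normE /= ltr_pdivlMr // mulrC => ts.
exact: le_lt_trans (L (t, s) (conj I I)) ts.
Qed.

Lemma periodic_bounded (h : R -> R) (P : R) : 0 < P -> continuous h ->
  (forall t, h (t + P) = h t) -> exists H, forall t, h t <= H.
Proof.
move=> P0 hc hp; have [m _ mP] := EVT_max (ltW P0) (continuous_subspaceT hc).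
exists (h m) => t; have [s /andP[s0 sP] ->] := periodic_reduce h P t P0 hp.
by apply: mP; rewrite in_itv /= s0 ltW.
Qed.

End HausdorffEstimate.


(** * Expansion of the free radius *)

Section FreeRadiusExpansion.
Context {R : realType}.

(** It decreases in [r] and vanishes where the radial potential that drops from
1 on the unit circle to 0 at radius [r] has slope [lambda] there. *)
Definition slope_defect (lambda r : R) : R := (lambda * r)^-1 - ln r.

Lemma slope_defect_layer_shift (lambda e S : R) : 0 < lambda -> 0 < e ->
  slope_defect lambda (expR (e * S)) = e * layer_shift lambda e S.
Proof.
move=> lam0 e0; rewrite /slope_defect /layer_shift expRK.
by field; rewrite !gt_eqF ?expR_gt0.
Qed.

Lemma radius_gap (lambda a b M D : R) : 0 < lambda -> 0 < a -> 0 < b -> b <= M ->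
  0 <= D -> slope_defect lambda a - slope_defect lambda b <= D -> b - a <= M * D.
Proof.
move=> lam0 a0 b0 bM D0 yD; have MD : 0 <= M * D by rewrite mulr_ge0 // (le_trans (ltW b0)).
have [ba|/ltW ab] := leP b a; first by apply: le_trans MD; rewrite subr_le0.
have h1 : 1 - (b / a)^-1 <= ln (b / a) by apply: ln_ge_1BV; rewrite divr_gt0.
rewrite ln_div ?posrE // invf_div in h1.
have h2 : (lambda * b)^-1 <= (lambda * a)^-1 by rewrite lef_pV2 ?posrE ?mulr_gt0 // ler_pM2l.
have h3 : b * (1 - a / b) = b - a by field; rewrite gt_eqF.
rewrite -h3; apply: le_trans (_ : b * D <= _); last by rewrite ler_wpM2r.
by rewrite ler_pM2l //; move: yD; rewrite /slope_defect; lra.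
Qed.

(** First-order expansion of the free radius of the disc for a potential drop of
[1 + e * B]; the choice of [B] makes the slope defect there equal to
[e * gamma] up to order two. *)
Lemma disc_radius_expansion (lambda e rho0 rho gamma : R) :
  let B := - (lambda * rho0 * gamma) in
  0 < lambda -> 0 < e -> 1 < rho0 -> 1 < rho ->
  lambda * (rho0 * ln rho0) = 1 -> lambda * (rho * ln rho) = 1 + e * B ->
  `|rho - rho0| <= e * (`|B| / lambda) /\
  `|slope_defect lambda rho - e * gamma| <= e ^+ 2 * (`|gamma| * `|B| / lambda).
Proof.
move=> B lam0 e0 rho01 rho1 rho0E rhoE.
have rho_gt0 : 0 < rho by lra.
have BB : lambda * (rho * ln rho - rho0 * ln rho0) = e * B by lra.
have rhod : `|rho - rho0| <= e * (`|B| / lambda).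
  rewrite mulrA ler_pdivlMr // -(gtr0_norm e0) -normrM -BB mulrC normrM (gtr0_norm lam0).
  rewrite ler_pM2l //; have [le|/ltW le] := leP rho0 rho.
    rewrite [`|rho - rho0|]ger0_norm ?subr_ge0 //; apply: le_trans (ler_norm _).
    exact: xlnx_increase (ltW rho01) le.
  rewrite [`|rho - rho0|]distrC [`|rho0 - rho|]ger0_norm ?subr_ge0 // distrC; apply: le_trans (ler_norm _).
  exact: xlnx_increase (ltW rho1) le.
split=> //.
have E : (slope_defect lambda rho - e * gamma) * rho = e * gamma * (rho0 - rho).
  have E1 : lambda * (slope_defect lambda rho * rho) = 1 - lambda * (rho * ln rho).
    by rewrite /slope_defect; field; rewrite !gt_eqF.
  have E2 : lambda * (slope_defect lambda rho * rho) = lambda * (e * (rho0 * gamma)).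
    by rewrite E1 rhoE /B; ring.
  have {}E2 := mulfI (lt0r_neq0 lam0) E2.
  by rewrite mulrBl E2; ring.
have nE : `|slope_defect lambda rho - e * gamma| * rho = e * `|gamma| * `|rho - rho0|.
  by rewrite -[X in _ * X = _](gtr0_norm rho_gt0) -normrM E !normrM (gtr0_norm e0) distrC.
rewrite -(ler_pM2r rho_gt0) nE.
have h1 : e * `|gamma| * `|rho - rho0| <= e * `|gamma| * (e * (`|B| / lambda)).
  by rewrite ler_wpM2l // mulr_ge0 // ltW.
apply: le_trans h1 _.
have -> : e * `|gamma| * (e * (`|B| / lambda)) = e ^+ 2 * (`|gamma| * `|B| / lambda) by ring.
rewrite ler_peMr //; last exact: ltW.
by rewrite mulr_ge0 ?sqr_ge0 // divr_ge0 ?mulr_ge0 // ltW.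
Qed.

Lemma small_scale (l H B : R) : 0 < l -> 0 <= H -> exists2 M : R, 0 < M &
  forall e, 0 < e -> e < M^-1 ->
  [/\ e <= 1, e * `|B| < 1, e * H <= 1 / 2 & [/\ 32 * H * e <= l,
     128 * H ^+ 2 * e ^+ 2 <= l & 128 * fit_error l H * e ^+ 2 <= l]].
Proof.
move=> l0 H0; have F0 := fit_error_ge0 _ _ l0 H0.
pose x1 := 2 * H; pose x2 := 32 * H / l; pose x3 := 128 * H ^+ 2 / l.
pose x4 := 128 * fit_error l H / l; pose x5 := `|B|.
have p1 : 0 <= x1 by rewrite mulr_ge0.
have p2 : 0 <= x2 by rewrite divr_ge0 ?mulr_ge0 // ltW.
have p3 : 0 <= x3 by rewrite divr_ge0 ?mulr_ge0 ?exprn_ge0 // ltW.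
have p4 : 0 <= x4 by rewrite divr_ge0 ?mulr_ge0 // ltW.
have p5 : 0 <= x5 by exact: normr_ge0.
pose M := 1 + x1 + x2 + x3 + x4 + x5.
have M0 : 0 < M by rewrite /M; move: p1 p2 p3 p4 p5; clear; lra.
exists M => // e e0 eMV; have eM : e * M < 1 by rewrite -ltr_pdivlMr // mul1r.
have small x : x <= M -> e * x < 1 by move=> xM; apply: le_lt_trans eM; rewrite ler_pM2l.
have le_M : [/\ 1 <= M, x1 <= M, x2 <= M, x3 <= M & x4 <= M /\ x5 <= M].
  by rewrite /M; move: p1 p2 p3 p4 p5; clear => *; do ?split; lra.
have [/small s0 /small s1 /small s2 /small s3 [/small s4 /small s5]] := le_M.
have e1 : e <= 1 by rewrite -[e]mulr1 ltW.
have ee : e ^+ 2 <= e by rewrite expr2 ler_piMr // ltW.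
have sl x : e * (x / l) < 1 -> x * e <= l by rewrite mulrA ltr_pdivrMr // mul1r mulrC => /ltW.
have sl2 x : 0 <= x -> e * (x / l) < 1 -> x * e ^+ 2 <= l.
  by move=> x0 /sl; apply: le_trans; rewrite ler_wpM2l.
split=> //; first by move: s1; rewrite /x1; lra.
by split; [exact: sl|apply: sl2 => //; rewrite mulr_ge0 ?exprn_ge0|apply: sl2 => //; rewrite mulr_ge0].
Qed.

End FreeRadiusExpansion.

(** * The second-order estimate *)

Theorem theorem1 (R : realType) (lambda : R) (h : R -> R) :
  0 < lambda ->
  (forall t : R, 0 <= h t) ->
  (forall t : R, h (t + 2 * pi) = h t) ->
  [lipschitz h x | x in [set: R]] ->
  exists B0 C : R, \forall e \near (0 : R)^'+,
    (exists n : nat, e^-1 = n%:R) ->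
    (forall t : R, h t < e^-1) ->
    forall (A A0 : set (R * R)) (u u0 : R * R -> R),
      bernoulli_solution lambda 0 (Omega h e) A u ->
      bernoulli_solution lambda (- (e * B0)) (Omega0 R) A0 u0 ->
      (hausdorff_dist A0 A <= (C * e ^+ 2)%:E)%E.
Proof.
move=> lam0 h0 hper hlip.
have hc := lipschitz_continuous _ hlip.
have hp t : h (t + pi *+ 2) = h t by rewrite -mulr_natl hper.
have p2 : 0 < (pi : R) *+ 2 by rewrite mulrn_wgt0 // pi_gt0.
have [H hH] := periodic_bounded h _ p2 hc hp.
have H0 : 0 <= H by exact: le_trans (h0 0) (hH 0).
have [l l0 lE] := unperturbed_radius lambda lam0.
have [gamma gammaP] := boundary_layer_shift lambda l H h lam0 l0.
pose rho0 := expR l.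
have rho01 : 1 < rho0 by rewrite -expR0 ltr_expR.
have rho0E : lambda * (rho0 * ln rho0) = 1 by rewrite /rho0 expRK -[RHS]lE; ring.
pose B0 := - (lambda * rho0 * gamma).
pose k := 128 * fit_error l H / (lambda * l).
have k0 : 0 <= k by rewrite divr_ge0 ?mulr_ge0 ?fit_error_ge0 // ltW.
pose K2 := `|gamma| * `|B0| / lambda.
have K20 : 0 <= K2 by rewrite divr_ge0 ?mulr_ge0 // ltW.
pose M := rho0 + `|B0| / lambda.
have B0l : 0 <= `|B0| / lambda by rewrite divr_ge0 // ltW.
have [E E0 small] := small_scale l H B0 l0 H0.
exists B0, (M * (k + K2)).
near=> e.
have e0 : 0 < e by near: e; exact: nbhs_right_gt.
have eE : e < E^-1 by near: e; apply: nbhs_right_lt; rewrite invr_gt0.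
move=> en _ A A0 u u0 B B'.
have [e1 eB eH [f1 f2 f3]] := small e e0 eE.
have hP : profile h H e by split.
have F : fine_scale l H e h by split.
have He : 2 * H * e < l.
  by have : 0 <= H * e; [rewrite mulr_ge0 // ltW|lra].
have [T [tau [rA eT et Wb]]] := potential_bounds lambda l H e h A u lam0 l0 lE hP He B.
have [glow gup] := gammaP e T tau A u F (ControlledSolution _ _ _ _ _ _ _ _ _ B rA eT et Wb).
have c1 : - (e * B0) < 1.
  by apply: le_lt_trans eB; rewrite -mulrN ler_pM2l // -normrN ler_norm.
have [rho [rho1 rhoE rhoin rhoout]] := disc_solution lambda _ A0 u0 lam0 c1 B'.
rewrite opprK in rhoE.
have [rhod defect] := disc_radius_expansion lambda e rho0 rho gamma lam0 e0 rho01 rho1 rho0E rhoE.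
have rho_gt0 : 0 < rho by exact: lt_trans rho1.
have rhoM : rho <= M.
  rewrite -lerBlDl; apply: le_trans (ler_norm _) _; apply: le_trans rhod _.
  by rewrite ler_piMl.
have routM : expR (e * T) <= M.
  by apply: le_trans (_ : rho0 <= _); [rewrite ler_expR|rewrite lerDl].
have D0 : 0 <= (k + K2) * e ^+ 2 by rewrite mulr_ge0 ?addr_ge0 ?sqr_ge0.
have yin : slope_defect lambda (expR (e * tau)) <= e * gamma + k * e ^+ 2.
  rewrite slope_defect_layer_shift // -lerBlDr expr2 mulrCA -mulrBr ler_pM2l //.
have yout : e * gamma - k * e ^+ 2 <= slope_defect lambda (expR (e * T)).
  by rewrite slope_defect_layer_shift // lerBlDr expr2 mulrCA -mulrDr ler_pM2l.
rewrite -mulrA.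
apply: (hausdorff_le_of_balls A0 A rho rho (expR (e * tau)) (expR (e * T))) => //.
- exact: expR_gt0.
- by rewrite mulr_ge0 // addr_ge0 // ltW // expR_gt0.
- apply: (radius_gap lambda) => //; first exact: expR_gt0.
  by move: yin defect D0; rewrite ler_norml -/B0 -/K2; clear; lra.
- apply: (radius_gap lambda) => //; first exact: expR_gt0.
  by move: yout defect D0; rewrite ler_norml -/B0 -/K2; clear; lra.
- exact: radii_inner_ball rA.
- by move=> x Ax; apply: (radii_outer_bound _ _ _ _ rA); exact: subset_closure.
Unshelve. all: by end_near. Qed.
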